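(* Suppose the base points of the partition bars evolve according to the partition dynamics $$\dot{\mathbf{s}}_i=-\kappa_s\,(m_i-m_{i-1})\,\nu_i,\qquad i\in\mathbb{I}_N=\{1,\dots,N\}.$$ Then the workloads of all subregions are equalized, i.e. $\lim_{t\to\infty}\big(m_i(t)-m_j(t)\big)=0$ for all $i,j\in\mathbb{I}_N$.
   Context: $\Omega\subset\mathbb{R}^2$ is an annular region bounded by two closed smooth curves: an inner boundary curve $l_{\text{in}}$, which encloses a convex region, and an outer boundary curve $l_{\text{out}}$, which encloses a star-shaped region. There are $N$ agents, with indices taken cyclically modulo $N$ (index $0$ means $N$, index $N+1$ means $1$). Agent $i$ has a virtual partition bar with base point $\mathbf{s}_i$ on the inner boundary $l_{\text{in}}$: $\xi_i=\{\mathbf{q}\in\Omega:(\mathbf{q}-\mathbf{s}_i)^T\nu_i=0\}$, where $\nu_i$ is the unit tangent vector to the inner boundary at $\mathbf{s}_i$; of this set one takes the piece emanating from $\mathbf{s}_i$ and running to the outer boundary (the connected component containing $\mathbf{s}_i$). The bars divide $\Omega$ into $N$ subregions; $\Omega_i$ is the subregion bounded by $l_{\text{in}}$, $l_{\text{out}}$, $\xi_i$ and $\xi_{i+1}$. The density $\rho:\Omega\to\mathbb{R}^+$ takes values in a bounded interval $[\underline{\rho},\bar{\rho}]$. The workload on $\Omega_i$ is $m_i=\int_{\Omega_i}\rho(\mathbf{q})\,d\mathbf{q}$, and $m_i(t)$ is its value at time $t$ along a solution of the partition dynamics. The orientation of $\nu_i$ is such that $m_i$ increases when $\mathbf{s}_i$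 moves in the direction $\nu_i$. $\kappa_s>0$ is a constant gain. *)

(* Defs.v *)
(* MathComp-Analysis *)
From HB Require Import structures.
From mathcomp Require Import all_boot all_order all_algebra.
From mathcomp Require Import all_classical all_reals all_analysis.

Set Implicit Arguments.
Unset Strict Implicit.
Unset Printing Implicit Defensive.

Import Order.TTheory GRing.Theory Num.Theory numFieldNormedType.Exports.

Local Open Scope classical_set_scope.
Local Open Scope ring_scope.

(* The norm that the library puts on R * R is the sup norm; lengths and angles
   are therefore expressed with [dot]. *)
Definition dot (R : realType) (p q : R * R) : R := p.1 * q.1 + p.2 * q.2.

(* A closed curve is given by a regular parametrization of period 1, which may
   run clockwise or counterclockwise. *)
Definition smooth_simple_closed (R : realType) (gamma : R -> R * R) : Prop :=
  [/\ forall x, gamma (x + 1) = gamma x,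
      forall x y, gamma x = gamma y -> exists k : int, y = x + k%:~R,
      forall n x, derivable (derive1n n gamma) x 1
    & forall x, derive1 gamma x != 0].

(* D is the bounded domain with boundary curve gamma; since gamma is a simple
   closed curve there is exactly one such D. *)
Definition encloses (R : realType) (gamma : R -> R * R)
    (D : set (R * R)) : Prop :=
  [/\ open D, connected D, bounded_set D, D !=set0
    & closure D `\` D = range gamma].

Definition star_shaped (R : realType) (D : set (R * R)) : Prop :=
  exists2 c, D c &
    forall q (l : R), D q -> 0 <= l <= 1 -> D ((1 - l) *: c + l *: q).

(* The inner boundary curve belongs to the annular region, so that a bar
   contains its base point; the outer one (a null set) does not, so that a bar
   ends where it first meets the outer boundary. *)
Definition annulus (R : realType) (Din Dout : set (R * R)) : set (R * R) :=
  Dout `\` Din.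

Definition unit_tangent (R : realType) (gamma : R -> R * R) (x : R) : R * R :=
  let v := derive1 gamma x in (Num.sqrt (dot v v))^-1 *: v.

(* The bar with base point [gamma x].  Its defining equation does not depend
   on which of the two unit tangent vectors is used. *)
Definition bar (R : realType) (Omega : set (R * R)) (gamma : R -> R * R)
    (x : R) : set (R * R) :=
  connected_component
    [set q | Omega q /\ dot (q - gamma x) (unit_tangent gamma x) = 0]
    (gamma x).

(* A configuration is given by curve parameters u i of the base points
   gamma (u i).  [next_base u i] is the parameter of base point i + 1, where the
   base point following the last one is the first one, a full turn later. *)
Definition next_base (R : realType) (N : nat) (u : 'I_N -> R) (i : 'I_N) : R :=
  if i.+1 == N then u (ordS i) + 1 else u (ordS i).

Definition cyclically_ordered (R : realType) (N : nat) (u : 'I_N -> R) : Prop :=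
  forall i, u i < next_base u i.

(* The part of Omega, cut along all bars, which is adjacent to the open arc of
   the inner boundary running from base point i to base point i + 1.  For a
   cyclically ordered configuration this arc is connected and meets no bar, so
   the union is a single connected component. *)
Definition subregion (R : realType) (Omega : set (R * R))
    (gamma : R -> R * R) (N : nat) (u : 'I_N -> R) (i : 'I_N) : set (R * R) :=
  \bigcup_(x in [set x | u i < x < next_base u i])
    connected_component (Omega `\` \bigcup_(j in [set: 'I_N])
                                      bar Omega gamma (u j)) (gamma x).

Definition workload (R : realType) (Omega : set (R * R)) (rho : R * R -> R)
    (gamma : R -> R * R) (N : nat) (u : 'I_N -> R) (i : 'I_N) : R :=
  \int[(@lebesgue_measure R \x @lebesgue_measure R)%E]_(q in
    subregion Omega gamma u i) rho q.

Definition move_base (R : realType) (N : nat) (u : 'I_N -> R) (i : 'I_N) (x : R) :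
    'I_N -> R :=
  fun j => if j == i then x else u j.

(* v is the unit tangent vector at base point i such that the workload of
   subregion i increases when this base point alone moves in direction v. *)
Definition oriented_tangent (R : realType) (Omega : set (R * R))
    (rho : R * R -> R) (gamma : R -> R * R) (N : nat) (u : 'I_N -> R)
    (i : 'I_N) (v : R * R) : Prop :=
  exists e : R,
    [/\ e = 1 \/ e = -1,
        v = e *: unit_tangent gamma (u i)
      & \forall h \near 0^'+,
          workload Omega rho gamma u i <
          workload Omega rho gamma (move_base u i (u i + e * h)) i].

(* Main.v *)
(* The projection onto the convex inner region gives every point outside it a
   foot on the inner curve, so the bars are disjoint normal segments, and because
   the outer region is star-shaped any two of them separate the annulus into
   exactly two pieces.  Hence the workload between consecutive base points a and b
   is M(b) - M(a) for a nondecreasing function M with M(x + 1) = M(x) + T.  The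
   function M need not be continuous: it jumps where a bar touches the outer
   curve tangentially and a whole pocket changes sides.

   In the arc-length coordinates w_i of the base points the dynamics reads
   w_i' = kappa (m_i - m_(i-1)) with m_i = M_(i+1) - M_i, a nonlinear diffusion on
   the cycle, that is, the gradient flow of a convex potential for a discrete
   negative Sobolev norm.  The flow is a contraction for this norm, so its speed,
   a multiple of E = sum_i (m_i - T/N)^2, is nonincreasing; the potential is
   bounded below and decreases at least at the rate kappa E.  Both facts need only
   the monotonicity of M, and together they force E to tend to 0. *)
Require Import Defs.
From HB Require Import structures.
From mathcomp Require Import all_boot all_order all_algebra.
From mathcomp Require Import all_classical all_reals all_analysis.
From mathcomp Require Import ring lra zify.

Set Implicit Arguments.
Unset Strict Implicit.
Unset Printing Implicit Defensive.

Import Order.TTheory GRing.Theory Num.Theory numFieldNormedType.Exports.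

Local Open Scope classical_set_scope.
Local Open Scope ring_scope.

(** Two points carry most of the work. Separation by two bars is proved by an explicit function
    rather than by a theorem on closed curves. Plane points are treated as complex numbers, and
    ratios built from the end points of the bars are combined so that their product is constant up
    to positive factors. Each ratio has a principal square root that is continuous off its own slit;
    away from the bars the product of the roots has a locally constant direction, and it changes
    sign at a bar because exactly one root jumps there. Collisions are the second point: the formula
    for the workloads needs the base points in cyclic order, which is assumed at time 0 only. At a
    first collapse, the strict increase demanded of the orientation gives the preceding subregion a
    positive workload, which drives the two bars apart. The parameters [u i] are merely continuous,
    so derivatives are taken in the arc-length coordinate, and no continuity of the workloads in
    time is used. *)

Section RealTools.
Context {R : realType}.

Lemma is_derive_nearP (f : R -> R) (x a : R) : is_derive x 1 f a ->
  forall e : R, 0 < e -> \forall z \near x,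
    `|f z - f x - a * (z - x)| <= e * `|z - x|.
Proof.
move=> /is_derive1_caratheodory[g [fg gx gxa]] e e0.
have : \forall z \near x, `|g x - g z| < e by move/cvgrPdist_lt : gx; exact.
apply: filterS => z; rewrite gxa fg -mulrBl normrM => ge.
by rewrite ler_wpM2r// distrC ltW.
Qed.

Lemma is_derive_cvgr (f : R -> R) (x a : R) : is_derive x 1 f a -> f z @[z --> x] --> f x.
Proof.
move=> [/derivable1_diffP d _].
exact: differentiable_continuous d.
Qed.

Lemma is_derive_fst (f : R -> R * R) (x : R) (v : R * R) :
  is_derive x 1 f v -> is_derive x 1 (fun t => (f t).1) v.1.
Proof.
move=> [df dfE].
have H : (fun h => h^-1 *: ((f \o shift x) (h *: 1) - f x)) h @[h --> 0^'] --> v.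
  by rewrite -dfE; exact: df.
have H1 : (fun h => h^-1 *: (((fun t => (f t).1) \o shift x) (h *: 1) - (f x).1)) h @[h --> 0^'] --> v.1.
  exact: (@cvg_comp _ _ _ _ fst _ _ (nbhs v.1) H (@cvg_fst _ _ (nbhs v.1) (nbhs v.2) _)).
split; first exact: cvgP H1.
exact: cvg_lim H1.
Qed.

Lemma is_derive_snd (f : R -> R * R) (x : R) (v : R * R) :
  is_derive x 1 f v -> is_derive x 1 (fun t => (f t).2) v.2.
Proof.
move=> [df dfE].
have H : (fun h => h^-1 *: ((f \o shift x) (h *: 1) - f x)) h @[h --> 0^'] --> v.
  by rewrite -dfE; exact: df.
have H1 : (fun h => h^-1 *: (((fun t => (f t).2) \o shift x) (h *: 1) - (f x).2)) h @[h --> 0^'] --> v.2.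
  exact: (@cvg_comp _ _ _ _ snd _ _ (nbhs v.2) H (@cvg_snd _ _ (nbhs v.1) (nbhs v.2) _)).
split; first exact: cvgP H1.
exact: cvg_lim H1.
Qed.

Lemma le0_is_derive_nonincreasing (f df : R -> R) (a b : R) : a <= b ->
  (forall t, a <= t <= b -> is_derive t 1 f (df t)) ->
  (forall t, a <= t <= b -> df t <= 0) -> f b <= f a.
Proof.
rewrite le_eqVlt => /orP[/eqP->//|ab] fd df0.
have [||c cab E] := @MVT R f df a b ab.
- by move=> t /itvP tab; apply: fd; rewrite !tab.
- apply: derivable_within_continuous => t /itvP tab.
  by apply: ex_derive; apply: fd; rewrite !tab.
- rewrite -subr_le0 E; apply: mulr_le0_ge0; last by rewrite subr_ge0 ltW.
  by apply: df0; rewrite !(itvP cab).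
Qed.

(** The infimum of the points where [f] is at least [f b] belongs to that set by the bound on the
    right, and the condition on the left would push it further down unless it is [a]. This replaces
    a derivative test for the potential, which is only estimated from one side. *)
Lemma left_nonincreasing (f : R -> R) (a b : R) : a <= b ->
  (forall t, a < t -> t <= b -> \forall s \near t, s <= t -> f t <= f s) ->
  (forall t, a <= t -> t < b -> forall e, 0 < e ->
    \forall s \near t, t <= s -> f s <= f t + e) ->
  f b <= f a.
Proof.
move=> ab fl fr.
pose S := [set s | a <= s <= b /\ f b <= f s].
have Sb : S b by split; rewrite ?ab ?lexx.
have lS : has_lbound S by exists a => s [/andP[]].
have iS : has_inf S by split => //; exists b.
set c := inf S.
have ac : a <= c by apply: lb_le_inf; [exists b|move=> s [/andP[]]].
have cb : c <= b by exact: ge_inf.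
have fc : f b <= f c.
  move: cb; rewrite le_eqVlt => /orP[/eqP->//|cb].
  apply/ler_addgt0Pr => e e0.
  have /nbhs_ballP[d /= d0 H] := fr _ ac cb _ e0.
  have [s Ss sd] := inf_adherent d0 iS.
  have cs : c <= s by exact: ge_inf.
  have bs : ball c d s by rewrite /ball /= distrC ger0_norm ?subr_ge0// ltrBlDl.
  by case: Ss => _ /le_trans; apply; exact: H s bs cs.
move: ac; rewrite le_eqVlt => /orP[/eqP->//|ac].
have /nbhs_ballP[d /= d0 H] := fl _ ac cb.
pose s := Num.max a (c - d / 2).
have sc : s < c by rewrite gt_max ac /= ltrBlDl ltrDr divr_gt0.
have fs : f c <= f s.
  apply: H; last exact: ltW.
  rewrite /ball /= ger0_norm ?subr_ge0 1?ltW//.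
  have : c - d / 2 <= s by rewrite le_max lexx orbT.
  lra.
have : S s.
  split; last exact: le_trans fs.
  by rewrite le_max lexx/= (le_trans (ltW sc)).
by move=> /(ge_inf lS); rewrite leNgt sc.
Qed.

End RealTools.

(** * Monotone diffusion on a cycle *)

Section Consensus.
Context {R : realType}.

Lemma sum_by_parts_cyclic (N : nat) (a b : 'I_N -> R) :
  \sum_i a i * (b (ordS i) - b i) = - \sum_i b i * (a i - a (ord_pred i)).
Proof.
under eq_bigr do rewrite mulrBr.
under [in RHS]eq_bigr do rewrite mulrBr.
rewrite !sumrB opprB [X in _ = X - _](reindex_inj (bij_inj (ordS_bij _)))/=.
congr (_ - _); apply: eq_bigr => i _; last by rewrite mulrC.
by rewrite ordSK mulrC.
Qed.

Lemma cvg_sumr (T : Type) (G : set_system T) (FG : Filter G) (I : finType)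
    (f : I -> T -> R) (l : I -> R) :
  (forall i, f i x @[x --> G] --> l i) ->
  \sum_i f i x @[x --> G] --> \sum_i l i.
Proof.
move=> fl; elim: (index_enum I) => [|i r IH].
  under eq_cvg do rewrite big_nil.
  by rewrite big_nil; exact: cvg_cst.
under eq_cvg do rewrite big_cons.
by rewrite big_cons; exact: cvgD (fl i) IH.
Qed.

Section flow.
(** Intended reading: [w i] is the arc-length coordinate of base point [i], [y i] the cumulative
    workload there, [F i] a convex potential with subgradient [y i], and [c i] the correction for
    the full turn. [g] is a discrete primitive of [w] along the cycle, so that the Euclidean norm of
    its increments is the negative Sobolev norm of those of [w]. *)
Variables (N : nat) (k mu : R) (g m y w F : 'I_N -> R -> R) (c : 'I_N -> R).
Hypothesis k0 : 0 < k.
Hypothesis dg : forall i (t : R), 0 < t -> is_derive t 1 (g i) (k * (m i t - mu)).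
Hypothesis gw : forall i (s t : R), 0 < s -> 0 < t ->
  (g i t - g i s) - (g (ord_pred i) t - g (ord_pred i) s) = w i t - w i s.
Hypothesis sum_g : forall s t : R, 0 < s -> 0 < t -> \sum_i (g i t - g i s) = 0.
Hypothesis my : forall i (t : R), 0 < t -> m i t = y (ordS i) t - y i t + c i.
Hypothesis y_mono : forall i (s t : R), 0 < s -> 0 < t ->
  0 <= (w i t - w i s) * (y i t - y i s).
Hypothesis F_convex : forall i (s t : R), 0 < s -> 0 < t ->
  y i t * (w i s - w i t) <= F i s - F i t.

Let E t := \sum_i (m i t - mu) ^+ 2.
Let Q t := \sum_i (F i t - c i * g i t).

(* Since [y] is monotone in [w], the flow contracts the distance measured by [g];
   this is applied to the solution and its own translate by the delay [h]. *)
Lemma flow_displacement_nonincreasing (h s t : R) : 0 < h -> 0 < s -> s <= t ->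
  \sum_i (g i (t + h) - g i t) ^+ 2 <= \sum_i (g i (s + h) - g i s) ^+ 2.
Proof.
move=> h0 s0 st.
pose D := fun t => \sum_i (g i (t + h) - g i t) ^+ 2.
pose D' := fun t => \sum_i (2 * (g i (t + h) - g i t) * (k * (m i (t + h) - m i t))).
apply: (@le0_is_derive_nonincreasing _ D D' _ _ st) => r /andP[sr rt].
  have r0 : 0 < r by exact: lt_le_trans sr.
  have rh0 : 0 < r + h by rewrite addr_gt0.
  rewrite /D.
  have -> : (fun t => \sum_i (g i (t + h) - g i t) ^+ 2) =
     \sum_i (fun t => (g i (t + h) - g i t) ^+ 2).
    by apply/funext => z; rewrite fct_sumE.
  apply: is_derive_sum => i.
  have d1 := dg i r0.
  have d2 : is_derive r 1 (fun t => g i (t + h)) (k * (m i (r + h) - mu)).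
    have d3 : is_derive r 1 (fun t : R => t + h) (1 + 0) by apply: is_deriveD.
    have := @is_derive1_comp _ (g i) (fun t => t + h) r _ _ (dg i rh0) d3.
    by rewrite addr0 mulr1.
  have d4 : is_derive r 1 (fun t => g i (t + h) - g i t)
     (k * (m i (r + h) - mu) - k * (m i r - mu)) by apply: is_deriveB.
  have -> : (fun t => (g i (t + h) - g i t) ^+ 2) =
    ((fun t => g i (t + h) - g i t) * (fun t => g i (t + h) - g i t)).
    by apply/funext => z; rewrite expr2.
  apply: is_derive_eq.
  rewrite /GRing.scale /=; ring.
have r0 : 0 < r by exact: lt_le_trans sr.
have rh0 : 0 < r + h by rewrite addr_gt0.
rewrite /D'.
under eq_bigr => i _.
  have -> : 2 * (g i (r + h) - g i r) * (k * (m i (r + h) - m i r)) =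
    2 * k * ((g i (r + h) - g i r) *
      ((y (ordS i) (r + h) - y (ordS i) r) - (y i (r + h) - y i r))).
    rewrite !my//; ring.
  over.
rewrite -mulr_sumr (sum_by_parts_cyclic _ (fun i => y i (r + h) - y i r)).
rewrite mulrN oppr_le0; apply: mulr_ge0; first by rewrite mulr_ge0// ltW.
by apply: sumr_ge0 => i _; rewrite gw// mulrC y_mono.
Qed.

(* Dividing by the delay gives the speed of [g], which equals the energy up to a
   constant: no regularity of [m] in time is needed. *)
Lemma flow_energy_nonincreasing (s t : R) : 0 < s -> s <= t -> E t <= E s.
Proof.
move=> s0 st.
have t0 : 0 < t by exact: lt_le_trans st.
have lim (r : R) : 0 < r -> \sum_i (h^-1 * (g i (r + h) - g i r)) ^+ 2 @[h --> 0^'+] -->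
    k ^+ 2 * E r.
  move=> r0; rewrite /E mulr_sumr; apply: cvg_sumr => i.
  have [d dE] := dg i r0.
  have H : h^-1 * (g i (r + h) - g i r) @[h --> 0^'] --> k * (m i r - mu).
    rewrite -dE; apply: cvg_trans d; apply: near_eq_cvg; near=> h => /=.
    by rewrite /GRing.scale/= mulr1 [h + r]addrC.
  move/cvg_dnbhs_at_right : H => H.
  rewrite -exprMn expr2; under eq_cvg do rewrite expr2.
  exact: cvgM.
have kE : k ^+ 2 * E t <= k ^+ 2 * E s.
  apply: ler_cvg_to (lim _ t0) (lim _ s0) _.
  near=> h.
  have h0 : 0 < h by near: h; exact: nbhs_right_gt.
  under eq_bigr do rewrite exprMn.
  under [leRHS]eq_bigr do rewrite exprMn.
  rewrite -!mulr_sumr ler_wpM2l ?sqr_ge0//.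
  exact: flow_displacement_nonincreasing.
by rewrite ler_pM2l ?exprn_gt0 in kE.
Unshelve. all: by end_near.
Qed.

(** Convexity with the subgradient at time [t], then summation by parts; subtracting [mu] is free
    because the increments of [g] sum to zero. Looking back from [t], the factor [m i t] is frozen
    and yields a rate; looking forward, it has to be bounded by the energy. *)
Lemma flow_potential_le (s t : R) : 0 < s -> 0 < t ->
  Q t - Q s <= - \sum_i (g i t - g i s) * (m i t - mu).
Proof.
move=> s0 t0.
have -> : \sum_i (g i t - g i s) * (m i t - mu) =
    \sum_i (g i t - g i s) * (y (ordS i) t - y i t) +
    \sum_i c i * (g i t - g i s).
  rewrite -big_split/= [RHS](_ : _ = \sum_i (g i t - g i s) * (m i t - mu) +
     mu * \sum_i (g i t - g i s)); last first.
    rewrite mulr_sumr -big_split/=; apply: eq_bigr => i _; rewrite my//; ring.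
  by rewrite sum_g// mulr0 addr0.
rewrite (sum_by_parts_cyclic (fun i => g i t - g i s) (fun i => y i t)).
rewrite /Q -sumrB opprD opprK -sumrN -big_split/=; apply: ler_sum => i _.
rewrite gw//; have := F_convex i s0 t0.
set A := y i t; rewrite !mulrBr; lra.
Qed.

Lemma flow_consensus (C : R) : (forall t : R, 1 <= t -> C <= Q t) ->
  forall i, m i t @[t --> +oo] --> mu.
Proof.
move=> QC.
have E0 t : 0 <= E t by apply: sumr_ge0 => i _; exact: sqr_ge0.
have small (e : R) : 0 < e -> exists2 t, 1 <= t & E t < e.
  move=> e0; apply: contrapT => H.
  have Ee t : 1 <= t -> e <= E t.
    by move=> t1; rewrite leNgt; apply/negP => lt; apply: H; exists t.
  (* Half of the rate [k * e]; the other half absorbs the error of linearizing at a point. *)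
  pose q := k * e / 2.
  have q0 : 0 < q by rewrite divr_gt0// mulr_gt0.
  have dec (t : R) : 1 <= t -> Q t + q * t <= Q 1 + q * 1.
    move=> t1.
    apply: (@left_nonincreasing _ (fun t => Q t + q * t) 1 t) => //.
      move=> r r1 rt.
      have r0 : 0 < r by lra.
      (* The workloads are frozen at time [r], which makes [G] differentiable there with derivative
         [k * E r], whatever [m] does nearby. *)
      pose G := fun s => \sum_i g i s * (m i r - mu).
      have dG : is_derive r 1 G (k * E r).
        have -> : G = \sum_i (fun s => g i s * (m i r - mu)).
          by apply/funext => z; rewrite fct_sumE.
        rewrite /E mulr_sumr; apply: is_derive_sum => i.
        have di := dg i r0.
        have -> : (fun s => g i s * (m i r - mu)) = (m i r - mu) \*: g i.
          by apply/funext => z; rewrite /GRing.scale/= mulrC.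
        by apply: is_derive_eq; rewrite /GRing.scale/=; ring.
      near=> s => sr.
      have s0 : 0 < s by near: s; exact: lt_nbhsr.
      have : `|G s - G r - k * E r * (s - r)| <= q * `|s - r|.
        by near: s; exact: is_derive_nearP.
      rewrite ler_norml => /andP[_ Gs].
      have rs : `|s - r| = r - s by rewrite ler0_norm ?subr_le0// opprB.
      have := flow_potential_le s0 r0.
      have -> : \sum_i (g i r - g i s) * (m i r - mu) = G r - G s.
        by rewrite /G -sumrB; apply: eq_bigr => i _; rewrite mulrBl.
      have : k * e * (r - s) <= k * E r * (r - s).
        by rewrite ler_wpM2r ?subr_ge0// ler_wpM2l ?(ltW k0)// Ee// ltW.
      move: Gs; rewrite rs /q; lra.
    move=> r r1 rt d d0.
    have r0 : 0 < r by lra.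
    (* Bounds every [|m i s - mu|] with [s] after [r], by [|x| <= 1 + x ^+ 2] and the monotone
       energy; this keeps [Q] from jumping up. *)
    pose B := 1 + E r.
    have Hc : B * (\sum_i `|g i s - g i r|) + q * (s - r) @[s --> r] -->
        B * (\sum_(i < N) `|g i r - g i r|) + q * (r - r).
      apply: cvgD; apply: cvgMr.
        apply: cvg_sumr => i; apply: cvg_norm; apply: cvgB; last exact: cvg_cst.
        exact: is_derive_cvgr (dg i r0).
      by apply: cvgB; [exact: cvg_id|exact: cvg_cst].
    have H0 : B * (\sum_i `|g i s - g i r|) + q * (s - r) @[s --> r] --> 0.
      move: Hc; rewrite subrr mulr0 addr0 [X in _ --> B * X]big1 ?mulr0// => i _.
      by rewrite subrr normr0.
    near=> s => rs.
    have s0 : 0 < s by lra.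
    have : B * (\sum_i `|g i s - g i r|) + q * (s - r) < d.
      by near: s; move/cvgr_lt : H0; exact.
    have := flow_potential_le r0 s0.
    suff : - (\sum_i (g i s - g i r) * (m i s - mu)) <= B * (\sum_i `|g i s - g i r|).
      lra.
    rewrite -sumrN mulr_sumr; apply: ler_sum => i _.
    apply: le_trans (ler_norm _) _; rewrite normrN normrM mulrC ler_wpM2r//.
    have : (m i s - mu) ^+ 2 <= E r.
      apply: le_trans (flow_energy_nonincreasing r0 rs).
      rewrite /E (bigD1 i)//= lerDl; apply: sumr_ge0 => j _; exact: sqr_ge0.
    rewrite -real_normK ?num_real// /B.
    have := sqr_ge0 (`|m i s - mu| - 1); have := normr_ge0 (m i s - mu).
    nra.
  (* The time by which the linear decay has brought [Q] down to [C - 1]. *)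
  pose t := 1 + (Q 1 - C + 1) / q.
  have t1 : 1 <= t.
    rewrite /t lerDl divr_ge0 ?(ltW q0)//.
    have := QC 1 (lexx _); lra.
  have := dec t t1; have := QC t t1.
  have : q * t = q + (Q 1 - C + 1) by rewrite /t mulrDr mulr1 [q * (_ / q)]mulrC divfK ?gt_eqF.
  lra.
move=> i; apply/cvgrPdist_lt => e e0.
have [t t1 Et] := small (e ^+ 2) (exprn_gt0 _ e0).
near=> s.
have ts : t <= s by near: s; apply: nbhs_pinfty_ge; rewrite num_real.
rewrite distrC -ltr_sqr ?nnegrE ?(ltW e0)// real_normK ?num_real//.
apply: le_lt_trans Et; apply: le_trans (flow_energy_nonincreasing _ ts); last by lra.
rewrite /E (bigD1 i)//= lerDl; apply: sumr_ge0 => j _; exact: sqr_ge0.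
Unshelve. all: by end_near.
Qed.

End flow.
End Consensus.

(** * Discrete primitives and a priori bounds for cyclically ordered points *)

Section CyclicFlow.
Context {R : realType}.

Lemma sum_cyclic_difference (n : nat) (a : 'I_n.+1 -> R) (k : nat) : (k < n.+1)%N ->
  \sum_(0 <= j < k.+1) (a (inord j) - a (ord_pred (inord j))) =
  a (inord k) - a ord_max.
Proof.
elim: k => [_|k IH kn].
  rewrite big_nat1; congr (_ - a _); apply: val_inj => /=.
  by rewrite inordK// add0n/= modn_small.
rewrite big_nat_recr//= IH 1?ltnW//.
have -> : ord_pred (inord k.+1 : 'I_n.+1) = inord k.
  apply: val_inj => /=.
  by rewrite !inordK ?(ltnW kn)// addSn/= modnDr modn_small// ltnW.
by ring.
Qed.

(** Collapsed arcs are allowed, so that the workload formula is still available at the very moment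
    of a collision, which is where collisions get excluded. *)
Definition weakly_ordered (N : nat) (u : 'I_N -> R) : Prop :=
  forall i, u i <= next_base u i.

Lemma sum_indicator_last (n : nat) (T : R) :
  \sum_(i < n.+1) (if i.+1 == n.+1 then T else 0) = T.
Proof.
rewrite big_ord_recr/= eqxx big1 ?add0r// => i _.
by rewrite eqSS ltn_eqF.
Qed.

Lemma next_base_quasi_periodic (f : R -> R) (T : R) (N : nat) (u : 'I_N -> R) (i : 'I_N) :
  (forall x, f (x + 1) = f x + T) ->
  f (next_base u i) = f (u (ordS i)) + (if i.+1 == N then T else 0).
Proof. by move=> fT; rewrite /next_base; case: ifP => _; rewrite ?addr0. Qed.

Lemma weakly_ordered_le (n : nat) (u : 'I_n.+1 -> R) : weakly_ordered u ->
  (forall i j : 'I_n.+1, (i <= j)%N -> u i <= u j) /\ (forall i j, u i <= u j + 1).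
Proof.
move=> uo.
have step (k : nat) : (k.+1 < n.+1)%N -> u (inord k) <= u (inord k.+1).
  move=> kn; have := uo (inord k); rewrite /next_base inordK ?(ltnW kn)//.
  rewrite (ltn_eqF kn); congr (_ <= u _); apply: val_inj => /=.
  by rewrite !inordK ?(ltnW kn)// modn_small.
have mono (i j : 'I_n.+1) : (i <= j)%N -> u i <= u j.
  move=> ij; rewrite -(inord_val i) -(inord_val j).
  have jn := ltn_ord j; move: (nat_of_ord i) (nat_of_ord j) ij jn => a b.
  elim: b => [|b IH]; first by rewrite leqn0 => /eqP->.
  rewrite leq_eqVlt => /predU1P[->//|ab] bn.
  exact: le_trans (IH ab (ltnW bn)) (step _ bn).
split=> // i j.
have := uo ord_max; rewrite /next_base /= eqxx.
have -> : ordS (@ord_max n) = ord0 by apply: val_inj => /=; rewrite modnn.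
move=> H; apply: le_trans (mono i ord_max (leq_ord i)) _.
by apply: le_trans H _; rewrite lerD2r mono.
Qed.

(** Here [P] is arc length, [M] the cumulative workload and [F] a potential whose slope with respect
    to [P] is [M]. The potential is bounded below because the sum of the arc-length coordinates is
    conserved and the points stay within one turn of each other. *)
Lemma cyclic_flow_consensus (N : nat) (kappa T ell : R) (M P F : R -> R)
    (u m : 'I_N -> R -> R) : 0 < kappa ->
  {homo M : x y / x <= y} -> {homo P : x y / x <= y} ->
  (forall x, M (x + 1) = M x + T) -> (forall x, P (x + 1) = P x + ell) ->
  (forall a b, M a * (P b - P a) <= F b - F a) ->
  (forall t : R, 0 < t -> weakly_ordered (fun i => u i t)) ->
  (forall i (t : R), 0 < t ->
     m i t = M (next_base (fun j => u j t) i) - M (u i t)) ->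
  (forall i (t : R), 0 < t ->
     is_derive t 1 (fun s => P (u i s)) (kappa * (m i t - m (ord_pred i) t))) ->
  forall i, m i t @[t --> +oo] --> T / N%:R.
Proof.
case: N u m => [|n] u m k0 Mm Pm MT PT FM uo mM dP; first by case.
pose N := n.+1.
pose w (i : 'I_N) t := P (u i t).
pose y (i : 'I_N) t := M (u i t).
pose c (i : 'I_N) : R := if i.+1 == N then T else 0.
(* The derivatives of the partial sums telescope to [kappa * (m k - m ord_max)]; subtracting the
   mean in [g] replaces the last workload by the average [T / N]. *)
pose B (k : nat) t := \sum_(0 <= j < k.+1) w (inord j) t.
pose g (i : 'I_N) t := B i t - N%:R^-1 * \sum_(j < N) B j t.
pose W t := \sum_(j < N) w j t.
have my i (t : R) : 0 < t -> m i t = y (ordS i) t - y i t + c i.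
  by move=> t0; rewrite mM// (next_base_quasi_periodic _ _ MT) addrAC.
have sum_m (t : R) : 0 < t -> \sum_i m i t = T.
  move=> t0; under eq_bigr do rewrite my//.
  rewrite big_split/= sum_indicator_last sumrB.
  by rewrite [X in _ - X + _](reindex_inj (bij_inj (ordS_bij _)))/= subrr add0r.
have dB k (t : R) : (k < N)%N -> 0 < t ->
    is_derive t 1 (B k) (kappa * (m (inord k) t - m ord_max t)).
  move=> kN t0; rewrite -(@sum_cyclic_difference _ (fun i => m i t))// mulr_sumr.
  have -> : B k = \sum_(0 <= j < k.+1) (fun t => w (inord j) t).
    by apply/funext => z; rewrite fct_sumE.
  rewrite !big_mkord; apply: is_derive_sum => i.
  exact: dP.
have dSB (t : R) : 0 < t -> is_derive t 1 (fun t => \sum_(j < N) B j t)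
   (kappa * (T - N%:R * m ord_max t)).
  move=> t0.
  have -> : (fun t => \sum_(j < N) B j t) = \sum_(j < N) B j.
    by apply/funext => z; rewrite fct_sumE.
  have -> : kappa * (T - N%:R * m ord_max t) =
      \sum_(j < N) (kappa * (m (inord j) t - m ord_max t)).
    rewrite -mulr_sumr sumrB sumr_const card_ord mulr_natl -(sum_m t t0).
    by congr (_ * (_ - _)); apply: eq_bigr => j _; rewrite inord_val.
  by apply: is_derive_sum => j; apply: dB.
have dg i (t : R) : 0 < t -> is_derive t 1 (g i) (kappa * (m i t - T / N%:R)).
  move=> t0.
  have d1 := dB _ _ (ltn_ord i) t0.
  have d2 := dSB _ t0.
  have -> : g i = B i - N%:R^-1 \*: (fun t => \sum_(j < N) B j t) by [].
  apply: is_derive_eq.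
  rewrite inord_val /GRing.scale/=.
  have N0 : N%:R != 0 :> R by rewrite pnatr_eq0.
  by field.
(* At index 0 the predecessor is the last index, whose partial sum is the total [W]; it is constant
   in time by [Wcst] and drops out of increments. *)
have gW i (t : R) : g i t - g (ord_pred i) t = w i t - (if i == ord0 then W t else 0).
  rewrite /g opprB addrA subrK.
  case: eqP => [->|/eqP i0].
    rewrite /B /= modn_small// big_nat1 big_mkord /W; congr (w _ _ - _).
      by apply: val_inj => /=; rewrite inordK.
    by apply: eq_bigr => j _; rewrite inord_val.
  have ip : (0 < i)%N by rewrite lt0n; apply: contra i0 => /eqP i0; apply/eqP/val_inj.
  have -> : nat_of_ord (ord_pred i) = i.-1.
    rewrite /= -{1}(prednK ip) addSn/= addnS -addnS modnDr modn_small//.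
    exact: leq_ltn_trans (leq_pred _) (ltn_ord i).
  rewrite /B (prednK ip) big_nat_recr//= addrAC subrr add0r subr0.
  by rewrite inord_val.
have Wcst (s t : R) : 0 < s -> 0 < t -> W t = W s.
  move=> s0 t0.
  have WB (z : R) : W z = B n z.
    by rewrite /W /B big_mkord; apply: eq_bigr => j _; rewrite inord_val.
  have dW (z : R) : 0 < z -> is_derive z 1 W 0.
    move=> z0; have -> : W = B n by apply/funext => ?; rewrite WB.
    have := dB n z (ltnSn _) z0.
    have -> : inord n = @ord_max n by apply: val_inj => /=; rewrite inordK.
    by rewrite subrr mulr0.
  have le0 (a b : R) : 0 < a -> a <= b -> W b = W a.
    move=> a0 ab; apply/eqP; rewrite eq_le; apply/andP; split.
      apply: (@le0_is_derive_nonincreasing _ W (fun=> 0)) => // z /andP[az _].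
      by apply: dW; exact: lt_le_trans az.
    rewrite -lerN2; apply: (@le0_is_derive_nonincreasing _ (- W) (fun=> 0)) => // z /andP[az _].
    have d := dW z (lt_le_trans a0 az).
    by apply: is_derive_eq; rewrite oppr0.
  by case: (leP s t) => [st|/ltW ts]; [exact: le0|rewrite (le0 t s)].
have gw i (s t : R) : 0 < s -> 0 < t ->
    (g i t - g i s) - (g (ord_pred i) t - g (ord_pred i) s) = w i t - w i s.
  move=> s0 t0; have := gW i t; have := gW i s.
  by rewrite (Wcst _ _ s0 t0); lra.
have sum_g s : \sum_i g i s = 0.
  rewrite /g sumrB sumr_const card_ord -[X in _ - X]mulr_natl mulrA mulfV ?mul1r ?subrr//.
  by rewrite pnatr_eq0.
(* Any two coordinates differ by at most [ell], hence each differs from the mean by at most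
   [ell]. *)
have w_close i (t : R) : 0 < t -> `|N%:R * w i t - W t| <= N%:R * ell.
  move=> t0.
  have [mono wrap] := weakly_ordered_le (uo t t0).
  rewrite mulr_natl -[X in _ *+ X]card_ord -sumr_const /W -sumrB.
  apply: le_trans (ler_norm_sum _ _ _) _.
  rewrite mulr_natl -[X in _ *+ X]card_ord -sumr_const; apply: ler_sum => j _.
  have H a b : w a t - w b t <= ell.
    by rewrite lerBlDl /w -PT Pm.
  by rewrite ler_norml H andbT lerNl opprB H.
pose W1 := W 1.
pose D := N%:R^-1 * (N%:R * ell + `|W1|).
have wD i (t : R) : 0 < t -> `|w i t| <= D.
  move=> t0; have := w_close i t t0; rewrite (Wcst 1 t)// -/W1 => H.
  rewrite /D ler_pdivlMl ?ltr0n//.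
  rewrite -[X in X * _]ger0_norm// -normrM.
  have := ler_normD (N%:R * w i t - W1) W1; rewrite subrK; lra.
have BD k (t : R) : (k < N)%N -> 0 < t -> `|B k t| <= N%:R * D.
  move=> kN t0; apply: le_trans (ler_norm_sum _ _ _) _.
  apply: (@le_trans _ _ (\sum_(0 <= j < k.+1) D)).
    by apply: ler_sum => j _; exact: wD.
  rewrite sumr_const_nat subn0 -[X in X <= _]mulr_natl ler_wpM2r ?ler_nat//.
  exact: le_trans (normr_ge0 _) (wD ord0 1 ltr01).
have gD i (t : R) : 0 < t -> `|g i t| <= 2 * N%:R * D.
  move=> t0; apply: le_trans (ler_normB _ _) _.
  have : `|N%:R^-1 * \sum_(j < N) B j t| <= N%:R * D.
    rewrite normrM ger0_norm// ler_pdivrMl ?ltr0n//.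
    apply: le_trans (ler_norm_sum _ _ _) _.
    have -> : N%:R * (N%:R * D) = \sum_(j < N) (N%:R * D).
      by rewrite sumr_const card_ord [LHS]mulr_natl.
    by apply: ler_sum => j _; exact: BD.
  have := BD i t (ltn_ord i) t0; lra.
(* Lower bound for the potential from the tangent inequality of [F] at time 1, with the worst sign
   in both products. *)
pose C := \sum_(i < N) (F (u i 1) - `|y i 1| * (2 * D) - `|c i| * (2 * N%:R * D)).
apply: (@flow_consensus _ N kappa (T / N%:R) g m y w (fun i t => F (u i t)) c) => //.
- by move=> s t _ _; rewrite sumrB !sum_g subrr.
- move=> i s t _ _; rewrite /w /y.
  case: (leP (u i s) (u i t)) => [|/ltW] H.
    by apply: mulr_ge0; rewrite subr_ge0; [exact: Pm|exact: Mm].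
  by apply: mulr_le0; rewrite subr_le0; [exact: Pm|exact: Mm].
- by move=> i s t _ _; exact: FM.
- suff H : forall t : R, 1 <= t -> C <= \sum_(i < N) (F (u i t) - c i * g i t) by exact: H.
  move=> t t1; apply: ler_sum => i _.
  have t0 : 0 < t by exact: lt_le_trans t1.
  have H1 := FM (u i 1) (u i t).
  have H2 : - (`|y i 1| * (2 * D)) <= M (u i 1) * (P (u i t) - P (u i 1)).
    rewrite lerNl -mulrN; apply: le_trans (ler_norm _) _; rewrite normrM normrN ler_wpM2l//.
    have := ler_normB (w i t) (w i 1); have := wD i t t0; have := wD i 1 ltr01.
    rewrite /w; lra.
  have H3 : c i * g i t <= `|c i| * (2 * N%:R * D).
    by apply: le_trans (ler_norm _) _; rewrite normrM ler_wpM2l// gD.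
  lra.
Qed.

End CyclicFlow.

(** * Primitives and convex potentials *)

Section Primitives.
Context {R : realType}.
Local Notation mu := (@lebesgue_measure R).

Lemma is_derive_near (f : R -> R) (x a : R) :
  (forall e : R, 0 < e -> \forall z \near x,
    `|f z - f x - a * (z - x)| <= e * `|z - x|) -> is_derive x 1 f a.
Proof.
move=> H; apply/is_derive1_caratheodory.
exists (fun z => if z == x then a else (f z - f x) / (z - x)); split.
- move=> z; case: eqP => [->|/eqP zx]; first by rewrite !subrr mulr0.
  by rewrite divfK// subr_eq0.
- apply/cvgrPdist_le => e e0; rewrite eqxx.
  have := H e e0; apply: filterS => z zx.
  case: eqP => [_|/eqP zx0]; first by rewrite subrr normr0 ltW.
  have d0 : z - x != 0 by rewrite subr_eq0.
  rewrite distrC.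
  have -> : (f z - f x) / (z - x) - a = (f z - f x - a * (z - x)) / (z - x).
    by rewrite [in RHS]mulrBl mulfK.
  by rewrite normrM normfV ler_pdivrMr ?normr_gt0.
- by rewrite eqxx.
Qed.

Definition primitive (f : R -> R) (x : R) : R :=
  if 0 <= x then \int[mu]_(t in `[0, x]) f t else - \int[mu]_(t in `[x, 0]) f t.

Lemma primitiveB (f : R -> R) (a b : R) :
  (forall a b, mu.-integrable `[a, b] (EFin \o f)) -> a <= b ->
  primitive f b - primitive f a = \int[mu]_(t in `[a, b]) f t.
Proof.
move=> fi ab.
have add x y z : x <= y -> y <= z -> \int[mu]_(t in `[x, z]) f t =
    \int[mu]_(t in `[x, y]) f t + \int[mu]_(t in `[y, z]) f t.
  move=> xy yz.
  have := @Rintegral_itvB _ f (BLeft x) (BRight z) y (fi x z).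
  rewrite Rintegral_itv_obnd_cbnd; last first.
    by apply: integrableS (fi y z) => //; exact: subset_itv_oc_cc.
  by rewrite !bnd_simp => /(_ xy yz) <-; rewrite addrC subrK.
rewrite /primitive; case: (leP 0 a) => a0.
  by rewrite (le_trans a0 ab) (add 0 a b)// addrAC subrr add0r.
case: (leP 0 b) => b0.
  by rewrite opprK addrC -add// ltW.
rewrite opprK addrC (add a b 0) ?(ltW b0)//; lra.
Qed.

Lemma Rintegral_itv_ge (f : R -> R) (a b c : R) : a <= b ->
  mu.-integrable `[a, b] (EFin \o f) -> (forall x, a <= x <= b -> c <= f x) ->
  c * (b - a) <= \int[mu]_(t in `[a, b]) f t.
Proof.
move=> ab fi cf.
have ic : mu.-integrable `[a, b] (EFin \o cst c).
  apply: continuous_compact_integrable; first exact: segment_compact.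
  by apply: continuous_subspaceT => x; exact: cvg_cst.
have -> : c * (b - a) = \int[mu]_(t in `[a, b]) cst c t.
  rewrite Rintegral_cst//= lebesgue_measure_itv/= lte_fin.
  move: ab; rewrite le_eqVlt => /orP[/eqP->|ab]; last by rewrite ab.
  by rewrite ltxx subrr.
by apply: le_Rintegral => // x /=; rewrite in_itv/=; exact: cf.
Qed.

Lemma Rintegral_itv_le (f : R -> R) (a b c : R) : a <= b ->
  mu.-integrable `[a, b] (EFin \o f) -> (forall x, a <= x <= b -> f x <= c) ->
  \int[mu]_(t in `[a, b]) f t <= c * (b - a).
Proof.
move=> ab fi cf.
have ic : mu.-integrable `[a, b] (EFin \o cst c).
  apply: continuous_compact_integrable; first exact: segment_compact.
  by apply: continuous_subspaceT => x; exact: cvg_cst.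
have -> : c * (b - a) = \int[mu]_(t in `[a, b]) cst c t.
  rewrite Rintegral_cst//= lebesgue_measure_itv/= lte_fin.
  move: ab; rewrite le_eqVlt => /orP[/eqP->|ab]; last by rewrite ab.
  by rewrite ltxx subrr.
by apply: le_Rintegral => // x /=; rewrite in_itv/=; exact: cf.
Qed.

Lemma continuous_itv_integrable (f : R -> R) : continuous f ->
  forall a b, mu.-integrable `[a, b] (EFin \o f).
Proof.
move=> cf a b; apply: continuous_compact_integrable; first exact: segment_compact.
exact: continuous_subspaceT.
Qed.

Lemma is_derive_primitive (f : R -> R) (x : R) : continuous f ->
  is_derive x 1 (primitive f) (f x).
Proof.
move=> cf; have fi := continuous_itv_integrable cf.
apply: is_derive_near => e e0.
have /cvgrPdist_le/(_ e e0)/nbhs_ballP[d /= d0 H] := cf x.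
apply/nbhs_ballP; exists d => //= z xz.
have key a b : a <= b -> (forall y, a <= y <= b -> ball x d y) ->
    `|primitive f b - primitive f a - f x * (b - a)| <= e * (b - a).
  move=> ab yd; rewrite primitiveB//.
  have near y : a <= y <= b -> f x - e <= f y <= f x + e.
    by move/yd/H; rewrite ler_norml; lra.
  have := @Rintegral_itv_ge f a b (f x - e) ab (fi a b) (fun y ay => proj1 (andP (near y ay))).
  have := @Rintegral_itv_le f a b (f x + e) ab (fi a b) (fun y ay => proj2 (andP (near y ay))).
  by rewrite ler_norml !mulrDl mulNr; lra.
have xzd : `|z - x| < d by rewrite distrC.
case: (leP x z) => [xlz|/ltW zlx].
  rewrite [`|z - x|]ger0_norm ?subr_ge0//; apply: key => // y xyz.
  by move: xzd; rewrite /ball/= !ltr_norml; lra.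
rewrite [`|z - x|]ler0_norm ?subr_le0// opprB -normrN.
have -> : - (primitive f z - primitive f x - f x * (z - x)) =
   primitive f x - primitive f z - f x * (x - z) by ring.
apply: key => // y xyz.
by move: xzd; rewrite /ball/= !ltr_norml; lra.
Qed.

Lemma primitive_homo (f : R -> R) : (forall a b, mu.-integrable `[a, b] (EFin \o f)) ->
  (forall x, 0 <= f x) -> {homo primitive f : x y / x <= y}.
Proof.
move=> fi f0 a b ab; rewrite -subr_ge0 primitiveB//.
by apply: Rintegral_ge0 => x _.
Qed.

Lemma is_derive_eq_cst (f g h : R -> R) : (forall x : R, is_derive x 1 f (h x)) ->
  (forall x : R, is_derive x 1 g (h x)) -> forall x, f x = g x + (f 0 - g 0).
Proof.
move=> df dg x.
have : (f - g) x = (f - g) 0.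
  apply: is_derive_0_is_cst => y.
  have := df y; have := dg y => ? ?.
  by apply: is_derive_eq; rewrite subrr.
by rewrite !fctE => E; rewrite -E; ring.
Qed.

Lemma primitive_quasi_periodic (f : R -> R) : continuous f ->
  (forall x, f (x + 1) = f x) ->
  exists ell, forall x, primitive f (x + 1) = primitive f x + ell.
Proof.
move=> cf f1; exists (primitive f (0 + 1) - primitive f 0).
apply: (@is_derive_eq_cst (fun x => primitive f (x + 1)) _ f) => x; last first.
  exact: is_derive_primitive.
have d3 : is_derive x 1 (fun t : R => t + 1) (1 + 0) by apply: is_deriveD.
have := @is_derive1_comp _ (primitive f) (fun t => t + 1) x _ _
  (is_derive_primitive (x + 1) cf) d3.
by rewrite addr0 mulr1 f1.
Qed.

(** With [v] the speed, the primitive of [M * v] integrates [M] against arc length. A nondecreasing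
    integrand lies between its end values, which is convexity in the variable [primitive v] with
    subgradient [M]. Monotonicity also supplies measurability and boundedness, so jumps of [M] are
    harmless. *)
Lemma convex_potential (M v : R -> R) : {homo M : x y / x <= y} ->
  continuous v -> (forall x, 0 <= v x) ->
  forall a b, M a * (primitive v b - primitive v a) <=
    primitive (fun x => M x * v x) b - primitive (fun x => M x * v x) a.
Proof.
move=> Mm cv v0.
have vi := continuous_itv_integrable cv.
have Mi a b : mu.-integrable `[a, b] (EFin \o (fun x => M x * v x)).
  have mM : measurable_fun `[a, b] M.
    apply: (@measurable_funS _ _ _ _ setT) => //.
    exact: measurable_realfun.nondecreasing_measurable.
  have bM : [bounded M x | x in `[a, b]].
    exists (`|M a| + `|M b|); split; first exact: num_real.
    move=> z Mz x /=; rewrite in_itv/= => /andP[ax xb].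
    have := Mm _ _ ax; have := Mm _ _ xb.
    move=> H1 H2; apply: le_trans (ltW Mz).
    have := ler_norm (M b); have := ler_norm (- M a); rewrite normrN.
    have := normr_ge0 (M b); have := normr_ge0 (M a).
    by rewrite ler_norml; lra.
  have -> : EFin \o (fun x => M x * v x) = ((EFin \o M) \* (EFin \o v))%E.
    by apply/funext => z /=; rewrite EFinM.
  by apply: integrableMr => //; exact: vi.
have key a b : a <= b -> M a * (primitive v b - primitive v a) <=
    primitive (fun x => M x * v x) b - primitive (fun x => M x * v x) a <=
    M b * (primitive v b - primitive v a).
  move=> ab; rewrite !primitiveB//.
  have ic c : mu.-integrable `[a, b] (EFin \o (fun x => c * v x)).
    have -> : EFin \o (fun x => c * v x) = (fun x => c%:E * (EFin \o v) x)%E.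
      by apply/funext => z /=; rewrite EFinM.
    by apply: integrableZl => //; exact: vi.
  rewrite -!RintegralZl//; apply/andP; split; apply: le_Rintegral => // x /=;
    rewrite in_itv/= => /andP[ax xb]; by rewrite ler_wpM2r// Mm.
move=> a b; case: (leP a b) => [/key/andP[]//|/ltW/key/andP[_]].
by lra.
Qed.

End Primitives.

(** * Convex sets in the plane and their boundary curves *)

Section Plane.
Context {R : realType}.
Implicit Types (p q z : R * R) (D : set (R * R)).

Definition seg p q (l : R) : R * R :=
  (p.1 + l * (q.1 - p.1), p.2 + l * (q.2 - p.2)).

Lemma cvg_pairR (T : Type) (F : set_system T) {FF : Filter F} (f g : T -> R) (a b : R) :
  f x @[x --> F] --> a -> g x @[x --> F] --> b -> (f x, g x) @[x --> F] --> (a, b).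
Proof. by move=> fa gb; apply: (@cvg_pair _ _ _ F (nbhs a) (nbhs b)). Qed.

Lemma cvg_fstR (T : Type) (F : set_system T) {FF : Filter F} (f : T -> R * R) p :
  f x @[x --> F] --> p -> (f x).1 @[x --> F] --> p.1.
Proof.
move=> fp; exact: (@cvg_comp _ _ _ f fst _ _ _ fp (@cvg_fst _ _ (nbhs p.1) (nbhs p.2) _)).
Qed.

Lemma cvg_sndR (T : Type) (F : set_system T) {FF : Filter F} (f : T -> R * R) p :
  f x @[x --> F] --> p -> (f x).2 @[x --> F] --> p.2.
Proof.
move=> fp; exact: (@cvg_comp _ _ _ f snd _ _ _ fp (@cvg_snd _ _ (nbhs p.1) (nbhs p.2) _)).
Qed.

Lemma continuous_fstR : continuous (fst : R * R -> R).
Proof. by move=> p; apply: cvg_fstR; exact: cvg_id. Qed.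

Lemma continuous_sndR : continuous (snd : R * R -> R).
Proof. by move=> p; apply: cvg_sndR; exact: cvg_id. Qed.

Lemma cvg_dot (T : Type) (F : set_system T) {FF : Filter F} (f g : T -> R * R) p q :
  f x @[x --> F] --> p -> g x @[x --> F] --> q -> dot (f x) (g x) @[x --> F] --> dot p q.
Proof.
move=> fp gq; apply: cvgD; apply: cvgM; by [exact: cvg_fstR|exact: cvg_sndR].
Qed.

Lemma cvg_seg (T : Type) (F : set_system T) {FF : Filter F} (f g : T -> R * R) (h : T -> R) p q l :
  f x @[x --> F] --> p -> g x @[x --> F] --> q -> h x @[x --> F] --> l ->
  seg (f x) (g x) (h x) @[x --> F] --> seg p q l.
Proof.
move=> fp gq hl; apply: cvg_pairR; apply: cvgD;
  do ?[exact: cvg_fstR|exact: cvg_sndR]; apply: cvgM => //; apply: cvgB;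
  by [exact: cvg_fstR|exact: cvg_sndR].
Qed.

Lemma near_open (T : Type) (F : set_system T) {FF : Filter F} (f : T -> R * R) D p :
  open D -> D p -> f x @[x --> F] --> p -> \forall x \near F, D (f x).
Proof. by move=> oD Dp; apply; exact: open_nbhs_nbhs. Qed.

Lemma dotC p q : dot p q = dot q p.
Proof. by rewrite /dot; ring. Qed.

Lemma dot_ge0 p : 0 <= dot p p.
Proof. by rewrite /dot addr_ge0// -expr2 sqr_ge0. Qed.

Lemma dot_eq0 p : dot p p = 0 -> p = 0.
Proof.
rewrite /dot => /eqP; rewrite -!expr2 paddr_eq0 ?sqr_ge0// !sqrf_eq0.
by case: p => a b /= /andP[/eqP-> /eqP->].
Qed.

Lemma dot_gt0 p : p != 0 -> 0 < dot p p.
Proof.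
move=> p0; rewrite lt_neqAle dot_ge0 andbT eq_sym.
by apply: contra p0 => /eqP/dot_eq0->.
Qed.

Definition convex (D : set (R * R)) :=
  forall p q l, D p -> D q -> 0 <= l <= 1 -> D (seg p q l).

Lemma convex_setE D : convex_set D -> convex D.
Proof.
move=> Dc p q l Dp Dq /andP[l0 l1].
have a0 : 0 <= 1 - l by rewrite subr_ge0.
have a1 : 1 - l <= 1 by rewrite gerBl.
have := Dc p q (Itv01 a0 a1); rewrite !inE => /(_ Dp Dq).
congr (D _); rewrite /conv /= /seg /unstable.onem; congr pair.
  by transitivity ((1 - l) * p.1 + (1 - (1 - l)) * q.1) => //; ring.
by transitivity ((1 - l) * p.2 + (1 - (1 - l)) * q.2) => //; ring.
Qed.

Lemma closureP D p : closure D p <-> forall P : set (R * R), nbhs p P -> exists2 z, D z & P z.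
Proof.
split=> [Dp P /Dp[z [Dz Pz]]|H P /H[z Dz Pz]]; by exists z.
Qed.

(** The point [p] of the closure is replaced by a nearby [z] in [D], and [q] is shifted to [f z] so
    that the point at ratio [l] stays the same; for [z] close to [p], the point [f z] is still in
    the open set. *)
Lemma seg_closure D p q l : open D -> convex D -> closure D p -> D q -> 0 < l <= 1 ->
  D (seg p q l).
Proof.
move=> oD cD Dp Dq /andP[l0 l1].
pose f p' : R * R := (q.1 + (1 - l) / l * (p.1 - p'.1), q.2 + (1 - l) / l * (p.2 - p'.2)).
have fq : f x @[x --> p] --> q.
  have -> : q = f p by rewrite /f !subrr !mulr0 !addr0; case: (q).
  apply: cvg_pairR; apply: cvgD; do ?exact: cvg_cst; apply: cvgMr; apply: cvgB; do ?exact: cvg_cst.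
    exact: continuous_fstR.
  exact: continuous_sndR.
have [z Dz Dfz] := (closureP D p).1 Dp _ (near_open oD Dq fq).
have -> : seg p q l = seg z (f z) l.
  rewrite /seg /f /=; congr pair; field; exact: lt0r_neq0.
by apply: cD; rewrite ?l1 ?ltW.
Qed.

Lemma cvg_derive_quotient (g : R -> R * R) (a t : R) v : is_derive a 1 g v ->
  ((g a).1 + h^-1 * ((g (a + t * h)).1 - (g a).1),
   (g a).2 + h^-1 * ((g (a + t * h)).2 - (g a).2)) @[h --> 0^'+] -->
  ((g a).1 + t * v.1, (g a).2 + t * v.2).
Proof.
move=> dg.
have key (f : R -> R) d : is_derive a 1 f d ->
    f a + h^-1 * (f (a + t * h) - f a) @[h --> 0^'+] --> f a + t * d.
  move=> /is_derive1_caratheodory[k [fk kc <-]].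
  apply: cvgD; first exact: cvg_cst.
  have H : t * k (a + t * h) @[h --> 0^'+] --> t * k a.
    apply: cvgMr; apply: (@cvg_comp _ _ _ (fun h => a + t * h) k _ (nbhs a)); last exact: kc.
    apply: cvg_at_right_filter.
    rewrite -[X in _ --> X]addr0 -[X in _ --> _ + X](mulr0 t).
    by apply: cvgD; [exact: cvg_cst|apply: cvgMr; exact: cvg_id].
  apply: cvg_trans H; apply: near_eq_cvg; near=> h.
  have h0 : 0 < h by near: h; exact: nbhs_right_gt.
  by rewrite fk; field; exact: lt0r_neq0.
by apply: cvg_pairR;
  [exact: (key (fun t => (g t).1) _ (is_derive_fst dg))
  |exact: (key (fun t => (g t).2) _ (is_derive_snd dg))].
Unshelve. all: by end_near.
Qed.

End Plane.

Section ConvexCurve.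
Context {R : realType}.
Implicit Types (p q z n : R * R).
Variables (g g' : R -> R * R) (D : set (R * R)).
Hypothesis g_derive : forall x, is_derive (x : R) 1 g (g' x).
Hypothesis g'_neq0 : forall x, g' x != 0.
Hypotheses (oD : open D) (cD : convex D) (D0 : D !=set0).
Hypothesis gD : closure D `\` D = range g.

Lemma curve_closure x : closure D (g x).
Proof. by have : range g (g x) by [exists x]; rewrite -gD => -[]. Qed.

Lemma curve_notin x : ~ D (g x).
Proof. by have : range g (g x) by [exists x]; rewrite -gD => -[]. Qed.

(** Suppose the tangent line met [D] in [q]. Curve points magnified about [g x] converge to [q],
    hence lie in [D]; shrinking back towards [g x], which is in the closure, puts points of the
    boundary curve itself into [D]. *)
Lemma tangent_avoids x q : D q -> (q.1 - (g x).1) * (g' x).2 - (q.2 - (g x).2) * (g' x).1 <> 0.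
Proof.
move=> Dq E.
pose v := g' x; pose t := dot (q - g x) v / dot v v.
have v0 : 0 < dot v v by rewrite dot_gt0// g'_neq0.
have qE : q = ((g x).1 + t * v.1, (g x).2 + t * v.2).
  rewrite [LHS]surjective_pairing /t; congr pair.
    have -> : dot (q - g x) v / dot v v * v.1 =
      ((q.1 - (g x).1) * dot v v - ((q.1 - (g x).1) * v.2 - (q.2 - (g x).2) * v.1) * v.2) / dot v v.
      by rewrite /dot/=; field; exact: lt0r_neq0.
    by rewrite E mul0r subr0 mulfK ?lt0r_neq0//; ring.
  have -> : dot (q - g x) v / dot v v * v.2 =
    ((q.2 - (g x).2) * dot v v + ((q.1 - (g x).1) * v.2 - (q.2 - (g x).2) * v.1) * v.1) / dot v v.
    by rewrite /dot/=; field; exact: lt0r_neq0.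
  by rewrite E mul0r addr0 mulfK ?lt0r_neq0//; ring.
have := @cvg_derive_quotient _ g x t v (g_derive x); rewrite -qE => /(near_open oD Dq) H.
have /filter_ex : \forall h \near (0 : R)^'+, D (g (x + t * h)).
  near=> h.
  have h0 : 0 < h by near: h; exact: nbhs_right_gt.
  have h1 : h <= 1 by near: h; apply: nbhs_right_le.
  have : D ((g x).1 + h^-1 * ((g (x + t * h)).1 - (g x).1),
            (g x).2 + h^-1 * ((g (x + t * h)).2 - (g x).2)) by near: h.
  move=> Dh; have := @seg_closure _ D (g x) _ h oD cD (@curve_closure x) Dh.
  rewrite h0 h1 => /(_ isT).
  congr (D _); rewrite /seg /= [RHS]surjective_pairing; congr pair; field; exact: lt0r_neq0.
by move=> [h]; exact: curve_notin.
Unshelve. all: by end_near.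
Qed.

(* [s = 1] or [s = -1] according to the orientation of the curve. *)
Lemma outward_normal x : exists s : R, s ^+ 2 = 1 /\
  forall q, D q -> dot (q - g x) (s * (g' x).2, - s * (g' x).1) < 0.
Proof.
pose f q := (q.1 - (g x).1) * (g' x).2 - (q.2 - (g x).2) * (g' x).1.
have f0 q : D q -> f q <> 0 by exact: tangent_avoids.
have [q0 Dq0] := D0.
have same q : D q -> 0 < f q0 * f q.
  move=> Dq; rewrite ltNge; apply/negP => neg.
  have ne : f q - f q0 != 0.
    apply/eqP => E; have fE : f q = f q0 by lra.
    move: neg; rewrite fE -expr2 => neg.
    have := f0 q0 Dq0; apply; apply/eqP; rewrite -sqrf_eq0; apply/eqP/le_anti.
    by rewrite neg sqr_ge0.
  pose l := - f q0 / (f q - f q0).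
  have fl : f (seg q0 q l) = 0.
    have -> : f (seg q0 q l) = f q0 + l * (f q - f q0) by rewrite /f /=; ring.
    by rewrite divfK//; ring.
  apply: (f0 (seg q0 q l)) => //; apply: cD => //.
  have d2 : 0 < (f q - f q0) ^+ 2 by rewrite exprn_even_gt0.
  have lE : l = - f q0 * (f q - f q0) / (f q - f q0) ^+ 2 by rewrite /l; field.
  rewrite lE ler_pdivlMr// ler_pdivrMr// mul0r mul1r.
  by apply/andP; split; have := sqr_ge0 (f q); have := sqr_ge0 (f q0); nra.
exists (if 0 < f q0 then -1 else 1); split; first by case: ifP => _; ring.
move=> q Dq; have := same q Dq; have E s : dot (q - g x) (s * (g' x).2, - s * (g' x).1) = s * f q.
  by rewrite /dot /f /=; ring.
rewrite E; case: (ltP 0 (f q0)) => [pos|neg].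
  by rewrite pmulr_rgt0// mulN1r oppr_lt0.
rewrite mul1r nmulr_rgt0// lt_neqAle neg andbT; exact/eqP/f0.
Qed.

End ConvexCurve.

Record annular (R : realType) (g g' : R -> R * R) (Din Dout : set (R * R)) : Prop := {
  an_derive : forall x, is_derive (x : R) 1 g (g' x);
  an_neq0 : forall x, g' x != 0;
  an_per : forall x, g (x + 1) = g x;
  an_inj : forall x y, g x = g y -> exists k : int, y = x + k%:~R;
  an_openD : open Din;
  an_convex : convex Din;
  an_D0 : Din !=set0;
  an_boundary : closure Din `\` Din = range g;
  an_openO : open Dout;
  an_bounded : exists r : R, forall q, Dout q -> -r <= q.1 <= r /\ -r <= q.2 <= r;
  an_connected : connected Dout;
  an_star : exists2 c, Dout c & forall q l, Dout q -> 0 <= l <= 1 -> Dout (seg c q l);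
  an_sub : closure Din `<=` Dout }.

(** * Projection onto the closed convex inner region *)

Section Foot.
Context {R : realType}.
Implicit Types (p q z n : R * R).
Variables (g g' : R -> R * R) (Din Dout : set (R * R)).
Hypothesis A : annular g g' Din Dout.

(** An outward normal of arbitrary length; the last clause expresses that it spans the line
    orthogonal to the tangent. *)
Definition is_normal x n : Prop :=
  [/\ 0 < dot n n, dot n (g' x) = 0,
      (forall q, Din q -> dot (q - g x) n < 0) &
      forall w, dot w (g' x) = 0 -> w = (dot w n / dot n n * n.1, dot w n / dot n n * n.2)].

Lemma normal_ex x : exists n, is_normal x n.
Proof.
have [s [s2 sn]] := outward_normal (an_derive A) (an_neq0 A) (an_openD A) (an_convex A)
   (an_D0 A) (an_boundary A) x.
exists (s * (g' x).2, - s * (g' x).1).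
have v0 := dot_gt0 (an_neq0 A x).
have nn : dot (s * (g' x).2, - s * (g' x).1) (s * (g' x).2, - s * (g' x).1) = dot (g' x) (g' x).
  transitivity (s ^+ 2 * dot (g' x) (g' x)); last by rewrite s2 mul1r.
  by rewrite /dot/=; ring.
split=> //; first by rewrite nn.
  by rewrite /dot/=; ring.
move=> w w0; rewrite nn [LHS]surjective_pairing; congr pair => /=.
- apply: (mulIf (lt0r_neq0 v0)); rewrite mulrAC divfK ?lt0r_neq0//.
  transitivity (w.1 * dot (g' x) (g' x) - dot w (g' x) * (g' x).1).
    by rewrite w0 mul0r subr0.
  transitivity (s ^+ 2 * (w.1 * dot (g' x) (g' x) - dot w (g' x) * (g' x).1)).
    by rewrite s2 mul1r.
  by rewrite /dot/=; ring.
- apply: (mulIf (lt0r_neq0 v0)); rewrite mulrAC divfK ?lt0r_neq0//.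
  transitivity (w.2 * dot (g' x) (g' x) - dot w (g' x) * (g' x).2).
    by rewrite w0 mul0r subr0.
  transitivity (s ^+ 2 * (w.2 * dot (g' x) (g' x) - dot w (g' x) * (g' x).2)).
    by rewrite s2 mul1r.
  by rewrite /dot/=; ring.
Qed.

Definition nrm x : R * R := xget 0 [set n | is_normal x n].

Lemma nrmP x : is_normal x (nrm x).
Proof. by rewrite /nrm; case: xgetP => // H; have [n /H] := normal_ex x. Qed.

Definition ray (x r : R) : R * R := ((g x).1 + r * (nrm x).1, (g x).2 + r * (nrm x).2).

Lemma ray0 x : ray x 0 = g x.
Proof. by rewrite /ray !mul0r !addr0; case: (g x). Qed.

Lemma ray_of_orthogonal x q : dot (q - g x) (g' x) = 0 ->
  q = ray x (dot (q - g x) (nrm x) / dot (nrm x) (nrm x)).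
Proof.
case: (nrmP x) => _ _ _ H /H; set r := dot _ _ / _ => E.
rewrite /ray [LHS]surjective_pairing; have := congr1 fst E; have := congr1 snd E => /=.
by move=> <- <-; congr pair; rewrite addrC subrK.
Qed.

(** It suffices to find one point of [Din] on the normal line, since by [seg_closure] the segment
    from there to [g x] lies in [Din] up to its end. To get one, a point of [Din] on one side of the
    line is joined to a curve point on the other side. *)
Lemma inward_ray x : exists2 r, 0 < r & forall e, 0 < e <= r -> Din (ray x (- e)).
Proof.
have [n0 nv nD nE] := nrmP x; have [oD cD] := (an_openD A, an_convex A).
have closg := @curve_closure _ g Din (an_boundary A).
suff [q Dq q0] : exists2 q, Din q & dot (q - g x) (g' x) = 0.
  have := ray_of_orthogonal q0; set r := _ / _ => qE.
  have r0 : 0 < - r by rewrite oppr_gt0 /r pmulr_llt0 ?invr_gt0// nD.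
  exists (- r) => // e /andP[e0 er].
  have := @seg_closure _ Din (g x) q (e / - r) oD cD (closg x) Dq.
  rewrite divr_gt0//= ler_pdivrMr// mul1r er => /(_ isT).
  congr (Din _); rewrite qE /seg /ray/=; congr pair; field;
    by move: r0; rewrite oppr_gt0 => /ltr0_neq0.
have [q Dq] := an_D0 A.
pose f y := dot (g y - g x) (g' x).
set al := dot (q - g x) (g' x).
have [al0|al0] := eqVneq al 0; first by exists q.
have v0 := dot_gt0 (an_neq0 A x).
(* Moving the parameter by [- al * h] changes the tangential coordinate by about
   [- al * h * dot v v], which has the sign opposite to [al]. *)
have [y sy] : exists y, f y * al < 0.
  have := @cvg_derive_quotient _ g x (- al) (g' x) (an_derive A x).
  set v := g' x => H.
  have {}H : h^-1 * f (x + - al * h) @[h --> 0^'+] --> - al * dot v v.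
    have -> : - al * dot v v = dot (((g x).1 + - al * v.1, (g x).2 + - al * v.2) - g x) v.
      by rewrite /dot/=; ring.
    have : dot (((g x).1 + h^-1 * ((g (x + - al * h)).1 - (g x).1),
         (g x).2 + h^-1 * ((g (x + - al * h)).2 - (g x).2)) - g x) v @[h --> 0^'+] -->
         dot (((g x).1 + - al * v.1, (g x).2 + - al * v.2) - g x) v.
      by apply: cvg_dot; [apply: cvgB => //; exact: cvg_cst|exact: cvg_cst].
    apply: cvg_trans; apply: near_eq_cvg; near=> h.
    by rewrite /f /dot/=; ring.
  have {}H : al * (h^-1 * f (x + - al * h)) @[h --> 0^'+] --> al * (- al * dot v v).
    by apply: cvgMr.
  have neg : al * (- al * dot v v) < 0.
    rewrite mulrA mulrN mulNr oppr_lt0 mulr_gt0// -expr2.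
    by rewrite exprn_even_gt0.
  have := cvgr_lt _ H _ neg => {}H.
  have /filter_ex[h [h0 hH]] : \forall h \near (0 : R)^'+, 0 < h /\ al * (h^-1 * f (x + - al * h)) < 0.
    by near=> h; split; near: h; [exact: nbhs_right_gt|exact: H].
  exists (x + - al * h); rewrite -(pmulr_rlt0 _ (x := h^-1)) ?invr_gt0//.
  by move: hH; rewrite mulrC mulrA.
pose s := f y; pose l := s / (s - al).
have sal : s - al != 0 by apply/eqP; move: sy; rewrite -/s; nra.
have lE : l = s * (s - al) / (s - al) ^+ 2 by rewrite /l; field.
have d2 : 0 < (s - al) ^+ 2 by rewrite exprn_even_gt0.
exists (seg (g y) q l).
  apply: (seg_closure oD cD (closg y) Dq).
  have s0 : s != 0 by apply/eqP => s0; move: sy; rewrite -/s s0 mul0r ltxx.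
  have s2 : 0 < s ^+ 2 by rewrite exprn_even_gt0.
  rewrite lE divr_gt0//=; last by move: sy s2; rewrite -/s; nra.
  by rewrite ler_pdivrMr// mul1r; have := sqr_ge0 al; move: sy; rewrite -/s; nra.
transitivity ((1 - l) * s + l * al); first by rewrite /s /al /f /seg /dot/=; ring.
by rewrite /l; field.
Unshelve. all: by end_near.
Qed.

(** The variational inequality that characterizes [g x] as the point nearest to [q] in the closure
    of [Din]. *)
Definition Foot q x := forall p, Din p -> dot (p - g x) (q - g x) <= 0.

Lemma Foot_closure q x p : Foot q x -> closure Din p -> dot (p - g x) (q - g x) <= 0.
Proof.
move=> F Dp; rewrite leNgt; apply/negP => pos.
have H : dot (z - g x) (q - g x) @[z --> p] --> dot (p - g x) (q - g x).
  by apply: cvg_dot; [apply: cvgB; [exact: cvg_id|exact: cvg_cst]|exact: cvg_cst].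
have [z Dz] := (closureP Din p).1 Dp _ (cvgr_gt _ H _ pos).
by rewrite /= ltNge F.
Qed.

Lemma Foot_curve q x y : Foot q x -> dot (g y - g x) (q - g x) <= 0.
Proof. by move=> /Foot_closure; apply; exact: (curve_closure (an_boundary A)). Qed.

(** The function [f] attains its maximum 0 at [x], so its derivative vanishes there. *)
Lemma Foot_orthogonal q x : Foot q x -> dot (q - g x) (g' x) = 0.
Proof.
move=> F; pose f y := dot (g y - g x) (q - g x).
have df (y : R) : is_derive y 1 f (dot (g' y) (q - g x)).
  have d1 := is_derive_fst (an_derive A y); have d2 := is_derive_snd (an_derive A y).
  have -> : f = (q - g x).1 \*: ((fun t => (g t).1) - cst (g x).1) +
                (q - g x).2 \*: ((fun t => (g t).2) - cst (g x).2).
    by apply/funext => t; rewrite /f /dot /= !fctE /= /GRing.scale/=; ring.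
  by apply: is_derive_eq; rewrite /dot /= /GRing.scale/=; ring.
have xx : x \in `](x - 1), (x + 1)[ by rewrite in_itv/= ltrBlDr ltrDl ltr01.
have d0 : is_derive x 1 f 0.
  apply: (derive1_at_max _ _ xx) => [|t _|t _].
  - by lra.
  - by case: (df t).
  - have -> : f x = 0 by rewrite /f /dot/=; ring.
    exact: Foot_curve.
by case: d0 => _ <-; case: (df x) => _ ->; rewrite dotC.
Qed.

Lemma Foot_ray x r : 0 <= r -> Foot (ray x r) x.
Proof.
move=> r0 p Dp; have [_ _ nD _] := nrmP x.
have -> : dot (p - g x) (ray x r - g x) = r * dot (p - g x) (nrm x).
  by rewrite /dot/=; ring.
by rewrite mulr_ge0_le0// ltW// nD.
Qed.

Lemma Foot_rayP q x : Foot q x -> exists2 r, 0 <= r & q = ray x r.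
Proof.
move=> F; have := ray_of_orthogonal (Foot_orthogonal F); set r := _ / _ => qE.
exists r => //; have [p Dp] := an_D0 A; have [n0 _ nD _] := nrmP x.
have := F p Dp; rewrite qE.
have -> : dot (p - g x) (ray x r - g x) = r * dot (p - g x) (nrm x).
  by rewrite /dot/=; ring.
by rewrite nmulr_lle0// nD.
Qed.

(** Sum of the two variational inequalities, each tested at the other foot; it makes the projection
    nonexpansive. *)
Lemma Foot_dist q q' x x' : Foot q x -> Foot q' x' ->
  dot (g x - g x') (g x - g x') <= dot (g x - g x') (q - q').
Proof.
move=> F F'; have := Foot_curve x' F; have := Foot_curve x F'.
by rewrite /dot/=; lra.
Qed.

Lemma Foot_unique q x x' : Foot q x -> Foot q x' -> g x = g x'.
Proof.
move=> F F'; apply/eqP; rewrite -subr_eq0; apply/eqP/dot_eq0/le_anti.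
rewrite dot_ge0 andbT; apply: le_trans (Foot_dist F F') _.
by rewrite /dot/=; lra.
Qed.

Lemma Foot_eq q x y : g x = g y -> Foot q x -> Foot q y.
Proof. by move=> E F p /F; rewrite E. Qed.

Lemma compact_closure_inner : compact (closure Din).
Proof.
have [r rD] := an_bounded A.
apply: (@subclosed_compact _ _ (`[- r, r] `*` `[- r, r])).
- exact: closed_closure.
- by apply: compact_setX; exact: segment_compact.
- by move=> q /(an_sub A)/rD[H1 H2]; split; rewrite /= in_itv.
Qed.

(** The nearest point of the compact closure satisfies the variational inequality by a first
    variation along segments. It lies on the boundary curve, because from a point of [Din] a small
    step towards [q] would stay in [Din] and violate that inequality. *)
Lemma Foot_exists q : ~ Din q -> exists x, Foot q x.
Proof.
move=> nDq; pose f p := dot (p - q) (p - q).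
have [oD cD] := (an_openD A, an_convex A).
have cf : continuous f.
  by move=> p; apply: cvg_dot; apply: cvgB; (exact: cvg_id || exact: cvg_cst).
have c0 : closure Din !=set0 by have [p Dp] := an_D0 A; exists p; exact: subset_closure.
have [p + min] := compact_EVT_min c0 compact_closure_inner (continuous_subspaceT cf).
rewrite inE => Dp.
have main z l : Din z -> 0 < l <= 1 -> f p <= f (seg p z l).
  move=> Dz l1; apply: min; rewrite inE; apply: subset_closure.
  exact: seg_closure.
have Fp z : Din z -> dot (z - p) (q - p) <= 0.
  move=> Dz; rewrite leNgt; apply/negP => pos.
  pose a := dot (z - p) (q - p); pose b := dot (z - p) (z - p).
  have b0 : 0 <= b by exact: dot_ge0.
  (* Chosen so that [0 < l <= 1] and [l * b < 2 * a], which makes the squared distance to [q]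
     drop. *)
  pose l := a / (a + b + 1) .
  have a0 : 0 < a by exact: pos.
  have d0 : 0 < a + b + 1 by lra.
  have l0 : 0 < l by rewrite divr_gt0.
  have l1 : l <= 1 by rewrite ler_pdivrMr// mul1r; lra.
  have := main z l Dz; rewrite l0 l1 => /(_ isT).
  have -> : f (seg p z l) = f p - 2 * l * a + l ^+ 2 * b.
    by rewrite /f /seg /a /b /dot /=; ring.
  have lE : l * (a + b + 1) = a by rewrite /l divfK// lt0r_neq0.
  have : l * (l * b) < l * (2 * a).
    by rewrite ltr_pM2l//; nra.
  by rewrite expr2; nra.
have nDp : ~ Din p.
  move=> Dip; have H : seg p q l @[l --> (0 : R)^'+] --> p.
    have {2}-> : p = seg p q 0 by rewrite /seg !mul0r !addr0; case: (p).
    by apply: cvg_seg; [exact: cvg_cst|exact: cvg_cst|apply: cvg_at_right_filter; exact: cvg_id].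
  have /filter_ex[l [l0 Dl]] : \forall l \near (0 : R)^'+, 0 < l /\ Din (seg p q l).
    near=> l; split; near: l; [exact: nbhs_right_gt|exact: near_open H].
  have := Fp _ Dl.
  have -> : dot (seg p q l - p) (q - p) = l * dot (q - p) (q - p).
    by rewrite /seg /dot/=; ring.
  rewrite pmulr_rle0// => H0; apply: nDq.
  suff -> : q = p by [].
  by apply/eqP; rewrite -subr_eq0; apply/eqP/dot_eq0/le_anti; rewrite H0 dot_ge0.
have : range g p by rewrite -(an_boundary A).
by case=> x _ xp; exists x => z /Fp; rewrite -xp.
Unshelve. all: by end_near.
Qed.

End Foot.

(** * Bars *)

Section Topology.
Context {R : realType}.
Implicit Types (p q z : R * R).

Lemma seg_start p q : seg p q 0 = p.
Proof. by rewrite /seg !mul0r !addr0; case: p. Qed.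

Lemma seg_end p q : seg p q 1 = q.
Proof. by rewrite /seg !mul1r !subrKC; case: q. Qed.

Lemma connected_curve (T : topologicalType) (f : R -> T) (a b : R) : continuous f ->
  connected (f @` `[a, b]).
Proof.
move=> cf; apply: connected_continuous_connected.
  exact/connected_intervalP/interval_is_interval.
exact: continuous_subspaceT.
Qed.

Lemma continuous_seg p q : continuous (seg p q).
Proof. by move=> l; apply: cvg_seg; [exact: cvg_cst|exact: cvg_cst|exact: cvg_id]. Qed.

Lemma connected_component_seg (W : set (R * R)) p q :
  (forall l, 0 <= l <= 1 -> W (seg p q l)) -> connected_component W p q.
Proof.
move=> Wl; have := @connected_component_max _ W (seg p q @` `[0, 1]) p.
apply.
- by exists 0; [rewrite /= in_itv/= lexx ler01|exact: seg_start].
- by move=> _ [l /= ll <-]; apply: Wl; rewrite in_itv in ll.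
- exact: connected_curve (@continuous_seg p q).
- by exists 1; [rewrite /= in_itv/= lexx ler01|exact: seg_end].
Qed.

Lemma near_connected_component (W : set (R * R)) p : nbhs p W ->
  \forall z \near p, connected_component W p z.
Proof.
move=> /nbhs_ballP[e /= e0 eW]; apply/nbhs_ballP; exists e => //= z [z1 z2].
apply: connected_component_seg => l /andP[l0 l1]; apply: eW; split; rewrite /= /ball/= in z1 z2 *.
- have -> : p.1 - (seg p z l).1 = l * (p.1 - z.1) by rewrite /seg/=; ring.
  by rewrite normrM ger0_norm//; apply: le_lt_trans z1; rewrite ler_piMl.
- have -> : p.2 - (seg p z l).2 = l * (p.2 - z.2) by rewrite /seg/=; ring.
  by rewrite normrM ger0_norm//; apply: le_lt_trans z2; rewrite ler_piMl.
Qed.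

Lemma connected_componentS (W W' : set (R * R)) p : W `<=` W' ->
  connected_component W p `<=` connected_component W' p.
Proof.
move=> WW' q [B [Bp BW cB] Bq]; exists B => //; split => //; exact: subset_trans WW'.
Qed.

Lemma near_seg (D : set (R * R)) p q : open D -> (forall l, 0 <= l <= 1 -> D (seg p q l)) ->
  \forall p' \near p & q' \near q, forall l, 0 <= l <= 1 -> D (seg p' q' l).
Proof.
move=> oD H.
have /compact_near_coveringP := @segment_compact R 0 1.
move=> /(_ ((R * R) * (R * R))%type (nbhs (p, q)) (fun i l => D (seg i.1 i.2 l))).
move=> /(_ _)[].
- move=> l /=; rewrite in_itv/= => /H Dl.
  suff : \forall z \near (l, (p, q)), D (seg z.2.1 z.2.2 z.1) by [].
  apply: (@near_open _ _ (nbhs (l, (p, q))) _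
    (fun z : R * ((R * R) * (R * R)) => seg z.2.1 z.2.2 z.1) D _ oD Dl).
  pose T := (R * ((R * R) * (R * R)))%type.
  apply: (@cvg_seg R T (nbhs (l, (p, q))) _ (fun z : T => z.2.1) (fun z : T => z.2.2) (fun z : T => z.1)).
  + apply: (@cvg_comp _ _ _ (@snd R ((R * R) * (R * R))) fst _ (nbhs (p, q))); first exact: cvg_snd.
    exact: cvg_fst.
  + apply: (@cvg_comp _ _ _ (@snd R ((R * R) * (R * R))) snd _ (nbhs (p, q))); first exact: cvg_snd.
    exact: cvg_snd.
  + exact: cvg_fst.
- move=> [U V] /= [Up Vq] UV; by exists (U, V).
Qed.

End Topology.

Section Bars.
Context {R : realType}.
Implicit Types (p q z n : R * R).
Variables (g g' : R -> R * R) (Din Dout : set (R * R)).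
Hypothesis A : annular g g' Din Dout.
Local Notation Om := (annulus Din Dout).
Local Notation n := (nrm g g' Din).
Local Notation ray := (ray g g' Din).
Local Notation Foot := (Foot g Din).
Local Notation bar := (bar Om g).

Lemma bar_constraint x q : dot (q - g x) (unit_tangent g x) = 0 <-> dot (q - g x) (g' x) = 0.
Proof.
have E : derive1 g x = g' x by rewrite derive1E; case: (an_derive A x).
have v0 : 0 < Num.sqrt (dot (g' x) (g' x)) by rewrite sqrtr_gt0 dot_gt0// (an_neq0 A).
rewrite /unit_tangent E; set c := Num.sqrt _.
have -> : dot (q - g x) (c^-1 *: g' x) = c^-1 * dot (q - g x) (g' x).
  transitivity ((q - g x).1 * (c^-1 * (g' x).1) + (q - g x).2 * (c^-1 * (g' x).2)) => //.
  by rewrite /dot; ring.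
split=> [/eqP|->]; last by rewrite mulr0.
by rewrite mulf_eq0 invr_eq0 gt_eqF//= => /eqP.
Qed.

Lemma curve_annulus x : Om (g x).
Proof.
split; last exact: (curve_notin (an_boundary A)).
apply: (an_sub A); exact: (curve_closure (an_boundary A)).
Qed.

Lemma bar_base x : bar x (g x).
Proof.
apply: connected_component_refl; split; first exact: curve_annulus.
by rewrite subrr /dot/=; ring.
Qed.

Lemma bar_connected x : connected (bar x).
Proof. exact: component_connected. Qed.

Lemma bar_sub x : bar x `<=` Om.
Proof. by move=> q /connected_component_sub[]. Qed.

Lemma seg_ray x r l : seg (g x) (ray x r) l = ray x (l * r).
Proof. by rewrite /seg /ray /=; congr pair; ring. Qed.

Lemma Foot_seg q x l : 0 <= l -> Foot q x -> Foot (seg (g x) q l) x.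
Proof.
move=> l0 F p /F; have -> : dot (p - g x) (seg (g x) q l - g x) = l * dot (p - g x) (q - g x).
  by rewrite /seg /dot/=; ring.
by move=> H; rewrite mulr_ge0_le0.
Qed.

Lemma Foot_notin q x : Foot q x -> ~ Din q.
Proof.
move=> F Dq; have := F q Dq => H.
have : q - g x = 0 by apply/dot_eq0/le_anti; rewrite H dot_ge0.
by move/eqP; rewrite subr_eq0 => /eqP E; apply: (curve_notin (an_boundary A) (x := x)); rewrite -E.
Qed.

(** The component lies on the normal line, where its coordinate [r] ranges over an interval
    containing 0. Negative values are impossible since the points just behind [g x] belong to [Din],
    so the bar is the part of the outward ray visible from [g x]. *)
Lemma barE x q : bar x q <-> Foot q x /\ forall l, 0 <= l <= 1 -> Dout (seg (g x) q l).
Proof.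
split=> [[C [Cx CW cC] Cq]|[F H]]; last first.
  apply: connected_component_seg => l l01; split.
    split; first exact: H.
    by apply: (@Foot_notin _ x); apply: Foot_seg => //; case/andP: l01.
  apply/bar_constraint; have := Foot_orthogonal A F.
  have -> : dot (seg (g x) q l - g x) (g' x) = l * dot (q - g x) (g' x).
    by rewrite /seg /dot/=; ring.
  by move->; rewrite mulr0.
have [n0 nv nD nE] := nrmP A x.
pose r z := dot (z - g x) (n x) / dot (n x) (n x).
have CE z : C z -> z = ray x (r z).
  by move=> /CW[_ /bar_constraint] /(ray_of_orthogonal A).
have cr : continuous r.
  move=> z; apply: cvgMl; apply: cvg_dot; last exact: cvg_cst.
  by apply: cvgB; [exact: cvg_id|exact: cvg_cst].
have /connected_intervalP iC : connected (r @` C).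
  by apply: connected_continuous_connected => //; exact: continuous_subspaceT.
have rx : r (g x) = 0 by rewrite /r subrr /dot/= !mul0r addr0 mul0r.
have C0 : (r @` C) 0 by exists (g x).
have Crq : (r @` C) (r q) by exists q.
have r0 : 0 <= r q.
  rewrite leNgt; apply/negP => rneg.
  have [e0 e00 De] := inward_ray A x.
  pose e := Num.min e0 (- r q).
  have eq : 0 < e by rewrite lt_min e00 oppr_gt0.
  have : (r @` C) (- e).
    apply: (iC _ _ Crq C0); apply/andP; split; last by rewrite oppr_le0 ltW.
    by rewrite lerNr ge_min lexx orbT.
  case=> z Cz rz; have := CW z Cz => -[[_ +] _]; apply.
  by rewrite (CE z Cz) rz; apply: De; rewrite eq ge_min lexx.
have qE := CE q Cq.
split; first by rewrite qE; exact: (Foot_ray A).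
move=> l /andP[l0 l1].
have : (r @` C) (l * r q).
  by apply: (iC _ _ C0 Crq); rewrite mulr_ge0//= ler_piMl.
case=> z Cz rz; rewrite qE seg_ray -rz -(CE z Cz).
by have [[]] := CW z Cz.
Qed.

Lemma bar_disjoint x y q : bar x q -> bar y q -> g x = g y.
Proof. by move=> /barE[F _] /barE[F' _]; exact: (Foot_unique A F F'). Qed.

Lemma bar_eq x y : g x = g y -> bar x = bar y.
Proof.
suff sub x' y' : g x' = g y' -> bar x' `<=` bar y'.
  by move=> E; apply/seteqP; split; exact: sub.
move=> E q /barE[F H]; apply/barE; split; first exact: Foot_eq F.
by rewrite -E.
Qed.

(** [L] is the infimum of the exit parameters, which exist by boundedness; it is itself an exit
    because [Dout] is open, and positive because [g x] lies in [Dout]. *)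
Lemma bar_end x : exists L, [/\ 0 < L, forall r, 0 <= r < L -> Dout (ray x r) & ~ Dout (ray x L)].
Proof.
have cr : continuous (ray x).
  move=> r; apply: cvg_pairR; apply: cvgD; do ?exact: cvg_cst; apply: cvgMl; exact: cvg_id.
have [n0 _ _ _] := nrmP A x.
pose S := [set r | 0 <= r /\ ~ Dout (ray x r)].
have S0 : S !=set0.
  have [b bD] := an_bounded A.
  apply: contrapT => nS.
  have D r : 0 <= r -> Dout (ray x r).
    by move=> r0; apply: contrapT => nD; apply: nS; exists r.
  have k (n1 g1 : R) : n1 != 0 -> exists2 r, 0 <= r & `|b| < `|g1 + r * n1|.
    move=> n10; exists ((`|b| + `|g1| + 1) / `|n1|).
      by rewrite divr_ge0// !addr_ge0.
    have : `|(`|b| + `|g1| + 1) / `|n1| * n1| = `|b| + `|g1| + 1.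
      rewrite normrM [`|_ / _|]ger0_norm ?divr_ge0 ?addr_ge0// divfK// normr_eq0//.
    move=> E; have := lerB_dist ((`|b| + `|g1| + 1) / `|n1| * n1) (- g1).
    rewrite E normrN opprK [_ * _ + _]addrC; lra.
  have [n1|n1] := eqVneq (n x).1 0; last first.
    have [r r0 br] := k _ (g x).1 n1.
    have [+ _] := bD _ (D r r0); rewrite -ler_norml /= => H.
    by have := lt_le_trans br H; rewrite ltNge ler_norm.
  have n2 : (n x).2 != 0.
    by apply: contraTneq n0 => n2; rewrite /dot n1 n2 !mul0r addr0 ltxx.
  have [r r0 br] := k _ (g x).2 n2.
  have [_ +] := bD _ (D r r0); rewrite -ler_norml /= => H.
  by have := lt_le_trans br H; rewrite ltNge ler_norm.
have lS : has_lbound S by exists 0 => r [].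
have iS : has_inf S by [].
set L := inf S.
have nDL : ~ Dout (ray x L).
  move=> DL; have H : \forall r \near L, Dout (ray x r).
    exact: (near_open (an_openO A) DL (cr L)).
  have /nbhs_ballP[e /= e0 eD] := H.
  have [r Sr rL] := inf_adherent e0 iS.
  have Lr : L <= r by exact: ge_inf.
  have : ball L e r by rewrite /ball/= distrC ger0_norm ?subr_ge0// ltrBlDl.
  by move=> /eD /=; case: Sr.
have L0 : 0 <= L by apply: lb_le_inf => // r [].
exists L; split => //.
  rewrite lt_neqAle L0 andbT; apply/eqP => E; apply: nDL; rewrite -E ray0.
  by case: (curve_annulus x).
move=> r /andP[r0 rL]; apply: contrapT => nD.
by have : S r by []; move/(ge_inf lS); rewrite leNgt rL.
Qed.

Definition bar_length x : R := xget 0 [set L |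
  [/\ 0 < L, forall r, 0 <= r < L -> Dout (ray x r) & ~ Dout (ray x L)]].

Lemma bar_lengthP x : [/\ 0 < bar_length x,
  forall r, 0 <= r < bar_length x -> Dout (ray x r) & ~ Dout (ray x (bar_length x))].
Proof. by rewrite /bar_length; case: xgetP => // H; have [L /H] := bar_end x. Qed.

Lemma bar_rayP x q : bar x q <-> exists2 r, 0 <= r < bar_length x & q = ray x r.
Proof.
have [L0 LD nDL] := bar_lengthP x; split=> [/barE[F H]|[r /andP[r0 rL] ->]].
  have [r r0 E] := Foot_rayP A F; exists r => //; rewrite r0 ltNge; apply/negP => Lr.
  have r1 : 0 < r by exact: lt_le_trans Lr.
  apply: nDL; have := H (bar_length x / r); rewrite E seg_ray divfK ?lt0r_neq0//; apply.
  by rewrite divr_ge0 ?(ltW L0)//= ler_pdivrMr// mul1r.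
apply/barE; split; first exact: (Foot_ray A).
move=> l /andP[l0 l1]; rewrite seg_ray; apply: LD; rewrite mulr_ge0//=.
by apply: le_lt_trans rL; rewrite ler_piMl.
Qed.

(** The bar lacks its outer end and is not closed in the plane; the segment completed by that end
    is, and has the same trace on [Om]. *)
Lemma bar_closed x : closed (ray x @` `[0, bar_length x]) /\
  forall q, Om q -> bar x q <-> (ray x @` `[0, bar_length x]) q.
Proof.
have [L0 LD nDL] := bar_lengthP x; split.
  apply: compact_closed; first exact: norm_hausdorff.
  apply: continuous_compact; last exact: segment_compact.
  apply: continuous_subspaceT => r; apply: cvg_pairR; apply: cvgD;
    do ?exact: cvg_cst; apply: cvgMl; exact: cvg_id.
move=> q [Dq _]; split=> [/bar_rayP[r /andP[r0 rL] ->]|[r /= rL rq]].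
  by exists r => //=; rewrite in_itv/= r0 ltW.
apply/bar_rayP; exists r => //; move: rL; rewrite in_itv/= => /andP[-> ]/=.
by rewrite le_eqVlt => /orP[/eqP E|//]; move: Dq; rewrite -rq E.
Qed.

(** Visibility survives small changes of both ends of a segment, and the foot moves no farther than
    the point. Points hidden behind bends of the outer curve need not lie on any bar. *)
Lemma visible_open x q : bar x q -> \forall z \near q, Om z -> exists y, bar y z.
Proof.
move=> /barE[F H].
have := near_seg (an_openO A) H.
move=> [[U V] /= [Up Vq] UV].
have /nbhs_ballP[e /= e0 eU] := Up.
have B : \forall z \near q, dot (z - q) (z - q) < e ^+ 2.
  have : dot (z - q) (z - q) @[z --> q] --> dot (q - q) (q - q).
    by apply: cvg_dot; apply: cvgB; (exact: cvg_id || exact: cvg_cst).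
  move/cvgr_lt; apply.
  have -> : dot (q - q) (q - q) = 0 by rewrite /dot/=; ring.
  exact: exprn_gt0.
near=> z => -[Dz nDz].
have [y Fy] := Foot_exists A nDz; exists y; apply/barE; split => //.
have Vz : V z by near: z.
have zq : dot (z - q) (z - q) < e ^+ 2 by near: z.
have := Foot_dist A Fy F => dist.
have sq : dot (g y - g x) (g y - g x) < e ^+ 2.
  apply: le_lt_trans zq; rewrite -subr_ge0.
  have -> : dot (z - q) (z - q) - dot (g y - g x) (g y - g x) =
    dot ((z - q) - (g y - g x)) ((z - q) - (g y - g x)) +
    2 * (dot (g y - g x) (z - q) - dot (g y - g x) (g y - g x)).
    by rewrite /dot /=; ring.
  by rewrite addr_ge0 ?dot_ge0// mulr_ge0// subr_ge0.
apply: (UV (g y, z)); split => //=; apply: eU; split; rewrite /ball/= -ltr_sqr ?nnegrE ?(ltW e0)//;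
  rewrite real_normK ?num_real//; apply: le_lt_trans sq; rewrite /dot/= -!expr2.
  by rewrite -[X in X <= _]sqrrN opprB lerDl sqr_ge0.
by rewrite -[X in X <= _]sqrrN opprB lerDr sqr_ge0.
Unshelve. all: by end_near.
Qed.

(* The points that are not connected to the inner boundary form a clopen subset
   of [Dout] that misses [Din]. *)
Lemma component_reaches_curve (X : set R) (C : set (R * R)) q :
  closed C -> (forall q, Om q -> C q <-> exists2 x, X x & bar x q) ->
  Om q -> ~ C q ->
  exists2 x, ~ C (g x) & connected_component (Om `\` \bigcup_(x in X) bar x) (g x) q.
Proof.
move=> cC CX Oq nCq; apply: contrapT => nreach.
set W := Om `\` _ in nreach.
have WE z : W z <-> Om z /\ ~ C z.
  split=> -[Oz H]; split => //.
    by move/(CX z Oz) => [x Xx xz]; apply: H; exists x.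
  by move=> [x Xx xz]; apply: H; apply/CX => //; exists x.
pose U := [set z | W z /\ forall x, ~ C (g x) -> ~ connected_component W (g x) z].
have Uq : U q.
  by split; [exact/WE|move=> x nC cc; apply: nreach; exists x].
(* A point of [U] on a bar would be joined to the inner curve by the bar itself, which avoids [C]
   because distinct bars are disjoint. *)
have UV x z : bar x z -> ~ U z.
  move=> xz [Wz]; have [Oz nCz] := (WE z).1 Wz.
  have xW : bar x `<=` W.
    move=> y xy; apply/WE; split; first exact: bar_sub xy.
    move/(CX y (bar_sub xy)) => [x' Xx' x'y].
    have E := bar_eq (bar_disjoint xy x'y).
    apply: nCz; apply: (CX z Oz).2; exists x'; first exact: Xx'.
    by move: xz; rewrite E.
  have [_ nCx] := (WE _).1 (xW _ (bar_base x)).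
  move=> /(_ x nCx); apply; exists (bar x) => //; split=> //.
    exact: bar_base.
  exact: bar_connected.
have loc p : Om p -> (forall x, ~ bar x p) -> \forall z \near p, connected_component W p z.
  move=> [Dp nDp] nV; apply: near_connected_component.
  have ncl : ~ closure Din p.
    move=> cl; have : range g p by rewrite -(an_boundary A).
    by case=> x _ E; apply: (nV x); rewrite -E; exact: bar_base.
  have nC : ~ C p by move/CX => -[//|x _ /nV].
  near=> z; apply/WE; split; first split.
  - by near: z; exact: open_nbhs_nbhs (conj (an_openO A) Dp).
  - have : ~ closure Din z.
      near: z; apply: open_nbhs_nbhs; split => //.
      by apply: closed_openC; exact: closed_closure.
    by move=> + Dz; apply; exact: subset_closure.
  - by near: z; apply: open_nbhs_nbhs; split => //; exact: closed_openC.
have oU : open U.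
  rewrite openE => p Up; have [Wp Hp] := Up; have [Op nCp] := (WE p).1 Wp.
  have nV x : ~ bar x p by move=> xp; exact: UV xp Up.
  rewrite /interior; near=> z.
  have pz : connected_component W p z by near: z; exact: loc.
  split; first exact: connected_component_sub pz.
  move=> x nCx xz; apply: (Hp x nCx).
  by apply: (connected_component_trans xz); exact: connected_component_sym.
have UO : U `<=` Dout by move=> z [/WE[[]]].
(* For closedness in [Dout]: a limit point cannot lie in the open set [Din], which [U] avoids; near
   a point on a bar every point of the annulus lies on a bar, hence off [U]; any other point is
   joined to a whole neighbourhood. *)
have UE : U = Dout.
  apply: (an_connected A); first by exists q.
    by exists U => //; rewrite setIidr.
  exists (closure U); first exact: closed_closure.
  apply/seteqP; split=> [z Uz|p [Dp clp]].
    by split; [exact: UO|exact: subset_closure].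
  have nDp : ~ Din p.
    move=> Dip; have [z Uz Dz] := (closureP U p).1 clp _ (open_nbhs_nbhs (conj (an_openD A) Dip)).
    by case: Uz => /WE[[_ nDz] _] _; exact: nDz.
  have Op : Om p by [].
  have [[x xp]|nV] := pselect (exists x, bar x p).
    have [z Uz Vz] := (closureP U p).1 clp _ (visible_open xp).
    have [y yz] := Vz (proj1 ((WE z).1 (proj1 Uz))).
    by case: (UV y z yz).
  have nV' x : ~ bar x p by move=> xp; apply: nV; exists x.
  have [z [Wz Hz] pz] := (closureP U p).1 clp _ (loc p Op nV').
  split; first exact: connected_component_sub (connected_component_sym pz).
  by move=> x nC xp; apply: (Hz x nC); exact: connected_component_trans pz.
have [d Dd] := an_D0 A.
have : U d by rewrite UE; apply: (an_sub A); exact: subset_closure.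
by case=> /WE[[_ nDd] _] _; exact: nDd.
Unshelve. all: by end_near.
Qed.

End Bars.

(** * Separation of the annulus by two bars *)

Section SquareRootBranch.
Context {R : realType}.
Implicit Types (p q z w : R * R).

(** Plane points as complex numbers. Quotients are avoided: [cmul z (conjp w)] is a positive
    multiple of [z / w], and only arguments matter. *)
Definition cmul z w : R * R := (z.1 * w.1 - z.2 * w.2, z.1 * w.2 + z.2 * w.1).
Definition conjp z : R * R := (z.1, - z.2).
Definition cabs z : R := Num.sqrt (dot z z).

(* [z + |z|] is a positive multiple of the principal square root of [z]; it
   vanishes exactly on the closed negative half-line. *)
Definition sqrt_dir z : R * R := (z.1 + cabs z, z.2).

Definition slit z := z.2 != 0 \/ 0 < z.1.

Lemma cabsE z : cabs z ^+ 2 = dot z z.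
Proof. by rewrite /cabs sqr_sqrtr// dot_ge0. Qed.

Lemma cabs_ge0 z : 0 <= cabs z.
Proof. exact: sqrtr_ge0. Qed.

Lemma slit_gt0 z : slit z -> 0 < z.1 + cabs z.
Proof.
have := cabsE z; have := cabs_ge0 z; rewrite /dot => a0 aE [z2|z1]; last by lra.
have : 0 < z.2 ^+ 2 by rewrite exprn_even_gt0.
rewrite ltNge => z22; apply/negP => le0.
have : cabs z * cabs z <= - z.1 * - z.1 by apply: ler_pM => //; lra.
by move: z22; rewrite -expr2 aE; lra.
Qed.

Lemma sqrt_dirE z : cmul (sqrt_dir z) (sqrt_dir z) =
  (2 * (z.1 + cabs z) * z.1, 2 * (z.1 + cabs z) * z.2).
Proof.
rewrite /cmul /sqrt_dir /=; congr pair; last by ring.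
have := cabsE z; rewrite /dot => E.
transitivity (z.1 ^+ 2 + 2 * z.1 * cabs z + cabs z ^+ 2 - z.2 * z.2); first by ring.
by rewrite E; ring.
Qed.

Lemma cvg_cmul (T : Type) (F : set_system T) {FF : Filter F} (f h : T -> R * R) p q :
  f x @[x --> F] --> p -> h x @[x --> F] --> q -> cmul (f x) (h x) @[x --> F] --> cmul p q.
Proof.
move=> fp hq; have f1 := @cvg_fstR _ _ _ FF _ _ fp; have f2 := @cvg_sndR _ _ _ FF _ _ fp.
have h1 := @cvg_fstR _ _ _ FF _ _ hq; have h2 := @cvg_sndR _ _ _ FF _ _ hq.
by apply: cvg_pairR; [apply: cvgB; exact: cvgM|apply: cvgD; exact: cvgM].
Qed.

Lemma cvg_conjp (T : Type) (F : set_system T) {FF : Filter F} (f : T -> R * R) p :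
  f x @[x --> F] --> p -> conjp (f x) @[x --> F] --> conjp p.
Proof.
by move=> fp; apply: cvg_pairR; [exact: cvg_fstR|apply: cvgN; exact: cvg_sndR].
Qed.

Lemma cvg_cabs (T : Type) (F : set_system T) {FF : Filter F} (f : T -> R * R) p :
  f x @[x --> F] --> p -> cabs (f x) @[x --> F] --> cabs p.
Proof.
move=> fp; apply: (@cvg_comp _ _ _ (fun x => dot (f x) (f x)) Num.sqrt _ (nbhs (dot p p))).
  exact: cvg_dot.
exact: sqrt_continuous.
Qed.

Lemma cvg_sqrt_dir (T : Type) (F : set_system T) {FF : Filter F} (f : T -> R * R) p :
  f x @[x --> F] --> p -> sqrt_dir (f x) @[x --> F] --> sqrt_dir p.
Proof.
move=> fp; apply: cvg_pairR; last exact: cvg_sndR.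
by apply: cvgD; [exact: cvg_fstR|exact: cvg_cabs].
Qed.

Lemma parallel_decomposition v w : v != 0 -> v.1 * w.2 = v.2 * w.1 ->
  w = (dot w v / dot v v * v.1, dot w v / dot v v * v.2).
Proof.
move=> v0 E; have d0 := lt0r_neq0 (dot_gt0 v0).
rewrite [LHS]surjective_pairing; congr pair; apply: (mulIf d0); rewrite mulrAC divfK//.
- transitivity (w.1 * dot v v + v.2 * (v.1 * w.2 - v.2 * w.1)).
    by rewrite E subrr mulr0 addr0.
  by rewrite /dot; ring.
- transitivity (w.2 * dot v v - v.1 * (v.1 * w.2 - v.2 * w.1)).
    by rewrite E subrr mulr0 subr0.
  by rewrite /dot; ring.
Qed.

(** The real part is the scalar product of [z - p] and [z - q], the imaginary part their cross
    product up to sign. If the latter vanishes and the former is not positive, then [z] lies on the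
    segment. *)
Lemma slit_segment p q z : (forall l, 0 <= l <= 1 -> z <> seg p q l) ->
  slit (cmul (z - p) (conjp (z - q))).
Proof.
move=> H; rewrite /slit; set w := cmul _ _.
have [w2|] := eqVneq w.2 0; last by left.
right; rewrite ltNge; apply/negP => w1.
have w1E : w.1 = dot (z - p) (z - q) by rewrite /w /cmul /conjp /dot /=; ring.
have [pq|pq] := eqVneq p q.
  apply: (H 0); first by rewrite lexx ler01.
  rewrite seg_start; apply/eqP; rewrite -subr_eq0; apply/eqP/dot_eq0/le_anti.
  by rewrite dot_ge0 andbT {2}pq -w1E.
have d0 : q - p != 0 by rewrite subr_eq0 eq_sym.
have dd := dot_gt0 d0.
pose l := dot (z - p) (q - p) / dot (q - p) (q - p).
have : z - p = (l * (q - p).1, l * (q - p).2).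
  by apply: parallel_decomposition => //; move: w2; rewrite /w /cmul /conjp /=; lra.
move=> E; have zE : z = seg p q l.
  have := congr1 fst E; have := congr1 snd E => /= E2 E1.
  by rewrite [LHS]surjective_pairing /seg -E1 -E2; congr pair; rewrite subrKC.
apply: (H l) => //.
have : w.1 = l * (l - 1) * dot (q - p) (q - p).
  by rewrite w1E zE /seg /dot /=; ring.
move: w1 => /[swap] ->; rewrite pmulr_lle0//.
rewrite leNgt => /negP l01; apply/andP; split; rewrite leNgt; apply/negP => l0; apply: l01.
  by rewrite nmulr_rgt0//; lra.
by rewrite mulr_gt0//; lra.
Qed.

Lemma real_of_square_gt0 w t : 0 < t -> cmul w w = (t, 0) -> w.2 = 0 /\ w.1 != 0.
Proof.
move=> t0; rewrite /cmul => -[E1 E2].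
have E : w.1 * w.2 = 0 by lra.
have w1 : w.1 != 0.
  apply/eqP => w1; move: E1; rewrite w1 mul0r; have := sqr_ge0 w.2; rewrite expr2; lra.
by split => //; move/eqP: E; rewrite mulf_eq0 (negbTE w1) => /eqP.
Qed.

Lemma connected_same_sign (T : topologicalType) (C : set T) (f : T -> R) (x y : T) :
  connected C -> {within C, continuous f} -> (forall c, C c -> f c != 0) -> C x -> C y ->
  0 < f x * f y.
Proof.
move=> cC cf f0 Cx Cy.
have /connected_intervalP iC := connected_continuous_connected cC cf.
have Cfp : (f @` C) (f x) by exists x.
have Cfq : (f @` C) (f y) by exists y.
have n0 : ~ (f @` C) 0 by case=> c /f0 /eqP.
rewrite lt_neqAle eq_sym mulf_neq0 ?f0//= leNgt; apply/negP => neg; apply: n0.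
have neg' : ~ 0 < f x * f y by apply/negP; rewrite -leNgt ltW.
have [pq|qp] := leP (f x) (f y).
  apply: (iC _ _ Cfp Cfq); apply/andP; split; rewrite leNgt; apply/negP => pos; apply: neg'.
    by apply: mulr_gt0 => //; exact: lt_le_trans pq.
  by rewrite nmulr_rgt0//; exact: le_lt_trans pos.
apply: (iC _ _ Cfq Cfp); apply/andP; split; rewrite leNgt; apply/negP => pos; apply: neg'.
  by apply: mulr_gt0 => //; exact: lt_trans qp.
by rewrite nmulr_rgt0//; exact: lt_trans pos.
Qed.

End SquareRootBranch.

Section Separation.
Context {R : realType}.
Implicit Types (p q z w n : R * R).

Lemma cmul_square z w : cmul (cmul z w) (cmul z w) = cmul (cmul z z) (cmul w w).
Proof. by rewrite /cmul /=; congr pair; ring. Qed.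

Lemma conjp_cmul z w : conjp (cmul z w) = cmul (conjp z) (conjp w).
Proof. by rewrite /conjp /cmul /=; congr pair; ring. Qed.

Lemma cmul_neq0 z w : z != 0 -> w != 0 -> cmul z w != 0.
Proof.
move=> z0 w0; apply/eqP => E.
have : dot (cmul z w) (cmul z w) = dot z z * dot w w by rewrite /dot /cmul /=; ring.
by rewrite E => H; have := mulr_gt0 (dot_gt0 z0) (dot_gt0 w0); rewrite -H /dot/= !mul0r addr0 ltxx.
Qed.

Lemma conjp_neq0 z : z != 0 -> conjp z != 0.
Proof.
apply: contra => /eqP[z1 /eqP]; rewrite oppr_eq0 => /eqP z2.
by apply/eqP; rewrite [LHS]surjective_pairing z1 z2.
Qed.

Lemma sqrt_dir_neq0 z : slit z -> sqrt_dir z != 0.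
Proof. by move=> /slit_gt0 H; apply/eqP => -[E _]; rewrite E ltxx in H. Qed.

Lemma sqrt_dir_square z : slit z -> exists2 t, 0 < t &
  cmul (sqrt_dir z) (sqrt_dir z) = (t * z.1, t * z.2).
Proof.
move=> /slit_gt0 H; exists (2 * (z.1 + cabs z)); last exact: sqrt_dirE.
by rewrite mulr_gt0.
Qed.

(** With [r = cabs w] one has [(r - w.1) * sqrt_dir w = w.2 * (w.2, r - w.1)]. The vector on the
    right does not vanish on the open negative half-line, so the jump of the square root is isolated
    in the factor [w.2]. *)
Lemma imaginary_part_eq0 p w : cabs w ^+ 2 = dot w w ->
  (cmul p (conjp (sqrt_dir w))).2 = 0 ->
  w.2 * (p.1 * (cabs w - w.1) - p.2 * w.2) = 0.
Proof.
rewrite /dot /cmul /conjp /sqrt_dir /=; move: (cabs w) => r rE p0.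
transitivity (- (r - w.1) * (p.1 * - w.2 + p.2 * (w.1 + r)) +
    p.2 * (r ^+ 2 - (w.1 * w.1 + w.2 * w.2))); first by ring.
by rewrite p0 rE subrr !mulr0 addr0.
Qed.

Lemma real_part_factor (s t d K f : R) p w : cabs w ^+ 2 = dot w w -> w.2 = K * f ->
  (cabs w - w.1) * (s * t * d * (cmul p (conjp (sqrt_dir w))).1) =
  K * (s * d * f) * (t * (p.1 * w.2 + p.2 * (cabs w - w.1))).
Proof.
rewrite /dot /cmul /conjp /sqrt_dir /=; move: (cabs w) => r rE wE.
transitivity (s * t * d * (p.1 * (r ^+ 2 - w.1 * w.1) + p.2 * w.2 * (r - w.1))).
  by ring.
rewrite rE [_ + _ - _]addrAC subrr add0r.
transitivity (s * t * d * w.2 * (p.1 * w.2 + p.2 * (r - w.1))); first by ring.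
by rewrite {1}wE; ring.
Qed.

Variables (g g' : R -> R * R) (Din Dout : set (R * R)) (c : R * R).
Hypothesis A : annular g g' Din Dout.
Hypothesis Dc : Dout c.
Hypothesis star : forall q l, Dout q -> 0 <= l <= 1 -> Dout (seg c q l).
Local Notation Om := (annulus Din Dout).
Local Notation nn := (nrm g g' Din).
Local Notation ray := (ray g g' Din).
Local Notation bar := (bar Om g).
Local Notation bar_length := (bar_length g g' Din Dout).

Definition inner_length x : R := xget 0 [set r |
  0 < r /\ forall e, 0 < e <= r -> Din (ray x (- e))].

Lemma inner_lengthP x : 0 < inner_length x /\
  forall e, 0 < e <= inner_length x -> Din (ray x (- e)).
Proof.
rewrite /inner_length; case: xgetP => [y _ //|H].
by have [r r0 rD] := inward_ray A x; case: (H r).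
Qed.

Let pin x := ray x (- inner_length x).
Let pout x := ray x (bar_length x).

Lemma pin_in x : Din (pin x).
Proof. by have [r0 rD] := inner_lengthP x; apply: rD; rewrite r0 lexx. Qed.

Lemma pout_out x : ~ Dout (pout x).
Proof. by have [_ _] := bar_lengthP A x. Qed.

(* Ratios, up to positive factors, whose square roots are single-valued off the
   normal segment through the bar, off the ray that continues the line from the
   star center [c] beyond the outer end of the bar, and off a chord of [Din]. *)
Let v1 x z := cmul (z - pin x) (conjp (z - pout x)).
Let v2 x z := cmul (pout x - z) (conjp (pout x - c)).
Let v3 x y z := cmul (z - pin x) (conjp (z - pin y)).

(** The slit of [v1] runs from [pin x] through [Din] to the curve, then along the bar, and ends
    outside [Dout]. *)
Lemma slit_bar x z : Om z -> ~ bar x z -> slit (v1 x z).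
Proof.
move=> [Dz nDz] nz; apply: slit_segment => l /andP[l0 l1] E.
have [r0 rD] := inner_lengthP x; have [L0 LD nDL] := bar_lengthP A x.
set r := - inner_length x + l * (bar_length x + inner_length x).
have zE : z = ray x r by rewrite E /seg /pin /pout /ray /r /=; congr pair; ring.
have rL : r <= bar_length x.
  have : l * (bar_length x + inner_length x) <= bar_length x + inner_length x.
    by rewrite ler_piMl// addr_ge0// ltW.
  by rewrite /r; lra.
have [rneg|rpos] := ltP r 0.
  apply: nDz; rewrite zE -[r]opprK; apply: rD; rewrite oppr_gt0 rneg /=.
  by rewrite /r opprD opprK gerBl mulr_ge0// addr_ge0// ltW.
move: rL; rewrite le_eqVlt => /orP[/eqP rL|rL].
  by apply: nDL; rewrite -rL -zE.
by apply: nz; apply/(bar_rayP A); exists r; rewrite // rpos.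
Qed.

(** If [pout x] lay between [z] and the star center, it would belong to [Dout]. *)
Lemma slit_ray x z : Dout z -> slit (v2 x z).
Proof.
move=> Dz; apply: slit_segment => l /andP[l0 l1] E.
apply: (@pout_out x); rewrite E.
have -> : seg z c l = seg c z (1 - l) by rewrite /seg; congr pair; ring.
by apply: star => //; apply/andP; split; lra.
Qed.

Lemma slit_inner x y z : ~ Din z -> slit (v3 x y z).
Proof.
move=> nDz; apply: slit_segment => l l01 E; apply: nDz; rewrite E.
by apply: (an_convex A) => //; exact: pin_in.
Qed.

Let H x z := cmul (sqrt_dir (v1 x z)) (sqrt_dir (v2 x z)).

Lemma neq_of (D : set (R * R)) z p : D z -> ~ D p -> z - p != 0.
Proof. by move=> Dz nDp; rewrite subr_eq0; apply/eqP => E; rewrite E in Dz. Qed.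

(** In the product of [v1] and [v2] the factors [conjp (z - pout x)] and [pout x - z] combine to a
    negative real number, whence the minus sign; only the zero at [pin x] remains. *)
Lemma bar_branch_square x z : Om z -> ~ bar x z -> exists2 t, 0 < t &
  cmul (H x z) (H x z) =
   (- t * (cmul (z - pin x) (conjp (pout x - c))).1,
    - t * (cmul (z - pin x) (conjp (pout x - c))).2).
Proof.
move=> Oz nz; have [t1 t10 E1] := sqrt_dir_square (slit_bar Oz nz).
have [t2 t20 E2] := sqrt_dir_square (slit_ray x Oz.1).
exists (t1 * t2 * dot (z - pout x) (z - pout x)).
  rewrite !mulr_gt0// dot_gt0//; exact: (neq_of Oz.1 (@pout_out x)).
rewrite /H cmul_square E1 E2 /v1 /v2 /cmul /conjp /dot /=; congr pair; ring.
Qed.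

Section two_bars.
Variables (a b : R).

(* The zeros and poles cancel in the product of the branches: its square is a
   positive multiple of the constant [k], so its direction is locally constant. *)
Let G z := cmul (H a z) (cmul (conjp (H b z)) (conjp (sqrt_dir (v3 a b z)))).
Let k := cmul (conjp (pout a - c)) (pout b - c).

Lemma branch_square z : Om z -> ~ bar a z -> ~ bar b z ->
  exists2 t, 0 < t & cmul (G z) (G z) = (t * k.1, t * k.2).
Proof.
move=> Oz na nb.
have [ta ta0 Ea] := bar_branch_square Oz na.
have [tb tb0 Eb] := bar_branch_square Oz nb.
have [t3 t30 E3] := sqrt_dir_square (slit_inner a b Oz.2).
exists (ta * tb * t3 * dot (z - pin a) (z - pin a) * dot (z - pin b) (z - pin b)).
  have Dp x : z - pin x != 0 by rewrite -oppr_eq0 opprB; exact: (neq_of (@pin_in x) Oz.2).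
  by rewrite !mulr_gt0// dot_gt0.
rewrite /G cmul_square cmul_square -!conjp_cmul Ea Eb E3 /k /v3.
move: (z - pin a) (z - pin b) (pout a - c) (pout b - c) => [x1 x2] [y1 y2] [z1 z2] [w1 w2].
rewrite /cmul /conjp /dot /=; congr pair; ring.
Qed.

Lemma k_gt0 : 0 < dot k k.
Proof.
have E x : pout x - c != 0 by rewrite -oppr_eq0 opprB; exact: (neq_of Dc (@pout_out x)).
by apply: dot_gt0; apply: cmul_neq0; rewrite ?conjp_neq0.
Qed.

Variable z0 : R * R.
Hypotheses (Oz0 : Om z0) (naz0 : ~ bar a z0) (nbz0 : ~ bar b z0).

(** Normalized by the value at [z0]: off the bars the square of [hc z] is a positive real, so [hc z]
    is real and its sign compares the branch at [z] with the one at [z0]. *)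
Let hc z := cmul (G z) (conjp (G z0)).

Lemma branch_real z : Om z -> ~ bar a z -> ~ bar b z -> (hc z).2 = 0 /\ (hc z).1 != 0.
Proof.
move=> Oz na nb.
have [t t_gt0 Et] := branch_square Oz na nb.
have [t0 t0_gt0 Et0] := branch_square Oz0 naz0 nbz0.
apply: (@real_of_square_gt0 _ _ (t * t0 * dot k k)); first by rewrite !mulr_gt0// k_gt0.
rewrite /hc cmul_square -conjp_cmul Et Et0 /cmul /conjp /dot /=; congr pair; ring.
Qed.

Lemma continuous_branch_parts :
  [/\ forall x, continuous (v1 x), forall x, continuous (v2 x) & continuous (v3 a b)].
Proof.
by split=> [x|x|] z; apply: cvg_cmul; try apply: cvg_conjp; try apply: cvgB;
  first [exact: cvg_id|exact: cvg_cst].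
Qed.

Lemma continuous_hc : continuous hc.
Proof.
have [c1 c2 c3] := continuous_branch_parts.
move=> z; apply: cvg_cmul; last exact: cvg_cst.
have cH x : H x y @[y --> z] --> H x z.
  by apply: cvg_cmul; apply: cvg_sqrt_dir; [exact: c1|exact: c2].
apply: cvg_cmul; first exact: cH.
by apply: cvg_cmul; apply: cvg_conjp; [exact: cH|apply: cvg_sqrt_dir; exact: c3].
Qed.

(* Only the branch along the bar [b] is discontinuous at [g b], where it changes
   sign; all other factors are continuous and nonzero there. *)
Lemma crossing_sign : g a <> g b ->
    (\forall x \near b, x != b -> g x <> g a /\ g x <> g b) ->
  exists2 s, s != 0 & \forall x \near b, x != b -> 0 < s * (x - b) * (hc (g x)).1.
Proof.
move=> gab gne.
(* Everything in [hc] except the square root of [w], the one factor whose slit contains [g b]. *)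
pose M z := cmul (H a z) (cmul (conjp (sqrt_dir (v2 b z)))
  (cmul (conjp (sqrt_dir (v3 a b z))) (conjp (G z0)))).
pose w z := v1 b z.
have [c1 c2 c3] := continuous_branch_parts.
have hcE z : hc z = cmul (M z) (conjp (sqrt_dir (w z))).
  have Hb : H b z = cmul (sqrt_dir (w z)) (sqrt_dir (v2 b z)) by [].
  rewrite /hc /M; set G0 := G z0; rewrite /G Hb; move: (H a z) (sqrt_dir (v2 b z)) (sqrt_dir (v3 a b z)).
  move: (sqrt_dir (w z)) G0 => [p1 p2] [q1 q2] [r1 r2] [s1 s2] [t1 t2].
  by rewrite /cmul /conjp /=; congr pair; ring.
have cM : continuous M.
  move=> z; apply: cvg_cmul; first by apply: cvg_cmul; apply: cvg_sqrt_dir; [exact: c1|exact: c2].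
  apply: cvg_cmul; first by apply: cvg_conjp; apply: cvg_sqrt_dir; exact: c2.
  by apply: cvg_cmul; [apply: cvg_conjp; apply: cvg_sqrt_dir; exact: c3|exact: cvg_cst].
have cg : g x @[x --> b] --> g b.
  have [/derivable1_diffP d _] := an_derive A b.
  exact: (differentiable_continuous d).
have Mg : M (g x) @[x --> b] --> M (g b).
  by apply: (@cvg_comp _ _ _ g M _ (nbhs (g b))) => //; exact: cM.
have wg : w (g x) @[x --> b] --> w (g b).
  by apply: (@cvg_comp _ _ _ g w _ (nbhs (g b))) => //; exact: c1.
have [n0 nv _ _] := nrmP A b.
have [e0 _] := inner_lengthP b; have [L0 _ _] := bar_lengthP A b.
set e := inner_length b in e0; set L := bar_length b in L0.
(* At [g b] the ratio [w] is a negative real, since [g b] lies strictly between [pin b] and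
   [pout b]. *)
have w1b : (w (g b)).1 = - (e * L * dot (nn b) (nn b)).
  by rewrite /w /v1 /cmul /conjp /pin /pout /ray /dot -/e -/L /=; ring.
(* Displacement along the tangent up to a factor: the imaginary part of [w] changes sign at [b]. *)
pose phi x := (nn b).2 * ((g x).1 - (g b).1) - (nn b).1 * ((g x).2 - (g b).2).
have w2g x : (w (g x)).2 = (L + e) * phi x.
  by rewrite /w /v1 /cmul /conjp /pin /pout /ray /phi -/e -/L /=; ring.
have w2b : (w (g b)).2 = 0 by rewrite w2g /phi; ring.
have rho0 : 0 < e * L * dot (nn b) (nn b) by rewrite !mulr_gt0.
set rho := e * L * _ in w1b rho0.
have rb : cabs (w (g b)) = rho.
  apply: (@pexpIrn _ 2) => //; rewrite ?nnegrE ?cabs_ge0 ?ltW//.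
  by rewrite cabsE /dot w1b w2b; ring.
pose cr := (nn b).2 * (g' b).1 - (nn b).1 * (g' b).2.
have cr0 : cr != 0.
  apply/eqP => cr0; have : cr ^+ 2 + dot (nn b) (g' b) ^+ 2 = dot (nn b) (nn b) * dot (g' b) (g' b).
    by rewrite /cr /dot; ring.
  rewrite nv cr0 expr0n addr0 => /esym/eqP.
  by rewrite gt_eqF// mulr_gt0// dot_gt0// (an_neq0 A).
have phi_sign : \forall x \near b, x != b -> 0 < cr * (x - b) * phi x.
  have dphi : is_derive b 1 phi cr.
    have d1 := is_derive_fst (an_derive A b); have d2 := is_derive_snd (an_derive A b).
    have -> : phi = (nn b).2 \*: ((fun t => (g t).1) - cst (g b).1) -
                    (nn b).1 \*: ((fun t => (g t).2) - cst (g b).2).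
      by apply/funext => t; rewrite /phi !fctE /= /GRing.scale/=.
    by apply: is_derive_eq; rewrite /cr /GRing.scale/=; ring.
  have c2' : 0 < `|cr| / 2 by rewrite divr_gt0// normr_gt0.
  have := is_derive_nearP dphi c2'; apply: filterS => x.
  have -> : phi b = 0 by rewrite /phi; ring.
  rewrite subr0 => Hx xb.
  have xb0 : x - b != 0 by rewrite subr_eq0.
  have d0 : 0 < `|cr * (x - b)| by rewrite normr_gt0 mulf_neq0.
  have : `|cr * (x - b) * (phi x - cr * (x - b))| <= `|cr * (x - b)| * (`|cr * (x - b)| / 2).
    by rewrite normrM ler_wpM2l// (le_trans Hx)// normrM mulrAC.
  rewrite ler_norml => /andP[Hx' _].
  have sq : `|cr * (x - b)| * `|cr * (x - b)| = cr * (x - b) * (cr * (x - b)).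
    by rewrite -normrM ger0_norm// -expr2 sqr_ge0.
  have := mulr_gt0 d0 d0; rewrite sq.
  move: Hx'; rewrite mulrA sq; lra.
have good : \forall x \near b, x != b -> (hc (g x)).2 = 0 /\ (hc (g x)).1 != 0.
  move: gne; apply: filterS => x /[apply] -[nga ngb]; apply: branch_real.
  - exact: curve_annulus A x.
  - by move=> /(bar_disjoint A (bar_base A x)).
  - by move=> /(bar_disjoint A (bar_base A x)).
have m1 := @cvg_fstR _ _ _ _ _ _ Mg; have m2 := @cvg_sndR _ _ _ _ _ _ Mg.
have ww1 := @cvg_fstR _ _ _ _ _ _ wg; have ww2 := @cvg_sndR _ _ _ _ _ _ wg.
have rr : cabs (w (g x)) @[x --> b] --> rho by rewrite -rb; exact: cvg_cabs.
have rw : cabs (w (g x)) - (w (g x)).1 @[x --> b] --> rho - - rho.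
  by apply: cvgB => //; rewrite -w1b; exact: ww1.
(* For [x] near [b] the value of [hc] is real; dividing out the factor [w.2] and letting [x] tend to
   [b] forces this real part to vanish. *)
have m1b : (M (g b)).1 = 0.
  apply/eqP; apply: contrapT => /negP m10.
  have cD : (M (g x)).1 * (cabs (w (g x)) - (w (g x)).1) - (M (g x)).2 * (w (g x)).2
      @[x --> b] --> (M (g b)).1 * (rho - - rho) - (M (g b)).2 * (w (g b)).2.
    by apply: cvgB; apply: cvgM; [exact: m1|exact: rw|exact: m2|exact: ww2].
  have D0 : (M (g b)).1 * (rho - - rho) - (M (g b)).2 * (w (g b)).2 != 0.
    by rewrite w2b mulr0 subr0 mulf_neq0// opprK gt_eqF// addr_gt0.
  have /filter_ex : \forall x \near b^', False; last by case.
  near=> x.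
  have xb : x != b by near: x; exact: nbhs_dnbhs_neq.
  have : (M (g x)).1 * (cabs (w (g x)) - (w (g x)).1) - (M (g x)).2 * (w (g x)).2 != 0.
    near: x; apply: nbhs_dnbhs; exact: (cvgr_neq0 _ cD D0).
  apply/negP; rewrite negbK.
  have [h2 _] : (hc (g x)).2 = 0 /\ (hc (g x)).1 != 0.
    by move: xb; near: x; exact: nbhs_dnbhs.
  have w20 : (w (g x)).2 != 0.
    have : x != b -> 0 < cr * (x - b) * phi x by near: x; exact: nbhs_dnbhs.
    move=> /(_ xb); rewrite w2g => ph; apply/mulf_neq0; first by rewrite gt_eqF// addr_gt0.
    by apply: contraTneq ph => ->; rewrite mulr0 ltxx.
  rewrite -(mulrI_eq0 _ (mulfI w20)).
  by rewrite hcE in h2; apply/eqP; exact: imaginary_part_eq0 (cabsE _) h2.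
have m2b : (M (g b)).2 != 0.
  have Oz : Om (g b) := curve_annulus A b.
  have na : ~ bar a (g b) by move=> /(bar_disjoint A (bar_base A b)) E; apply: gab.
  have nz : M (g b) != 0.
    apply: cmul_neq0; first by apply: cmul_neq0; apply: sqrt_dir_neq0; [exact: slit_bar|exact: slit_ray Oz.1].
    apply: cmul_neq0; first by apply/conjp_neq0/sqrt_dir_neq0/slit_ray/Oz.1.
    apply: cmul_neq0; first by apply/conjp_neq0/sqrt_dir_neq0/slit_inner/Oz.2.
    apply/conjp_neq0; apply/eqP => G0.
    have [_] := branch_real Oz0 naz0 nbz0.
    by rewrite /hc G0 /cmul /= !mul0r subrr eqxx.
  by apply: contra nz => /eqP m20; apply/eqP; rewrite [LHS]surjective_pairing m1b m20.
(* The cofactor of [w.2] in the real part of [hc]; its limit [2 * rho * (M (g b)).2] is nonzero, so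
   [hc] inherits the sign change of [phi]. *)
pose kap z := (M z).1 * (w z).2 + (M z).2 * (cabs (w z) - (w z).1).
have ck : kap (g x) @[x --> b] --> (M (g b)).1 * (w (g b)).2 + (M (g b)).2 * (rho - - rho).
  by apply: cvgD; apply: cvgM; [exact: m1|exact: ww2|exact: m2|exact: rw].
set kb := _ + _ in ck.
have kb0 : kb != 0.
  by rewrite /kb w2b mulr0 add0r mulf_neq0// opprK gt_eqF// addr_gt0.
exists (cr * kb); first by rewrite mulf_neq0.
have rpos : \forall x \near b, 0 < cabs (w (g x)) - (w (g x)).1.
  by apply: (cvgr_gt _ rw); rewrite opprK addr_gt0.
have kpos : \forall x \near b, 0 < kb * kap (g x).
  have : kb * kap (g x) @[x --> b] --> kb * kb by apply: cvgMr.
  move/cvgr_gt; apply; by rewrite -expr2 exprn_even_gt0.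
near=> x => xb.
have r0 : 0 < cabs (w (g x)) - (w (g x)).1 by near: x.
have k0 : 0 < kb * kap (g x) by near: x.
have p0 : 0 < cr * (x - b) * phi x by move: xb; near: x.
rewrite -(pmulr_rgt0 _ r0).
rewrite hcE (real_part_factor cr kb (x - b) _ (cabsE (w (g x))) (w2g x)).
apply: mulr_gt0; last exact: k0.
by apply: mulr_gt0; [exact: addr_gt0|exact: p0].
Unshelve. all: by end_near.
Qed.

Lemma crossing_function : g a <> g b ->
    (\forall x \near b, x != b -> g x <> g a /\ g x <> g b) ->
  exists f : R * R -> R,
    [/\ continuous f, forall z, Om z -> ~ bar a z -> ~ bar b z -> f z != 0 &
        exists2 s, s != 0 & \forall x \near b, x != b -> 0 < s * (x - b) * f (g x)].
Proof.
move=> gab gne; exists (fun z => (hc z).1); split.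
- by move=> z; apply: cvg_fstR; exact: continuous_hc.
- by move=> z Oz na nb; have [] := branch_real Oz na nb.
- exact: crossing_sign.
Qed.

End two_bars.
End Separation.

(** * Sectors between bars *)

Section Sectors.
#[local] Opaque Defs.bar connected_component.
Context {R : realType}.
Implicit Types (p q z : R * R).
Variables (g g' : R -> R * R) (Din Dout : set (R * R)).
Hypothesis A : annular g g' Din Dout.
Local Notation Om := (annulus Din Dout).
Local Notation bar := (bar Om g).

Lemma int_lt1_eq0 (k : int) : -1 < (k%:~R : R) < 1 -> k = 0.
Proof.
move=> /andP[k1 k2].
have H1 : -1 < k by rewrite -(ltr_int R) mulrN1z.
have H2 : k < 1 by rewrite -(ltr_int R).
by lia.
Qed.

Lemma curve_periodic_int x (k : int) : g (x + k%:~R) = g x.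
Proof.
have nat_case y (n : nat) : g (y + n%:R) = g y.
  by elim: n => [|n IH]; rewrite ?addr0// -natr1 addrA (an_per A).
case: k => n; first exact: nat_case.
by rewrite NegzE mulrNz -[in RHS](subrK n.+1%:R x) nat_case.
Qed.

Lemma curve_neq x y : -1 < x - y < 1 -> x != y -> g x <> g y.
Proof.
move=> xy ne E; have [k kE] := an_inj A E.
have k0 : k = 0 by apply: int_lt1_eq0; rewrite kE in xy; lra.
by move: ne; rewrite kE k0 addr0 eqxx.
Qed.

Lemma representative a x : exists2 y, a <= y < a + 1 & g y = g x.
Proof.
exists (x + (- Num.floor (x - a))%:~R); last exact: curve_periodic_int.
have := floor_itv (x - a); rewrite intrD1 mulrNz.
by move=> /andP[H1 H2]; apply/andP; split; lra.
Qed.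

Lemma bar_eq_periodic x : bar (x + 1) = bar x.
Proof. by apply: (bar_eq A); rewrite (an_per A). Qed.

Lemma bar_curveP x y : -1 < x - y < 1 -> x != y -> ~ bar y (g x).
Proof. by move=> xy ne /(bar_disjoint A (bar_base A x)); exact: curve_neq. Qed.

(** The crossing function has no zeros on the arcs from [a] to [b] and from [b] to [a + 1], hence a
    constant sign on each; the change at [b] makes the two signs different, and the factor [- s]
    orients them. *)
Lemma separation a b : a < b < a + 1 -> exists h : R * R -> R,
  [/\ continuous h, forall z, Om z -> ~ bar a z -> ~ bar b z -> h z != 0,
      forall x, a < x < b -> 0 < h (g x) & forall x, b < x < a + 1 -> h (g x) < 0].
Proof.
move=> /andP[ab ba].
have [c Dc star] := an_star A.
pose x0 := (a + b) / 2.
have x0a : ~ bar a (g x0) by apply: bar_curveP; rewrite /x0; [lra|apply/eqP; lra].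
have x0b : ~ bar b (g x0) by apply: bar_curveP; rewrite /x0; [lra|apply/eqP; lra].
have near_ne : \forall x \near b, x != b -> g x <> g a /\ g x <> g b.
  near=> x => xb.
  have ax : a < x by near: x; exact: lt_nbhsr.
  have xa : x < a + 1 by near: x; exact: lt_nbhsl.
  by split; apply: curve_neq => //; [lra|apply/eqP; lra|lra].
have gab : g a <> g b by apply: curve_neq; [lra|apply/eqP; lra].
have Ox0 := curve_annulus A x0.
have [f [cf f0 [s s0 Hs]]] := crossing_function A Dc star Ox0 x0a x0b gab near_ne.
pose h z := - s * f z.
have cont : continuous h by move=> z; apply: cvgMr; exact: cf.
have h0 z : Om z -> ~ bar a z -> ~ bar b z -> h z != 0.
  by move=> Oz na nb; rewrite mulf_neq0 ?oppr_eq0// f0.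
have cg : continuous g.
  move=> x; have [/derivable1_diffP d _] := an_derive A x.
  exact: (differentiable_continuous d).
have chg : continuous (h \o g) by move=> x; apply: continuous_comp; [exact: cg|exact: cont].
have arc (y z x1 x2 : R) : (forall x, y < x < z -> ~ bar a (g x) /\ ~ bar b (g x)) ->
    y < x1 < z -> y < x2 < z -> 0 < h (g x1) * h (g x2).
  move=> H Hx1 Hx2; apply: (@connected_same_sign _ _ `]y, z[ (h \o g)).
  - exact/connected_intervalP/interval_is_interval.
  - exact: continuous_subspaceT.
  - move=> x; rewrite /= in_itv/= => /H[na nb]; apply: h0 => //.
    exact: (curve_annulus A).
  - by rewrite /= in_itv.
  - by rewrite /= in_itv.
have arc1 x : a < x < b -> ~ bar a (g x) /\ ~ bar b (g x).
  by move=> xx; split; apply: bar_curveP; solve [lra|apply/eqP; lra].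
have arc2 x : b < x < a + 1 -> ~ bar a (g x) /\ ~ bar b (g x).
  by move=> xx; split; apply: bar_curveP; solve [lra|apply/eqP; lra].
have sgn x : 0 < s * (x - b) * f (g x) -> h (g x) * (x - b) < 0.
  by rewrite /h; lra.
have [x1 x1b h1] : exists2 x, a < x < b & 0 < h (g x).
  have /filter_ex[x [ax xb Hx]] : \forall x \near b^'-, [/\ a < x, x < b &
      (x != b -> 0 < s * (x - b) * f (g x))].
    near=> x; split; near: x; [exact: nbhs_left_gt|exact: nbhs_left_lt|].
    by apply: filterS Hs => y + _.
  exists x; first by rewrite ax.
  have := sgn x (Hx _); rewrite lt_eqF// => /(_ isT).
  by rewrite nmulr_llt0// subr_lt0.
have [x2 x2b h2] : exists2 x, b < x < a + 1 & h (g x) < 0.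
  have /filter_ex[x [ax xb Hx]] : \forall x \near b^'+, [/\ b < x, x < a + 1 &
      (x != b -> 0 < s * (x - b) * f (g x))].
    near=> x; split; near: x; [exact: nbhs_right_gt|exact: nbhs_right_lt|].
    by apply: filterS Hs => y + _.
  exists x; first by rewrite ax.
  have := sgn x (Hx _); rewrite gt_eqF// => /(_ isT).
  by rewrite pmulr_llt0// subr_gt0.
exists h; split => //.
- by move=> x xx; have := arc _ _ _ _ arc1 x1b xx; rewrite pmulr_rgt0.
- by move=> x xx; have := arc _ _ _ _ arc2 x2b xx; rewrite nmulr_rgt0.
Unshelve. all: by end_near.
Qed.

Definition off_bars (X : set R) : set (R * R) := Om `\` \bigcup_(x in X) bar x.

Definition adjacent (X : set R) (a b : R) : set (R * R) :=
  \bigcup_(x in [set x | a < x < b]) connected_component (off_bars X) (g x).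

(** Only the two bounding bars are cut, which makes a sector independent of the other agents;
    [adjacent_eq_sector] shows that their bars make no difference. *)
Definition sector (a b : R) : set (R * R) := adjacent [set a; b] a b.

Lemma off_bars2 a b z : off_bars [set a; b] z <-> [/\ Om z, ~ bar a z & ~ bar b z].
Proof.
split=> [[Oz H]|[Oz na nb]].
  by split=> // xz; apply: H; [exists a => //; left|exists b => //; right].
split; first exact: Oz.
by case=> x [->|->]; [exact: na|exact: nb].
Qed.

Lemma adjacent_sub X a b : adjacent X a b `<=` off_bars X.
Proof. by move=> z [x _ /connected_component_sub]. Qed.

Lemma off_barsS X Y : (forall x, X x -> exists2 y, Y y & g y = g x) ->
  off_bars Y `<=` off_bars X.
Proof.
move=> XY z [Oz H]; split; first exact: Oz.
case=> x Xx xz; apply: H.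
have [y Yy E] := XY x Xx.
by exists y; [exact: Yy|rewrite (bar_eq A E); exact: xz].
Qed.

Lemma adjacentS X Y a b c d : (forall x, X x -> exists2 y, Y y & g y = g x) ->
  c <= a -> b <= d -> adjacent Y a b `<=` adjacent X c d.
Proof.
move=> XY ca bd z [x /= /andP[ax xb] xz]; exists x.
  by rewrite /= (le_lt_trans ca ax) (lt_le_trans xb bd).
exact: connected_componentS (off_barsS XY) _ xz.
Qed.

Lemma off_bars_closed3 a b c : exists2 C, closed C &
  forall q, Om q -> C q <-> exists2 x, [set a; b; c] x & bar x q.
Proof.
have [ca Ca] := bar_closed A a; have [cb Cb] := bar_closed A b.
have [cc Cc] := bar_closed A c.
exists ((ray g g' Din a @` `[0, bar_length g g' Din Dout a]) `|`
  (ray g g' Din b @` `[0, bar_length g g' Din Dout b]) `|`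
  (ray g g' Din c @` `[0, bar_length g g' Din Dout c])).
  by apply: closedU => //; apply: closedU.
move=> q Oq; split=> [[[]|]|[x [[->|->]|->]]].
- by move/(Ca q Oq) => ?; exists a => //; left; left.
- by move/(Cb q Oq) => ?; exists b => //; left; right.
- by move/(Cc q Oq) => ?; exists c => //; right.
- by move/(Ca q Oq) => ?; left; left.
- by move/(Cb q Oq) => ?; left; right.
- by move/(Cc q Oq) => ?; right.
Qed.

(** By [component_reaches_curve] every point off the bars is joined to a curve point, whose
    parameter can be taken in one period and so in one of three arcs. Equal parameters are allowed,
    which covers two bars as well. *)
Lemma adjacent_cover3 a b c z : a <= b -> b <= c -> c <= a + 1 ->
  off_bars [set a; b; c] z ->
  [\/ adjacent [set a; b; c] a b z, adjacent [set a; b; c] b c z |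
      adjacent [set a; b; c] c (a + 1) z].
Proof.
move=> ab bc ca [Oz nz].
have [C cC CX] := off_bars_closed3 a b c.
have nC : ~ C z by move=> /(CX z Oz)[x Xx xz]; apply: nz; exists x.
have [x nCx xz] := component_reaches_curve A cC CX Oz nC.
have [y /andP[ay ya] E] := representative a x.
have nbar t : [set a; b; c] t -> y != t.
  move=> Xt; apply/eqP => yt; apply: nCx; apply/(CX _ (curve_annulus A x)).
  by exists t => //; rewrite -E yt; exact: (bar_base A).
have ya' := nbar a (or_introl (or_introl erefl)).
have yb := nbar b (or_introl (or_intror erefl)).
have yc := nbar c (or_intror erefl).
rewrite -E in xz.
have ay' : a < y by rewrite lt_neqAle eq_sym ya'.
have [by_|yb'] := ltP b y; last first.
  by apply: Or31; exists y => //=; rewrite ay' lt_neqAle yb.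
have [cy|yc'] := ltP c y; last first.
  by apply: Or32; exists y => //=; rewrite by_ lt_neqAle yc.
by apply: Or33; exists y => //=; rewrite cy.
Qed.

(** The function [h] keeps its sign on each component, which gives the forward implications; the
    converses follow because the two sectors cover the complement of the bars. *)
Lemma sector_sign (a b : R) (h : R * R -> R) : a < b < a + 1 ->
  [/\ continuous h, forall z, Om z -> ~ bar a z -> ~ bar b z -> h z != 0,
      forall x, a < x < b -> 0 < h (g x) & forall x, b < x < a + 1 -> h (g x) < 0] ->
  (forall z, sector a b z <-> off_bars [set a; b] z /\ 0 < h z) /\
  (forall z, sector b (a + 1) z <-> off_bars [set a; b] z /\ h z < 0).
Proof.
move=> /andP[ab ba] [ch h0 hp hn].
have ob : off_bars [set b; a + 1] = off_bars [set a; b].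
  apply/seteqP; split=> z /off_bars2[Oz H1 H2]; apply/off_bars2; split.
  - exact: Oz.
  - by rewrite -bar_eq_periodic; exact: H2.
  - exact: H1.
  - exact: Oz.
  - exact: H2.
  - by rewrite bar_eq_periodic; exact: H1.
have sign (x : R) z : ~ bar a (g x) -> ~ bar b (g x) ->
    connected_component (off_bars [set a; b]) (g x) z -> 0 < h (g x) * h z.
  move=> na nb xz.
  apply: (@connected_same_sign _ _ (connected_component (off_bars [set a; b]) (g x)) h) => //.
  - exact: component_connected.
  - exact: continuous_subspaceT.
  - by move=> c /connected_component_sub/off_bars2[]; exact: h0.
  - apply: connected_component_refl; apply/off_bars2; split.
    + exact: (curve_annulus A).
    + exact: na.
    + exact: nb.
have s1 z : sector a b z -> 0 < h z.
  case=> x /= xab /sign; rewrite pmulr_rgt0 ?hp//; apply.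
    by apply: bar_curveP; [lra|apply/eqP; lra].
  by apply: bar_curveP; [lra|apply/eqP; lra].
have s2 z : sector b (a + 1) z -> h z < 0.
  rewrite /sector /adjacent ob; case=> x /= xab /sign; rewrite nmulr_rgt0 ?hn//; apply.
    by apply: bar_curveP; [lra|apply/eqP; lra].
  by apply: bar_curveP; [lra|apply/eqP; lra].
have cov z : off_bars [set a; b] z -> sector a b z \/ sector b (a + 1) z.
  have E : [set a; b; b] = [set a; b].
    by apply/seteqP; split=> x [[]|]; [left|right|right|left; left|right].
  move=> Hz; have := @adjacent_cover3 a b b z (ltW ab) (lexx _) (ltW ba).
  rewrite E => /(_ Hz)[H|[x /= /andP[H1 H2] _]|H].
  - by left.
  - by have := lt_trans H1 H2; rewrite ltxx.
  - by right; rewrite /sector /adjacent ob.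
split=> z; split.
- by move=> Sz; split; [exact: adjacent_sub Sz|exact: s1].
- by case=> /cov[//|/s2 H1 H2]; have := lt_trans H1 H2; rewrite ltxx.
- by move=> Sz; split; [rewrite -ob; exact: adjacent_sub Sz|exact: s2].
- by case=> /cov[/s1 H1 H2|//]; have := lt_trans H1 H2; rewrite ltxx.
Qed.

Lemma sector_disjoint a b z : a < b < a + 1 -> sector a b z -> ~ sector b (a + 1) z.
Proof.
move=> ab; have [h Hh] := separation ab; have [S1 S2] := sector_sign ab Hh.
by move=> /S1[_ H1] /S2[_ H2]; have := lt_trans H1 H2; rewrite ltxx.
Qed.

Lemma sector_cover a b z : a < b < a + 1 -> off_bars [set a; b] z ->
  sector a b z \/ sector b (a + 1) z.
Proof.
move=> ab; have [h Hh] := separation ab; have [S1 S2] := sector_sign ab Hh.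
move=> Wz; have [Oz na nb] := (off_bars2 _ _ _).1 Wz.
have : h z != 0 by case: Hh => _ h0 _ _; exact: h0.
by rewrite neq_lt => /orP[H|H]; [right; apply/S2|left; apply/S1].
Qed.

Lemma sector_full a : sector a (a + 1) = off_bars [set a; a + 1].
Proof.
apply/seteqP; split; first exact: adjacent_sub.
have E : [set a; a + 1; a + 1] = [set a; a + 1].
  by apply/seteqP; split=> x [[]|]; [left|right|right|left; left|right].
have a1 : a <= a + 1 by rewrite lerDl.
move=> z; have := @adjacent_cover3 a (a + 1) (a + 1) z a1 (lexx _) (lexx _).
rewrite E => H /H[//|[x /= /andP[H1 H2] _]|[x /= /andP[H1 H2] _]];
  by have := lt_trans H1 H2; rewrite ltxx.
Qed.

(** A bar based strictly outside the arc is connected and avoids the bars of [a] and [b], so it lies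
    with its base point in the complementary sector. *)
Lemma sector_avoids a b y z : a < b <= a + 1 -> b <= y <= a + 1 -> sector a b z -> ~ bar y z.
Proof.
move=> /andP[ab ba] /andP[yb ya] Sz.
have [Oz na nb] := (off_bars2 _ _ _).1 (adjacent_sub Sz).
have [->//|byne] := eqVneq y b.
have [->|yane] := eqVneq y (a + 1); first by rewrite bar_eq_periodic.
have by_ : b < y by rewrite lt_neqAle eq_sym byne.
have ya' : y < a + 1 by rewrite lt_neqAle yane.
have abb : a < b < a + 1 by rewrite ab (lt_trans by_ ya').
move=> yz; apply: (sector_disjoint abb Sz); exists y; first by rewrite /= by_.
exists (bar y); last exact: yz.
split; [exact: (bar_base A)| |exact: bar_connected].
move=> q yq; apply/off_bars2; split; first exact: bar_sub yq.
  by move=> /(bar_disjoint A yq); apply: curve_neq; [lra|apply/eqP; lra].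
by rewrite bar_eq_periodic => /(bar_disjoint A yq); apply: curve_neq; [lra|apply/eqP; lra].
Qed.

(** Further bars do not meet the sector, so each component forming it stays connected when they are
    cut as well. *)
Lemma adjacent_eq_sector a b (Y : set R) : a < b <= a + 1 ->
  (forall y, Y y -> exists2 y', b <= y' <= a + 1 & g y' = g y) ->
  (exists2 y, Y y & g y = g a) -> (exists2 y, Y y & g y = g b) ->
  adjacent Y a b = sector a b.
Proof.
move=> ab HY Ya Yb.
have XY x : [set a; b] x -> exists2 y, Y y & g y = g x by case=> ->.
apply/seteqP; split; first exact: adjacentS.
move=> z [x xab xz]; exists x => //.
exists (connected_component (off_bars [set a; b]) (g x)) => //; split.
- apply: connected_component_refl; have /andP[xa xb] := xab.
  have /andP[_ b1] := ab.
  apply/off_bars2; split; first exact: (curve_annulus A).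
    by apply: bar_curveP; [lra|apply/eqP; lra].
  by apply: bar_curveP; [lra|apply/eqP; lra].
- move=> q xq; have Sq : sector a b q by exists x.
  have [Oq _ _] := (off_bars2 _ _ _).1 (adjacent_sub Sq).
  split; first exact: Oq.
  case=> y /HY[y' Hy' E] yq.
  by apply: (sector_avoids ab Hy' Sq); rewrite (bar_eq A E); exact: yq.
- exact: component_connected.
Qed.

Lemma sector_split a b c : a < b -> b < c -> c < a + 1 ->
  [/\ sector a b `<=` sector a c, sector b c `<=` sector a c,
      forall z, sector a b z -> ~ sector b c z &
      forall z, sector a c z -> [\/ sector a b z, sector b c z | bar b z]].
Proof.
move=> ab bc ca; pose Y := [set a; b; c].
have Ya : Y a by left; left.
have Yb : Y b by left; right.
have Yc : Y c by right.
have P1 y : g (y + 1) = g y by exact: (an_per A).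
have E1 : adjacent Y a b = sector a b.
  apply: adjacent_eq_sector; [lra| |by exists a|by exists b].
  by move=> y [[->|->]|->]; [exists (a + 1); [lra|]|exists b; [lra|]|exists c; [lra|]].
have E2 : adjacent Y b c = sector b c.
  apply: adjacent_eq_sector; [lra| |by exists b|by exists c].
  by move=> y [[->|->]|->]; [exists (a + 1); [lra|]|exists (b + 1); [lra|]|exists c; [lra|]].
have E3 : adjacent Y c (a + 1) = sector c (a + 1).
  apply: adjacent_eq_sector; [lra| |by exists c|by exists a; rewrite ?P1].
  by move=> y [[->|->]|->]; [exists (a + 1); [lra|]|exists (b + 1); [lra|]|exists (c + 1); [lra|]].
have acY x : [set a; c] x -> exists2 y, Y y & g y = g x by case=> ->; [exists a|exists c].
split.
- by rewrite -E1; apply: adjacentS => //; exact: ltW.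
- by rewrite -E2; apply: adjacentS => //; exact: ltW.
- move=> z Sz Sz'; apply: (@sector_disjoint a b z) => //; first lra.
  move: Sz'; rewrite -E2; apply: adjacentS => //; last exact: ltW.
  by move=> x [->|->]; [exists b|exists a; rewrite ?P1].
- move=> z Sz; have [bz|nbz] := pselect (bar b z); first exact: Or33.
  have [Oz na nc] := (off_bars2 _ _ _).1 (adjacent_sub Sz).
  have : off_bars Y z.
    by split; [exact: Oz|case=> x [[->|->]|->]; [exact: na|exact: nbz|exact: nc]].
  move/(adjacent_cover3 (ltW ab) (ltW bc) (ltW ca)); rewrite -/Y E1 E2 E3.
  case=> [?|?|Sz']; [exact: Or31|exact: Or32|].
  by exfalso; apply: (@sector_disjoint a c z) => //; lra.
Qed.

End Sectors.

(** * The cumulative workload *)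

Section PlanarMeasure.
Context {R : realType}.
Implicit Types (p q z : R * R) (U : set (R * R)).
Local Notation mu2 := (@lebesgue_measure R \x @lebesgue_measure R)%E.

Lemma open_measurable2 U : open U -> measurable U.
Proof.
move=> oU.
pose box (a b r : rat) : set (R * R) :=
  `](ratr a - ratr r), (ratr a + ratr r)[ `*` `](ratr b - ratr r), (ratr b + ratr r)[.
have -> : U = \bigcup_(a in [set: rat]) \bigcup_(b in [set: rat]) \bigcup_(r in [set: rat])
    (if pselect (box a b r `<=` U) then box a b r else set0).
  apply/seteqP; split=> [p Up|p [a _ [b _ [r _]]]]; last by case: pselect => // H /H.
  have /nbhs_ballP[e /= e0 eU] : nbhs p U by exact: open_nbhs_nbhs.
  have [r] := @rat_in_itvoo R 0 (e / 2) (divr_gt0 e0 (ltr0n _ 2)).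
  rewrite in_itv/= => /andP[r0 re].
  have [a] := @rat_in_itvoo R (p.1 - ratr r) (p.1 + ratr r) ltac:(lra).
  have [b] := @rat_in_itvoo R (p.2 - ratr r) (p.2 + ratr r) ltac:(lra).
  rewrite !in_itv/= => /andP[b1 b2] /andP[a1 a2].
  exists a => //; exists b => //; exists r => //.
  case: pselect => [H|[]].
    by split; rewrite /= in_itv/=; apply/andP; split; lra.
  move=> q [/=]; rewrite !in_itv/= => /andP[q1 q2] /andP[q3 q4].
  by apply: eU; split; rewrite /ball/= ltr_norml; apply/andP; split; lra.
apply: bigcupT_measurable_rat => a; apply: bigcupT_measurable_rat => b.
apply: bigcupT_measurable_rat => r.
case: (pselect (box a b r `<=` U)) => H /=; last exact: measurable0.
by apply: measurableX; exact: measurable_itv.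
Qed.

Lemma closed_measurable2 U : closed U -> measurable U.
Proof.
by move=> cU; rewrite -[U]setCK; apply: measurableC; apply: open_measurable2; exact: closed_openC.
Qed.

(** A vertical line is a product with a null factor; every other line has single points as vertical
    sections. *)
Lemma line_measure0 p v : v != 0 -> mu2 [set q | dot (q - p) v = 0] = 0%E.
Proof.
move=> v0.
have [v2|v2] := eqVneq v.2 0.
  have v1 : v.1 != 0.
    by apply: contra v0 => /eqP v1; apply/eqP; rewrite [LHS]surjective_pairing v1 v2.
  have -> : [set q | dot (q - p) v = 0] = [set p.1] `*` setT.
    apply/seteqP; split=> q /=; rewrite /dot v2 mulr0 addr0.
      by move/eqP; rewrite mulf_eq0 (negbTE v1) orbF subr_eq0 => /eqP.
    by move=> [q1 _]; rewrite /= q1 subrr mul0r.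
  by rewrite product_measure1E//= lebesgue_measure_set1 mul0e.
rewrite /product_measure1; apply: integral0_eq => x _ /=.
have -> : xsection [set q | dot (q - p) v = 0] x = [set p.2 - (x - p.1) * v.1 / v.2].
  apply/seteqP; split=> y; rewrite /xsection/= ?inE /dot/=.
    by move=> H; apply: (mulIf v2); rewrite mulrBl divfK//; lra.
  by move=> ->; rewrite ?inE /=; field.
exact: lebesgue_measure_set1.
Qed.

End PlanarMeasure.

Section Cumulative.
Context {R : realType}.
Implicit Types (p q z : R * R).
#[local] Opaque Defs.bar connected_component.
Variables (g g' : R -> R * R) (Din Dout : set (R * R)).
Hypothesis A : annular g g' Din Dout.
Local Notation Om := (annulus Din Dout).
Local Notation bar := (bar Om g).
Local Notation sector := (sector g Din Dout).
Local Notation off_bars := (off_bars g Din Dout).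
Local Notation mu2 := (@lebesgue_measure R \x @lebesgue_measure R)%E.
Variables (rho : R * R -> R) (C : R).
Hypothesis rho_meas : measurable_fun Om rho.
Hypothesis rho_pos : forall q, Om q -> 0 < rho q.
Hypothesis rho_le : forall q, Om q -> rho q <= C.

Lemma annulus_measurable : measurable Om.
Proof.
by apply: measurableD; apply: open_measurable2; [exact: (an_openO A)|exact: (an_openD A)].
Qed.

Lemma bar_measurable x : measurable (bar x).
Proof.
have [cx Cx] := bar_closed A x.
rewrite (_ : bar x = Om `&` (ray g g' Din x @` `[0, bar_length g g' Din Dout x])).
  by apply: measurableI; [exact: annulus_measurable|exact: closed_measurable2].
apply/seteqP; split=> q.
  by move=> xq; have Oq := bar_sub xq; split; [exact: Oq|apply/(Cx q Oq)].
by case=> Oq /(Cx q Oq).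
Qed.

Lemma bar_null x : mu2 (bar x) = 0%E.
Proof.
apply/eqP; rewrite eq_le measure_ge0 andbT -(line_measure0 (g x) (an_neq0 A x)).
apply: le_measure; rewrite ?inE.
- exact: bar_measurable.
- have -> : [set q | dot (q - g x) (g' x) = 0] = (fun q => dot (q - g x) (g' x)) @^-1` [set 0] by [].
  apply: closed_measurable2; apply: closed_comp; last exact: closed_eq.
  move=> q _; apply: cvg_dot; last exact: cvg_cst.
  by apply: cvgB; [exact: cvg_id|exact: cvg_cst].
- by move=> q /(barE A)[F _]; exact: (Foot_orthogonal A F).
Qed.

Lemma annulus_integrable : mu2.-integrable Om (EFin \o rho).
Proof.
apply: measurable_bounded_integrable => //; first exact: annulus_measurable.
  have [r rD] := an_bounded A.
  have sub : Om `<=` `[- r, r] `*` `[- r, r].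
    by move=> q [/rD[H1 H2] _]; split; rewrite /= in_itv.
  apply: (@le_lt_trans _ _ (mu2 (`[- r, r] `*` `[- r, r]))).
    by apply: le_measure; rewrite ?inE//; [exact: annulus_measurable|exact: measurableX].
  rewrite product_measure1E//= lebesgue_measure_itv/=.
  by case: ifP => _; rewrite ?mul0e ?ltry// -EFinB -EFinM ltry.
exists C; split; first exact: num_real.
move=> M CM q Oq /=; rewrite ger0_norm ?ltW ?rho_pos//.
exact: le_lt_trans (rho_le Oq) CM.
Qed.

Lemma mass_split (S S1 S2 : set (R * R)) x :
  measurable S -> measurable S1 -> measurable S2 -> S `<=` Om ->
  S1 `<=` S -> S2 `<=` S -> (forall z, S1 z -> ~ S2 z) ->
  (forall z, S z -> [\/ S1 z, S2 z | bar x z]) ->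
  \int[mu2]_(q in S) rho q = \int[mu2]_(q in S1) rho q + \int[mu2]_(q in S2) rho q.
Proof.
move=> mS m1 m2 SO S1S S2S dis cov.
have intS B : measurable B -> B `<=` S -> mu2.-integrable B (EFin \o rho).
  move=> mB BS; apply: integrableS annulus_integrable => //.
    exact: annulus_measurable.
  exact: subset_trans SO.
have m12 : measurable (S1 `|` S2) by exact: measurableU.
pose Nl := S `\` (S1 `|` S2).
have mN : measurable Nl by exact: measurableD.
have SE : S = (S1 `|` S2) `|` Nl.
  by rewrite /Nl setDE setUIr setUCr setIT setUidr// => z [/S1S|/S2S].
have N0 : mu2 Nl = 0%E.
  apply/eqP; rewrite eq_le measure_ge0 andbT -(bar_null x).
  apply: le_measure; rewrite ?inE; [exact: mN|exact: bar_measurable|].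
  by move=> z [/cov[H|H|//] H2]; exfalso; apply: H2; [left|right].
have iN : \int[mu2]_(q in Nl) rho q = 0.
  rewrite /Rintegral null_set_integral//.
  have := intS Nl mN (@subDsetl _ _ _) => /integrableP[]; exact.
rewrite {1}SE Rintegral_setU//.
- rewrite iN addr0 Rintegral_setU//.
  + by apply: intS => // z [/S1S|/S2S].
  + by apply/disj_setPS => z [/dis].
- by rewrite -SE; apply: intS.
- by rewrite /Nl; apply/disj_setPS => z [H1 [_ H2]]; apply: H2.
Qed.

Definition sector_mass a b : R := \int[mu2]_(q in sector a b) rho q.

Lemma sector_sub a b : sector a b `<=` Om.
Proof. by move=> z /adjacent_sub[]. Qed.

Lemma off_bars_measurable a b : measurable (off_bars [set a; b]).
Proof.
rewrite (_ : off_bars _ = (Om `\` bar a) `\` bar b).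
  by apply: measurableD; [apply: measurableD; [exact: annulus_measurable|]|]; exact: bar_measurable.
apply/seteqP; split=> z; first by move=> /off_bars2[? ? ?]; split=> //; split.
by case=> [[? ?] ?]; apply/off_bars2; split.
Qed.

Lemma sector_measurable a b : a <= b <= a + 1 -> measurable (sector a b).
Proof.
move=> /andP[]; rewrite le_eqVlt => /orP[/eqP->|ab].
  move=> _; rewrite (_ : sector b b = set0)//.
  by apply/seteqP; split=> z // [x /= /andP[H1 H2]]; have := lt_trans H1 H2; rewrite ltxx.
rewrite le_eqVlt => /orP[/eqP->|ba].
  by rewrite (sector_full A); exact: off_bars_measurable.
have abb : a < b < a + 1 by rewrite ab.
have [h Hh] := separation A abb; have [S1 _] := sector_sign A abb Hh.
rewrite (_ : sector a b = off_bars [set a; b] `&` (h @^-1` [set y | 0 < y])).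
  apply: measurableI; first exact: off_bars_measurable.
  apply: open_measurable2; apply: open_comp; last exact: open_gt.
  by move=> z _; case: Hh => ch _ _ _; exact: ch.
by apply/seteqP; split=> z /S1.
Qed.

Lemma sector_mass0 a : sector_mass a a = 0.
Proof.
rewrite /sector_mass (_ : sector a a = set0) ?Rintegral_set0//.
by apply/seteqP; split=> z // [x /= /andP[H1 H2]]; have := lt_trans H1 H2; rewrite ltxx.
Qed.

Lemma sector_mass_ge0 a b : 0 <= sector_mass a b.
Proof. by apply: Rintegral_ge0 => z /sector_sub/rho_pos/ltW. Qed.

Lemma sector_massD a b c : a <= b -> b <= c -> c <= a + 1 ->
  sector_mass a c = sector_mass a b + sector_mass b c.
Proof.
rewrite le_eqVlt => /orP[/eqP->|ab]; first by rewrite sector_mass0 add0r.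
rewrite le_eqVlt => /orP[/eqP->|bc]; first by rewrite sector_mass0 addr0.
move=> ca.
have mS : measurable (sector a c) by apply: sector_measurable; lra.
have m1 : measurable (sector a b) by apply: sector_measurable; lra.
have m2 : measurable (sector b c) by apply: sector_measurable; lra.
move: ca; rewrite le_eqVlt => /orP[/eqP ca|ca]; last first.
  have [H1 H2 H3 H4] := sector_split A ab bc ca.
  exact: (mass_split mS m1 m2 (@sector_sub a c) H1 H2 H3 H4).
(* A full turn needs its own argument: the bar at [a + 1] is the bar at [a], and the sector is the
   annulus cut along this single bar. *)
have abb : a < b < a + 1 by rewrite ab -ca.
rewrite ca in mS m2 bc *.
have fullE z : sector a (a + 1) z <-> Om z /\ ~ bar a z.
  rewrite (sector_full A); split=> [/off_bars2[Oz na _]|[Oz na]]; first exact: conj Oz na.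
  by apply/off_bars2; split; [exact: Oz|exact: na|rewrite (bar_eq_periodic A); exact: na].
apply: (@mass_split _ _ _ b mS m1 m2 (@sector_sub a (a + 1))).
- by move=> z /adjacent_sub/off_bars2[Oz na _]; apply/fullE; exact: conj Oz na.
- move=> z /adjacent_sub/off_bars2[Oz _]; rewrite (bar_eq_periodic A) => na.
  by apply/fullE; exact: conj Oz na.
- by move=> z; exact: (sector_disjoint A).
- move=> z /fullE[Oz na]; have [bz|nb] := pselect (bar b z); first exact: Or33.
  have : off_bars [set a; b] z by apply/off_bars2; split; [exact: Oz|exact: na|exact: nb].
  by case/(sector_cover A abb) => ?; [exact: Or31|exact: Or32].
Qed.

Definition total_mass : R := \int[mu2]_(q in Om) rho q.

Lemma sector_mass_full a : sector_mass a (a + 1) = total_mass.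
Proof.
have mS : measurable (sector a (a + 1)) by apply: sector_measurable; lra.
have mO := annulus_measurable.
have m0 : measurable (set0 : set (R * R)) by exact: measurable0.
have dis z : sector a (a + 1) z -> ~ set0 z by move=> _ [].
have cov z : Om z -> [\/ sector a (a + 1) z, set0 z | bar a z].
  move=> Oz; have [az|na] := pselect (bar a z); first exact: Or33.
  apply: Or31; rewrite (sector_full A); apply/off_bars2.
  by split; [exact: Oz|exact: na|rewrite (bar_eq_periodic A); exact: na].
rewrite /total_mass (mass_split mO mS m0 (@subset_refl _ _) (@sector_sub a (a + 1))
  (@sub0set _ _) dis cov).
by rewrite Rintegral_set0 addr0.
Qed.

(** Sector masses add up only within one turn, so whole turns are counted by the floor and the
    remainder by a sector. *)
Definition cumulative x : R :=
  total_mass * (Num.floor x)%:~R + sector_mass (Num.floor x)%:~R x.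

Lemma floor_bounds (x : R) : (Num.floor x)%:~R <= x < (Num.floor x)%:~R + 1.
Proof. by have := floor_itv x; rewrite intrD1. Qed.

Lemma total_mass_ge0 : 0 <= total_mass.
Proof. by rewrite -(sector_mass_full 0) sector_mass_ge0. Qed.

Lemma cumulativeB a b : a <= b <= a + 1 -> sector_mass a b = cumulative b - cumulative a.
Proof.
move=> /andP[ab ba]; rewrite /cumulative.
have := floor_bounds a; have := floor_bounds b.
set k := Num.floor a; set l := Num.floor b => /andP[lb bl] /andP[ka ak].
have kl : k <= l by exact: le_floor.
have lk : l <= k + 1.
  suff : l < k + 2 by lia.
  by rewrite -(ltr_int R) intrD; lra.
have : l = k \/ l = k + 1 by lia.
case=> E.
  have := @sector_massD k%:~R a b ka ab; rewrite E => ->; last by rewrite E in bl; lra.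
  by ring.
have lE : l%:~R = k%:~R + 1 :> R by rewrite E intrD1.
have H1 : sector_mass a b = sector_mass a l%:~R + sector_mass l%:~R b.
  by apply: sector_massD; lra.
have H2 : total_mass = sector_mass k%:~R a + sector_mass a l%:~R.
  by rewrite -(sector_mass_full k%:~R) -lE; apply: sector_massD; lra.
rewrite H1 lE mulrDr; have : total_mass * 1 = total_mass by rewrite mulr1.
by rewrite -lE; lra.
Qed.

Lemma cumulative_period x : cumulative (x + 1) = cumulative x + total_mass.
Proof.
have : sector_mass x (x + 1) = cumulative (x + 1) - cumulative x by apply: cumulativeB; lra.
by rewrite sector_mass_full; lra.
Qed.

Lemma cumulative_homo : {homo cumulative : x y / x <= y}.
Proof.
have step x y : x <= y <= x + 1 -> cumulative x <= cumulative y.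
  by move=> /cumulativeB E; rewrite -subr_ge0 -E sector_mass_ge0.
have nstep x (n : nat) : cumulative x <= cumulative (x + n%:R).
  elim: n => [|n IH]; first by rewrite addr0.
  by apply: le_trans IH _; rewrite -natr1 addrA cumulative_period lerDl total_mass_ge0.
move=> x y xy; have := floor_bounds (y - x).
have : 0 <= Num.floor (y - x) by rewrite floor_ge0 subr_ge0.
case: (Num.floor _) => // n _ nE.
by apply: le_trans (nstep x n) _; apply: step; move: nE; rewrite -pmulrn; lra.
Qed.

Lemma next_base_le (N : nat) (u : 'I_N -> R) i : weakly_ordered u ->
  next_base u i <= u i + 1.
Proof.
case: N u i => [|n] u i; first by case: i.
move=> uo; have [mono wrap] := weakly_ordered_le uo.
rewrite /next_base; case: ifP => // /eqP iE.
by rewrite lerD2r mono//= iE modnn.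
Qed.

Lemma weakly_ordered_representative (N : nat) (u : 'I_N -> R) i j : weakly_ordered u ->
  exists2 y, next_base u i <= y <= u i + 1 & g y = g (u j).
Proof.
case: N u i j => [|n] u i j; first by case: i.
move=> uo; have [mono wrap] := weakly_ordered_le uo.
have [ij|ji] := ltnP i j.
  exists (u j) => //; rewrite wrap andbT /next_base.
  have il : (i.+1 < n.+1)%N by exact: leq_ltn_trans ij (ltn_ord j).
  by rewrite ltn_eqF// mono//= modn_small.
exists (u j + 1); last exact: (an_per A).
rewrite lerD2r mono// andbT /next_base; case: ifP => [/eqP iE|_]; last exact: wrap.
by rewrite lerD2r mono//= iE modnn.
Qed.

Lemma workloadE (N : nat) (u : 'I_N -> R) i : weakly_ordered u ->
  workload Om rho g u i = cumulative (next_base u i) - cumulative (u i).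
Proof.
move=> uo; have unext := uo i; have nextu := next_base_le i uo.
rewrite -cumulativeB ?unext ?nextu// /sector_mass.
have subE : subregion Om g u i = adjacent g Din Dout (range u) (u i) (next_base u i).
  by rewrite /subregion /adjacent /off_bars bigcup_image.
rewrite /workload subE.
move: unext; rewrite le_eqVlt => /orP[/eqP E|lt].
  by rewrite -E; congr Rintegral; apply/seteqP; split=> z [x /= /andP[H1 H2]];
    have := lt_trans H1 H2; rewrite ltxx.
congr Rintegral; apply: (adjacent_eq_sector A); first by rewrite lt nextu.
- by move=> _ [j _ <-]; exact: weakly_ordered_representative.
- by exists (u i) => //; exists i.
- exists (u (ordS i)); first by exists (ordS i).
  by rewrite /next_base; case: ifP => _ //; rewrite (an_per A).
Qed.

End Cumulative.

(** * Motion of the base points *)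

Section Motion.
Context {R : realType}.
#[local] Opaque Defs.bar connected_component.

Lemma is_derive_local_factor (f k : R -> R) (t : R) :
  (\forall r \near t, f r - f t = k r * (r - t)) -> k r @[r --> t] --> k t ->
  is_derive t 1 f (k t).
Proof.
move=> fk kt; apply: is_derive_near => e e0.
have ke : \forall r \near t, `|k t - k r| < e by move/cvgrPdist_lt : kt; exact.
near=> r; have -> : f r - f t = k r * (r - t) by near: r.
by rewrite -mulrBl normrM ler_wpM2r// distrC ltW//; near: r.
Unshelve. all: by end_near.
Qed.

(** Differentiability is given for [s], not for [u]. The projection of [g] onto its tangent has
    nonzero slope at [u t], so it can be inverted to first order there. *)
Lemma arc_length_derive (g g' s : R -> R * R) (P u : R -> R) (t d e : R) :
  is_derive (u t) 1 g (g' (u t)) -> g' (u t) != 0 ->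
  is_derive (u t) 1 P (Num.sqrt (dot (g' (u t)) (g' (u t)))) ->
  u r @[r --> t] --> u t ->
  (\forall r \near t, s r = g (u r)) ->
  is_derive t 1 s (d *: (e *: ((Num.sqrt (dot (g' (u t)) (g' (u t))))^-1 *: g' (u t)))) ->
  is_derive t 1 (fun r => P (u r)) (d * e).
Proof.
set a := u t; set v := Num.sqrt _ => dg v0 dP cu su ds.
have vv : v ^+ 2 = dot (g' a) (g' a) by rewrite sqr_sqrtr// dot_ge0.
have vpos : 0 < v by rewrite sqrtr_gt0 dot_gt0.
pose proj (f : R -> R * R) r := dot (f r) (g' a).
have dproj (f : R -> R * R) (x : R) w : is_derive x 1 f w -> is_derive x 1 (proj f) (dot w (g' a)).
  move=> df; have d1 := is_derive_fst df; have d2 := is_derive_snd df.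
  have -> : proj f = (g' a).1 \*: (fun r => (f r).1) + (g' a).2 \*: (fun r => (f r).2).
    by apply/funext => r; rewrite /proj /dot !fctE /= /GRing.scale/=; ring.
  by apply: is_derive_eq; rewrite /dot /GRing.scale/=; ring.
have /is_derive1_caratheodory[psi [psiE psic psia]] := dproj _ _ _ dg.
have /is_derive1_caratheodory[pi [piE pic pia]] := dP.
have /is_derive1_caratheodory[chi [chiE chic chit]] := dproj _ _ _ ds.
have chiv : chi t = d * e * v.
  rewrite chit.
  transitivity (d * (e * (v^-1 * (g' a).1)) * (g' a).1 + d * (e * (v^-1 * (g' a).2)) * (g' a).2) => //.
  transitivity (d * e * v^-1 * dot (g' a) (g' a)); first by rewrite /dot; ring.
  by rewrite -vv; field; rewrite gt_eqF.
have psiu : psi (u r) @[r --> t] --> psi a.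
  by apply: (@cvg_comp _ _ _ u psi _ (nbhs a)) => //; exact: psic.
have piu : pi (u r) @[r --> t] --> pi a.
  by apply: (@cvg_comp _ _ _ u pi _ (nbhs a)) => //; exact: pic.
have psi0 : psi a != 0 by rewrite psia gt_eqF// dot_gt0.
(* Slope of [P] times slope of [s] divided by slope of [g], each a Caratheodory factor continuous at
   the relevant point. *)
pose k r := pi (u r) * (chi r / psi (u r)).
have kt : k t = d * e.
  by rewrite /k -/a psia pia chiv -vv; field; rewrite gt_eqF.
rewrite -kt; apply: is_derive_local_factor; last first.
  by apply: cvgM => //; apply: cvgM => //; exact: cvgV.
have st : s t = g a by apply: (nbhs_singleton su).
near=> r.
have sr : s r = g (u r) by near: r.
have pr : psi (u r) != 0 by near: r; exact: (cvgr_neq0 _ psiu psi0).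
have E : psi (u r) * (u r - a) = chi r * (r - t).
  by rewrite -psiE -chiE /proj sr st.
rewrite piE /k -mulrA; congr (_ * _).
by apply: (mulfI pr); rewrite E; field.
Unshelve. all: by end_near.
Qed.

Lemma annular_of (gin gout : R -> R * R) (Din Dout : set (R * R)) :
  smooth_simple_closed gin -> encloses gin Din -> encloses gout Dout ->
  convex_set Din -> star_shaped Dout -> closure Din `<=` Dout ->
  annular gin (derive1 gin) Din Dout.
Proof.
move=> [per inj sm reg] [oD cD bD D0 bdD] [oO cO bO O0 bdO] convD [c Dc star] sub.
split.
- by move=> x; rewrite derive1E; apply: derivableP; exact: (sm 0 x).
- exact: reg.
- exact: per.
- exact: inj.
- exact: oD.
- exact: convex_setE.
- exact: D0.
- exact: bdD.
- exact: oO.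
- have [r [_ Hr]] := bO; exists (r + 1) => q Dq.
  have : `|q| <= r + 1 by apply: Hr => //; rewrite ltrDl.
  by rewrite /Num.norm/= ge_max !ler_norml => /andP[].
- exact: cO.
- exists c; first exact: Dc.
  move=> q l Dq l01; have := star q l Dq l01; congr (Dout _).
  rewrite /seg [LHS]surjective_pairing; congr pair.
    by transitivity ((1 - l) * c.1 + l * q.1) => //; ring.
  by transitivity ((1 - l) * c.2 + l * q.2) => //; ring.
- exact: sub.
Qed.

Lemma speed_continuous (gin : R -> R * R) : smooth_simple_closed gin ->
  continuous (fun x => Num.sqrt (dot (derive1 gin x) (derive1 gin x))).
Proof.
move=> [_ _ sm _] x.
have cg : derive1 gin y @[y --> x] --> derive1 gin x.
  by have /derivable1_diffP d := sm 1 x; exact: (differentiable_continuous d).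
exact: cvg_cabs.
Qed.

Lemma derive1_periodic (gin : R -> R * R) : smooth_simple_closed gin ->
  forall x, derive1 gin (x + 1) = derive1 gin x.
Proof.
move=> [per _ sm _] x.
have dg y : is_derive (y : R) 1 gin (derive1 gin y).
  by rewrite derive1E; apply: derivableP; exact: (sm 0 y).
have key (f df : R -> R) : (forall y, f (y + 1) = f y) ->
    (forall y : R, is_derive y 1 f (df y)) -> df (x + 1) = df x.
  move=> fp fd.
  have d3 : is_derive x 1 (fun t : R => t + 1) (1 + 0) by apply: is_deriveD.
  have := @is_derive1_comp _ f (fun t => t + 1) x _ _ (fd (x + 1)) d3.
  have -> : f \o (fun t => t + 1) = f by apply/funext => y /=; exact: fp.
  by rewrite addr0 mulr1 => -[_ <-]; case: (fd x) => _ ->.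
have E1 := key (fun y => (gin y).1) (fun y => (derive1 gin y).1)
  (fun y => congr1 fst (per y)) (fun y => is_derive_fst (dg y)).
have E2 := key (fun y => (gin y).2) (fun y => (derive1 gin y).2)
  (fun y => congr1 snd (per y)) (fun y => is_derive_snd (dg y)).
by rewrite (surjective_pairing (derive1 gin (x + 1))) E1 E2 -surjective_pairing.
Qed.

Lemma ordS_neq (N : nat) (i : 'I_N) : (1 < N)%N -> ordS i != i.
Proof.
case: N i => [|n] i // n1; apply/eqP => /(congr1 val) /= E.
have := ltn_ord i; rewrite leq_eqVlt => /orP[/eqP iE|lt].
  by move: E; rewrite iE modnn => i0; move: iE n1; rewrite -i0 => <-.
by move: E; rewrite modn_small// => /eqP; rewrite gtn_eqF.
Qed.

Lemma next_base_move (N : nat) (u : 'I_N -> R) (i : 'I_N) (x : R) : (1 < N)%N ->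
  next_base (move_base u i x) i = next_base u i.
Proof. by move=> N1; rewrite /next_base /move_base (negbTE (ordS_neq i N1)). Qed.

Lemma weakly_ordered_move_up (N : nat) (u : 'I_N -> R) (i : 'I_N) (x : R) : (1 < N)%N ->
  weakly_ordered u -> u i <= x <= next_base u i -> weakly_ordered (move_base u i x).
Proof.
move=> N1 uo /andP[ux xn] j; have [->|ji] := eqVneq j i.
  by rewrite next_base_move// /move_base eqxx.
rewrite {1}/move_base (negbTE ji); apply: le_trans (uo j) _.
rewrite /next_base /move_base; have [E|_] := eqVneq (ordS j) i; last by [].
by rewrite E; case: ifP => _; rewrite ?lerD2r.
Qed.

Lemma weakly_ordered_move_down (N : nat) (u : 'I_N -> R) (i : 'I_N) (h : R) : (1 < N)%N ->
  weakly_ordered u -> 0 <= h <= next_base u (ord_pred i) - u (ord_pred i) ->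
  weakly_ordered (move_base u i (u i - h)).
Proof.
move=> N1 uo /andP[h0 hg] j; have [->|ji] := eqVneq j i.
  rewrite next_base_move// /move_base eqxx; apply: le_trans (uo i).
  by rewrite gerBl.
rewrite {1}/move_base (negbTE ji).
have := uo j; rewrite /next_base /move_base; have [E|_] := eqVneq (ordS j) i => //.
move=> _; move: hg; rewrite -{1 2}E ordSK /next_base E; case: ifP => _; lra.
Qed.

Lemma iter_ordS (n : nat) (j : 'I_n.+1) (k : nat) :
  val (iter k (@ordS n.+1) j) = ((j + k) %% n.+1)%N.
Proof.
elim: k => [|k IH]; first by rewrite addn0 modn_small.
by rewrite iterS /= IH -addn1 modnDml addn1 addnS.
Qed.

(** The gaps sum to a full turn, so one of them is positive; from there one walks forward to the
    first gap that vanishes. *)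
Lemma positive_before_zero (N : nat) (u : 'I_N -> R) (k : 'I_N) : weakly_ordered u ->
  next_base u k = u k ->
  exists2 i, next_base u i = u i & u (ord_pred i) < next_base u (ord_pred i).
Proof.
case: N u k => [|n] u k; first by case: k.
move=> uo kz.
have [j jpos] : exists j, u j < next_base u j.
  apply: contrapT => H.
  have gap0 i : next_base u i = u (i : 'I_n.+1).
    apply/le_anti; rewrite uo andbT leNgt; apply/negP => lt.
    by apply: H; exists i.
  have : \sum_i next_base u i = \sum_i u i by apply: eq_bigr => i _.
  under eq_bigr => i _.
    rewrite (_ : next_base u i = u (ordS i) + (if i.+1 == n.+1 then 1 else 0)).
      over.
    by rewrite /next_base; case: ifP; rewrite ?addr0.
  rewrite big_split/= sum_indicator_last [X in _ = X](reindex_inj (bij_inj (ordS_bij _)))/=.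
  by move=> E; have := @ltr01 R; lra.
have ex : exists n0, next_base u (iter n0 (@ordS _) j) == u (iter n0 (@ordS _) j).
  exists (k + n.+1 - j)%N.
  have -> : iter (k + n.+1 - j) (@ordS _) j = k.
    apply: val_inj; rewrite iter_ordS subnKC ?modnDr ?modn_small//.
    by rewrite (leq_trans (ltnW (ltn_ord j)))// leq_addl.
  exact/eqP.
case: (ex_minnP ex) => -[|r] /eqP rz rmin.
  by move: jpos; rewrite rz ltxx.
exists (iter r.+1 (@ordS _) j) => //.
rewrite iterS ordSK lt_neqAle uo andbT eq_sym; apply/negP => H.
by have := rmin r H; rewrite ltnn.
Qed.

Section orientation.
Variables (g g' : R -> R * R) (Din Dout : set (R * R)).
Hypothesis A : annular g g' Din Dout.
Local Notation Om := (annulus Din Dout).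
Variables (rho : R * R -> R) (C : R).
Hypothesis rho_meas : measurable_fun Om rho.
Hypothesis rho_pos : forall q, Om q -> 0 < rho q.
Hypothesis rho_le : forall q, Om q -> rho q <= C.
Local Notation M := (cumulative g Din Dout rho).
Local Notation load := (workload Om rho g).

Let loadE N (u : 'I_N -> R) i (uo : weakly_ordered u) : load u i = M (next_base u i) - M (u i) :=
  workloadE A rho_meas rho_pos rho_le i uo.

Lemma workload_empty_arc (N : nat) (u : 'I_N -> R) (i : 'I_N) :
  next_base u i <= u i -> load u i = 0.
Proof.
move=> le; rewrite /workload (_ : subregion Om g u i = set0) ?Rintegral_set0//.
apply/seteqP; split=> z // [x /= /andP[H1 H2] _].
by have := lt_le_trans (lt_trans H1 H2) le; rewrite ltxx.
Qed.

(** Moving base point [i] forward shrinks its arc, and the cumulative workload is nondecreasing, so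
    a strict increase excludes the sign [+1]. If the arc is already empty, both workloads are 0. For
    a single agent the other end of the arc would move along. *)
Lemma oriented_tangent_backward (N : nat) (u : 'I_N -> R) (i : 'I_N) v : (1 < N)%N ->
  weakly_ordered u -> oriented_tangent Om rho g u i v ->
  v = -1 *: unit_tangent g (u i) /\
  \forall h \near 0^'+, load u i < load (move_base u i (u i - h)) i.
Proof.
move=> N1 uo [e [[->|->] -> H]]; last first.
  split; first reflexivity.
  by apply: filterS H => h; rewrite mulN1r; apply.
exfalso.
have : \forall h \near (0 : R)^'+, False; last by move/filter_ex => [].
have := uo i; rewrite le_eqVlt => /orP[/eqP E|lt].
  near=> h.
  have h0 : 0 < h by near: h; exact: nbhs_right_gt.
  have : load u i < load (move_base u i (u i + 1 * h)) i by near: h.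
  rewrite !workload_empty_arc ?ltxx// ?next_base_move// -?E//.
  by rewrite /move_base eqxx mul1r lerDl ltW.
near=> h.
have h0 : 0 < h by near: h; exact: nbhs_right_gt.
have hlt : h < next_base u i - u i by near: h; apply: nbhs_right_lt; rewrite subr_gt0.
have : load u i < load (move_base u i (u i + 1 * h)) i by near: h.
rewrite mul1r.
have uo' : weakly_ordered (move_base u i (u i + h)).
  by apply: weakly_ordered_move_up => //; lra.
rewrite !loadE// next_base_move// /move_base eqxx.
have := cumulative_homo A rho_meas rho_pos rho_le.
by move=> /(_ (u i) (u i + h)); rewrite lerDl ltW// => /(_ isT); lra.
Unshelve. all: by end_near.
Qed.

(** With arc [i] collapsed, the strict gain from moving its base point backward says that [M] is
    smaller just before it; the ground gained belongs to the preceding arc. *)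
Lemma workload_before_collapse (N : nat) (u : 'I_N -> R) (i : 'I_N) v : (1 < N)%N ->
  weakly_ordered u -> oriented_tangent Om rho g u i v ->
  next_base u i = u i -> u (ord_pred i) < next_base u (ord_pred i) ->
  0 < load u (ord_pred i).
Proof.
move=> N1 uo ov zi pos; have [_ H] := oriented_tangent_backward N1 uo ov.
have /filter_ex[h [h0 hlt]] : \forall h \near (0 : R)^'+,
    [/\ 0 < h, h < next_base u (ord_pred i) - u (ord_pred i) &
        load u i < load (move_base u i (u i - h)) i].
  near=> h; split; near: h => //; first exact: nbhs_right_gt.
  by apply: nbhs_right_lt; rewrite subr_gt0.
have uo' : weakly_ordered (move_base u i (u i - h)).
  by apply: weakly_ordered_move_down => //; rewrite !ltW.
rewrite !loadE// next_base_move// /move_base eqxx zi subrr subr_gt0 => lt.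
have Mm := cumulative_homo A rho_meas rho_pos rho_le.
have MT := cumulative_period A rho_meas rho_pos rho_le.
have n1 : next_base u (ord_pred i) =
    u i + (if (ord_pred i).+1 == N then 1 else 0).
  by rewrite /next_base ord_predK; case: ifP; rewrite ?addr0.
rewrite (next_base_quasi_periodic _ _ MT) ord_predK.
have : M (u (ord_pred i)) <= M (u i - h) +
    (if (ord_pred i).+1 == N then total_mass Din Dout rho else 0).
  move: hlt; rewrite n1; case: ifP => _ hlt; last by rewrite addr0; apply: Mm; lra.
  by rewrite -MT; apply: Mm; lra.
lra.
Unshelve. all: by end_near.
Qed.

End orientation.
End Motion.

(** * Exclusion of collisions *)

Section OrderPreservation.
Context {R : realType}.
#[local] Opaque Defs.bar connected_component.

Definition gap (N : nat) (u : 'I_N -> R -> R) (i : 'I_N) (t : R) : R :=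
  next_base (fun j => u j t) i - u i t.

Lemma gap_cvg (N : nat) (u : 'I_N -> R -> R) (i : 'I_N) (t : R) :
  (forall i, {within [set t : R | 0 <= t], continuous (u i)}) -> 0 <= t ->
  gap u i s @[s --> within [set s | 0 <= s] (nbhs t)] --> gap u i t.
Proof.
move=> uc t0.
have cu j : u j s @[s --> within [set s | 0 <= s] (nbhs t)] --> u j t.
  by have /subspace_continuousP := uc j; apply.
rewrite /gap /next_base; case: ifP => _; apply: cvgB; try exact: cu.
by apply: cvgD; [exact: cu|exact: cvg_cst].
Qed.

(* At the first collapse of an arc the two bars bounding it would have to be
   moving apart. *)
Lemma order_preserved (N : nat) (u dw : 'I_N -> R -> R) (P : R -> R) (ell : R) :
  (forall i, {within [set t : R | 0 <= t], continuous (u i)}) ->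
  {homo P : x y / x <= y} -> (forall x, P (x + 1) = P x + ell) ->
  cyclically_ordered (fun i => u i 0) ->
  (forall i (t : R), 0 < t -> weakly_ordered (fun j => u j t) ->
     is_derive t 1 (fun r => P (u i r)) (dw i t)) ->
  (forall i (t : R), 0 < t -> weakly_ordered (fun j => u j t) -> gap u i t = 0 ->
     0 < gap u (ord_pred i) t -> dw i t < dw (ordS i) t) ->
  forall t : R, 0 <= t -> cyclically_ordered (fun i => u i t).
Proof.
move=> uc Pm PT u0 dP dw_lt t1 t10.
have gapE i t : (0 < gap u i t) = (u i t < next_base (fun j => u j t) i).
  by rewrite /gap subr_gt0.
pose B := [set t | 0 <= t /\ exists i, gap u i t <= 0].
suff nB : ~ B t1.
  move=> i; rewrite -gapE ltNge; apply/negP => le; apply: nB; split => //.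
  by exists i.
move=> Bt1.
have lB : has_lbound B by exists 0 => t [].
have iB : has_inf B by split; [exists t1|].
set T := inf B.
have T0 : 0 <= T by apply: lb_le_inf; [exists t1|move=> t []].
have below t i : 0 <= t -> t < T -> 0 < gap u i t.
  move=> t0 tT; rewrite ltNge; apply/negP => le.
  have : B t by split=> //; exists i.
  by move/(ge_inf lB); rewrite leNgt tT.
have [k gk] : exists k, gap u k T <= 0.
  apply: contrapT => H.
  have pos i : 0 < gap u i T by rewrite ltNge; apply/negP => le; apply: H; exists i.
  have : \forall s \near T, forall i, 0 <= s -> 0 < gap u i s.
    apply: (@filter_forall _ _ (fun i s => 0 <= s -> 0 < gap u i s) (nbhs T)) => i.
    exact: (cvgr_gt _ (@gap_cvg N u i T uc T0) _ (pos i)).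
  move=> /nbhs_ballP[e /= e0 He].
  have [s [s0 [i si]] sT] := inf_adherent e0 iB.
  have Ts : T <= s by apply: ge_inf => //; split=> //; exists i.
  have := He s _ i s0; rewrite ltNge si => /(_ _)/negP; apply => //.
  by rewrite /ball/= distrC ger0_norm ?subr_ge0// ltrBlDl.
have Tpos : 0 < T.
  rewrite lt_neqAle T0 andbT; apply/eqP => T0'.
  by have := u0 k; rewrite -gapE => g0; move: gk; rewrite -T0' leNgt g0.
have wo : weakly_ordered (fun j => u j T).
  move=> i; rewrite -subr_ge0 -/(gap u i T) leNgt; apply/negP => neg.
  have H : \forall s \near T, 0 <= s -> gap u i s < 0.
    exact: (cvgr_lt _ (@gap_cvg N u i T uc T0) _ neg).
  have /filter_ex[s [s0 sT Hs]] : \forall s \near T^'-, [/\ 0 <= s, s < T & (0 <= s -> gap u i s < 0)].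
    near=> s; split; near: s.
    - by apply: filterS (nbhs_left_gt Tpos) => s; exact: ltW.
    - exact: nbhs_left_lt.
    - by apply: filterS H => s + _.
  by have := below s i s0 sT; rewrite ltNge (ltW (Hs s0)).
have gap0 i : gap u i T = 0 <-> next_base (fun j => u j T) i = u i T.
  by rewrite /gap; split=> [/eqP|->]; [rewrite subr_eq0 => /eqP|rewrite subrr].
have kz : next_base (fun j => u j T) k = u k T.
  by apply/gap0/le_anti; rewrite gk subr_ge0 wo.
have [i iz ipos] := positive_before_zero wo kz.
have lt : dw i T < dw (ordS i) T.
  by apply: dw_lt => //; [exact/gap0|rewrite gapE].
(* The gap is measured in arc length, where derivatives exist. A positive derivative at [T], where
   the measured gap is zero, would make it negative just before [T]. *)
pose q t := P (u (ordS i) t) - P (u i t).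
have dq : is_derive T 1 q (dw (ordS i) T - dw i T).
  by apply: is_deriveB; exact: dP.
have qE t : P (next_base (fun j => u j t) i) - P (u i t) = q t + (if i.+1 == N then ell else 0).
  by rewrite (next_base_quasi_periodic _ _ PT) /q; ring.
have e0 : 0 < (dw (ordS i) T - dw i T) / 2 by rewrite divr_gt0// subr_gt0.
have := is_derive_nearP dq e0 => H.
have /filter_ex[s [s0 sT Hs]] : \forall s \near T^'-, [/\ 0 < s, s < T &
    `|q s - q T - (dw (ordS i) T - dw i T) * (s - T)| <= (dw (ordS i) T - dw i T) / 2 * `|s - T|].
  near=> s; split; near: s; [exact: nbhs_left_gt|exact: nbhs_left_lt|].
  by apply: filterS H => s + _.
have := below s i (ltW s0) sT; rewrite gapE => /ltW/Pm; rewrite -subr_ge0 qE.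
have := qE T; rewrite iz subrr => qT.
move: Hs; rewrite ler_norml ltr0_norm ?subr_lt0// => /andP[_].
have : 0 < (dw (ordS i) T - dw i T) * (T - s) by rewrite mulr_gt0 ?subr_gt0.
lra.
Unshelve. all: by end_near.
Qed.

End OrderPreservation.

Theorem lemma2 (R : realType)
  (gin gout : R -> R * R) (Din Dout : set (R * R))
  (gin_smooth : smooth_simple_closed gin)
  (gout_smooth : smooth_simple_closed gout)
  (gin_encl : encloses gin Din) (gout_encl : encloses gout Dout)
  (Din_convex : convex_set Din) (Dout_star : star_shaped Dout)
  (in_out : closure Din `<=` Dout)
  (rho : R * R -> R) (rho_lo rho_hi : R)
  (rho_meas : measurable_fun (annulus Din Dout) rho)
  (rho_bounds : forall q, annulus Din Dout q ->
     0 < rho q /\ rho_lo <= rho q <= rho_hi)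
  (kappa : R) (kappa_gt0 : 0 < kappa)
  (N : nat) (s nu : 'I_N -> R -> R * R) (u : 'I_N -> R -> R)
  (m : 'I_N -> R -> R)
  (u_cont : forall i : 'I_N, {within [set t : R | 0 <= t], continuous (u i)})
  (u_order : cyclically_ordered (fun i => u i 0))
  (s_def : forall (i : 'I_N) (t : R), 0 <= t -> s i t = gin (u i t))
  (m_def : forall (i : 'I_N) (t : R), 0 <= t ->
     m i t = workload (annulus Din Dout) rho gin (fun j => u j t) i)
  (nu_def : forall (i : 'I_N) (t : R), 0 <= t ->
     oriented_tangent (annulus Din Dout) rho gin (fun j => u j t) i (nu i t))
  (dynamics : forall (i : 'I_N) (t : R), 0 < t ->
     is_derive t 1 (s i)
       (- kappa * (m i t - m (ord_pred i) t) *: nu i t)) :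
  forall i j : 'I_N, m i t - m j t @[t --> +oo] --> 0.
Proof.
have A := annular_of gin_smooth gin_encl gout_encl Din_convex Dout_star in_out.
have rho_pos q (Oq : annulus Din Dout q) : 0 < rho q := proj1 (rho_bounds q Oq).
have rho_le q (Oq : annulus Din Dout q) : rho q <= rho_hi.
  by have [_ /andP[]] := rho_bounds q Oq.
move=> i j.
(* With at most one agent the two indices coincide; from two agents on, the ends of an arc belong to
   different agents. *)
have [N1|N1] := leqP N 1.
  have -> : i = j.
    by apply: val_inj; have := ltn_ord i; have := ltn_ord j; case: N N1 {s nu u m u_cont u_order s_def m_def nu_def dynamics} i j => [|[|n]]//= _ [[]] // ? [[]].
  by under eq_cvg do rewrite subrr; exact: cvg_cst.
set Om := annulus Din Dout in rho_meas rho_pos rho_le *.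
pose speed x := Num.sqrt (dot (derive1 gin x) (derive1 gin x)).
have cspeed : continuous speed by exact: speed_continuous.
have speed0 x : 0 <= speed x by exact: sqrtr_ge0.
have pspeed x : speed (x + 1) = speed x by rewrite /speed derive1_periodic.
pose P := primitive speed.
have Pm : {homo P : x y / x <= y}.
  by apply: primitive_homo => //; exact: continuous_itv_integrable.
have [ell PT] := primitive_quasi_periodic cspeed pspeed.
pose M := cumulative gin Din Dout rho.
pose T := total_mass Din Dout rho.
have Mm : {homo M : x y / x <= y} := cumulative_homo A rho_meas rho_pos rho_le.
have MT : forall x, M (x + 1) = M x + T := cumulative_period A rho_meas rho_pos rho_le.
have mE i' (t : R) : 0 <= t -> weakly_ordered (fun j => u j t) ->
    m i' t = M (next_base (fun j => u j t) i') - M (u i' t).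
  by move=> t0 wo; rewrite m_def// (workloadE A rho_meas rho_pos rho_le).
have m_ge0 i' (t : R) : 0 <= t -> weakly_ordered (fun j => u j t) -> 0 <= m i' t.
  by move=> t0 wo; rewrite mE// subr_ge0; apply: Mm; exact: wo.
pose dw i' t := kappa * (m i' t - m (ord_pred i') t).
have dP i' (t : R) : 0 < t -> weakly_ordered (fun j => u j t) ->
    is_derive t 1 (fun r => P (u i' r)) (dw i' t).
  move=> t0 wo.
  have [nuE _] := oriented_tangent_backward A rho_meas rho_pos rho_le N1 wo (nu_def i' t (ltW t0)).
  have := dynamics i' t t0; rewrite nuE => ds.
  have cu : u i' r @[r --> t] --> u i' t.
    have /subspace_continuousP/(_ t (ltW t0)) H := u_cont i'.
    move=> U HU; have pos : \forall r \near t, 0 < r by exact: lt_nbhsr.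
    have UH : \forall r \near t, 0 <= r -> U (u i' r) by exact: (H U HU).
    suff : \forall r \near t, U (u i' r) by [].
    near=> r; have r0 : 0 < r by near: r.
    suff : 0 <= r -> U (u i' r) by apply; exact: ltW.
    by near: r.
  have su : \forall r \near t, s i' r = gin (u i' r).
    have : \forall r \near t, 0 < r by exact: lt_nbhsr.
    by apply: filterS => r r0; apply: s_def; exact: ltW.
  have -> : dw i' t = - kappa * (m i' t - m (ord_pred i') t) * -1 by rewrite /dw; ring.
  apply: (arc_length_derive (an_derive A _) (an_neq0 A _) _ cu su ds).
  exact: is_derive_primitive.
have order (t : R) : 0 <= t -> cyclically_ordered (fun i => u i t).
  (* At a first collapse [m i'] is 0, the preceding workload is positive and the following one
     nonnegative, so base point [i'] moves backward while its successor does not. *)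
  apply: (order_preserved u_cont Pm PT u_order dP) => i' r r0 wo gi gp.
  have zi : next_base (fun j => u j r) i' = u i' r.
    by move/eqP: gi; rewrite subr_eq0 => /eqP.
  have pos : 0 < m (ord_pred i') r.
    rewrite m_def ?ltW//.
    apply: (workload_before_collapse A rho_meas rho_pos rho_le N1 wo (nu_def i' r (ltW r0)) zi).
    by rewrite -subr_gt0.
  have mi : m i' r = 0 by rewrite mE ?ltW// zi subrr.
  have := m_ge0 (ordS i') r (ltW r0) wo; rewrite /dw ordSK mi => mS.
  by rewrite ltr_pM2l//; lra.
have wo (t : R) : 0 < t -> weakly_ordered (fun i => u i t).
  by move=> t0 i'; apply/ltW; exact: (order t (ltW t0) i').
have lim := cyclic_flow_consensus kappa_gt0 Mm Pm MT PT
  (convex_potential Mm cspeed speed0) wo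
  (fun i' t t0 => mE i' t (ltW t0) (wo t t0)) (fun i' t t0 => dP i' t t0 (wo t t0)).
by rewrite -(subrr (T / N%:R)); apply: cvgB.
Unshelve. all: by end_near.
Qed.
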